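(* Fix $\varepsilon>0$. Let $M,N$ be positive integers, let $p\in[0,1]$ be such that $(1-p)N$ is an integer, and let $C\ge 1$. Let $F$ be a random $M\times N$ matrix whose entries are drawn independently from a standard normal distribution. If $$\sqrt{\frac{M}{N}}\leq\frac{C-1}{C+1}\sqrt{1-p}-\sqrt{\varepsilon+2p(1-\log p)},$$ then $F$ is a $(p,C)$-numerically erasure-robust frame with overwhelming probability. That is: for every $\alpha>0$ there is a constant $c=c(\varepsilon,\alpha)$ such that, for all positive integers $M,N$, all $p\in[0,1]$ with $(1-p)N$ an integer, and all $C\ge 1$ satisfying $\sqrt{\frac{M}{N}}\leq\frac{C-1}{C+1}\sqrt{1-p}-\sqrt{\varepsilon+2p(1-\log p)}$, the probability that $F$ is not a $(p,C)$-numerically erasure-robust frame is at most $cN^{-\alpha}$.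
   Context: An $M\times N$ frame is an $M\times N$ real or complex matrix whose columns $f_1,\dots,f_N$ span the $M$-dimensional space. For an $M\times K$ matrix $A$, $\mathrm{Cond}(A)$ is the ratio of its greatest singular value to its smallest one, i.e. $\mathrm{Cond}(A)=\sqrt{\lambda_{\max}(AA^* )/\lambda_{\min}(AA^* )}$ where $AA^*$ is $M\times M$, with $\mathrm{Cond}(A)=\infty$ if $A$ has rank less than $M$. For $\mathcal{K}\subseteq\{1,\dots,N\}$, $F_{\mathcal{K}}$ is the submatrix of $F$ formed by the columns indexed by $\mathcal{K}$. Given $p\in[0,1]$ (with $(1-p)N$ an integer) and $C\ge1$, an $M\times N$ frame $F$ is a $(p,C)$-numerically erasure-robust frame if $\mathrm{Cond}(F_{\mathcal{K}})\le C$ for every $\mathcal{K}\subseteq\{1,\dots,N\}$ of size $(1-p)N$. Here $\log$ is the natural logarithm and $p(1-\log p)$ is taken to be $0$ when $p=0$. *)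

(* Defs.v *)
From HB Require Import structures.
From mathcomp Require Import all_boot all_order all_algebra.
From mathcomp Require Import all_classical all_reals all_analysis.

Set Implicit Arguments.
Unset Strict Implicit.
Unset Printing Implicit Defensive.

Import Order.TTheory GRing.Theory Num.Theory.
Import numFieldNormedType.Exports.

Local Open Scope classical_set_scope.
Local Open Scope ring_scope.

(* All matrices are real, so the adjoint A^* of A is its transpose. *)

Section Frames.
Context {R : realType}.

(* Used only for A *m A^T, a real symmetric matrix: in positive dimension its *)
(* set of real eigenvalues is finite and nonempty, so that the supremum       *)
(* (infimum) is the greatest (smallest) eigenvalue.                           *)
Definition lambda_max n (S : 'M[R]_n) : R := sup [set a | eigenvalue S a].
Definition lambda_min n (S : 'M[R]_n) : R := inf [set a | eigenvalue S a].

Definition cond_number m k (A : 'M[R]_(m, k)) : \bar R :=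
  if (\rank A < m)%N then +oo%E
  else (Num.sqrt (lambda_max (A *m A^T) / lambda_min (A *m A^T)))%:E.

Definition is_frame m n (F : 'M[R]_(m, n)) : bool := row_full F^T.

Definition col_submx m n (F : 'M[R]_(m, n)) (K : {set 'I_n}) : 'M[R]_(m, #|K|) :=
  colsub (fun j : 'I_#|K| => enum_val j) F.

Definition is_NERF m n (p C : R) (F : 'M[R]_(m, n)) : Prop :=
  is_frame F /\
  forall K : {set 'I_n}, #|K|%:R = (1 - p) * n%:R ->
    (cond_number (col_submx F K) <= C%:E)%E.

End Frames.

Section RandomMatrices.
Context {d : measure_display} {T : measurableType d} {R : realType}
  {P : probability T R}.

Definition mutually_independent (I : finType) (X : I -> {RV P >-> R}) : Prop :=
  forall (J : {set I}) (B : I -> set R), (forall i, measurable (B i)) ->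
    P (\bigcap_(i in [set` J]) (X i @^-1` B i)) =
    (\prod_(i in J) P (X i @^-1` B i))%E.

(* Equality of measures is only meaningful on the Borel sets. *)
Definition standard_normal (X : {RV P >-> R}) : Prop :=
  forall B : set R, measurable B -> distribution P X B = normal_prob 0 1 B.

Definition iid_standard_normal_mx m n (F : 'M[{RV P >-> R}]_(m, n)) : Prop :=
  mutually_independent (fun ij : 'I_m * 'I_n => F ij.1 ij.2) /\
  forall i j, standard_normal (F i j).

Definition sample_mx m n (F : 'M[{RV P >-> R}]_(m, n)) (t : T) : 'M[R]_(m, n) :=
  \matrix_(i, j) F i j t.

End RandomMatrices.

(* Main.v *)
Require Import Defs.
From HB Require Import structures.
From mathcomp Require Import all_boot all_order all_algebra.
From mathcomp Require Import all_classical all_reals all_analysis.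
From mathcomp Require Import measurable_realfun ring lra.

(** Fix a set [K] of [k = (1 - p) N] columns.  The submatrix [A] of [F] on [K]
    is an [M x k] Gaussian matrix, whose singular values lie between
    [sqrt k - sqrt M - lam] and [sqrt k + sqrt M + lam] outside an event of
    probability about [exp (- lam ^ 2 / 2)].  On these bounds the condition
    number is at most [C] as soon as
    [sqrt M + lam <= (C - 1) / (C + 1) * sqrt k], and the hypothesis, multiplied
    by [sqrt N], allows [lam ^ 2 / 2] to be slightly less than
    [N * (eps / 2 + p (1 - ln p))].  There are [C(N, k) <= exp (N p (1 - ln p))]
    sets [K], so a union bound leaves an exponentially small probability.

    The entropy of the union bound is cancelled exactly, so the constant in
    [exp (- lam ^ 2 / 2)] must be sharp.  It comes from Gordon's comparison of
    the process [<G u, v> + gamma], with [G] a Gaussian matrix and [gamma] an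
    independent Gaussian shared by all pairs of unit vectors [u, v], with the
    separable process [<g, u> + <h, v>]: the covariances of the former are larger
    by [(1 - <u, u'>) (1 - <v, v'>)].  The comparison ([gordon_comparison]) is
    made directly for the exponential functionals
    [softmm x = (\sum_u (\sum_v exp (bet x_uv)) ^ sig) ^ (lam / bet)], which are
    proxies for [exp (lam max x)] when [sig = 1] and for
    [exp (- lam min_u max_v x)] when [sig = -1].  Adding [gamma] multiplies
    their expectation by exactly [exp (lam ^ 2 / 2)], and the separable side is
    controlled by the norms of [g] and [h] alone, which are independent chi
    variables.  Markov's inequality at rate [lam] then gives the tails
    [bilin_max_tail] and [bilin_minmax_tail] without a separate concentration
    inequality.

    The comparison rests on one inequality between second derivatives of
    [softmm] at a fixed point ([laplacian_gordon]).  To pass from it to Gaussian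
    averages, each average is written as [2 ^ k] successive averages over
    directions shorter by [2 ^ (- k / 2)] ([gauss_avg_split]).  On such a short
    average a Taylor expansion holds with an error of third order relative to
    [softmm] itself ([gauss_avg_expansion]), so the [2 ^ k] errors multiply to a
    bounded factor ([gauss_avg_compare]).

    The tails are stated over finite nets of the two spheres; the constants do
    not depend on the nets, which are taken so fine that the passage to all unit
    vectors ([lcomb_upper], [lcomb_lower]) is absorbed by a strict inequality.
    Finally the event that [F] is not robust must be measurable for its
    probability to be compared with that of the exceptional events
    ([measurable_NERF]). *)

Set Implicit Arguments.
Unset Strict Implicit.
Unset Printing Implicit Defensive.

Import Order.TTheory GRing.Theory Num.Theory.
Import numFieldNormedType.Exports.

Local Open Scope classical_set_scope.
Local Open Scope ring_scope.

(** * Gaussian integrals on the line *)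

Section GaussianIntegrals.
Context {R : realType}.
Local Notation mu := (@lebesgue_measure R).
Implicit Types (h : R -> \bar R) (m s c d : R).

Import HBNNSimple.

(** Integration against the Gaussian law is integration against its density:
    for indicators this is the definition of the law, and both sides are limits
    along increasing simple functions. *)
Lemma integral_normal_prob m s h :
  measurable_fun [set: R] h -> (forall x, 0 <= h x)%E ->
  (\int[normal_prob m s]_x h x = \int[mu]_x (h x * (normal_pdf m s x)%:E))%E.
Proof.
move=> mh h0.
have mpdf : measurable_fun setT (fun x => (normal_pdf m s x)%:E : \bar R).
  by apply/measurable_EFinP; exact: measurable_normal_pdf.
have pdf0 x : (0 <= (normal_pdf m s x)%:E)%E by rewrite lee_fin normal_pdf_ge0.
have simple (g : {nnsfun R >-> R}) :
    (\int[normal_prob m s]_x (g x)%:E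
     = \int[mu]_x ((g x)%:E * (normal_pdf m s x)%:E))%E.
  have mpre r : measurable (g @^-1` [set r]).
    by apply: (measurable_funPTI g); exact: measurable_set1.
  have mind r : measurable_fun [set: R] (fun x => (\1_(g @^-1` [set r]) x)%:E : \bar R).
    by apply/measurable_EFinP; exact: measurable_indic.
  have mcell r : measurable_fun [set: R]
      (fun x => (r * \1_(g @^-1` [set r]) x)%:E : \bar R).
    apply/measurable_EFinP; apply: measurable_funM => //; exact: measurable_indic.
  under [LHS]eq_integral do rewrite fimfunE -fsumEFin//.
  rewrite [LHS]ge0_integral_fsum//; last first.
    by move=> n x _; rewrite EFinM nnfun_muleindic_ge0.
  under [RHS]eq_integral.
    move=> x _; rewrite fimfunE -fsumEFin// muleC ge0_mule_fsumr; last first.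
      by move=> r; rewrite EFinM nnfun_muleindic_ge0.
    over.
  rewrite [RHS]ge0_integral_fsum//; last 2 first.
    - by move=> r; apply: emeasurable_funM; [exact: mpdf|exact: mcell].
    - by move=> n x _; rewrite mule_ge0// EFinM nnfun_muleindic_ge0.
  apply: eq_fsbigr => r _; have [r0|r0] := ltP r 0.
    rewrite !integral0_eq// => x _; rewrite preimage_nnfun0// indic0 mulr0//.
    by rewrite mule0.
  under [LHS]eq_integral do rewrite EFinM.
  under [RHS]eq_integral do rewrite EFinM muleCA.
  rewrite !ge0_integralZl//; last 3 first.
    - by apply: emeasurable_funM; [exact: mpdf|exact: mind].
    - by move=> x _; rewrite mule_ge0// lee_fin.
    - exact: mind.
  congr (_ * _)%E; rewrite integral_indic//; last exact: mpre.
  rewrite setIT [LHS]integral_mkcond.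
  apply: eq_integral => x _; rewrite patchE indicE.
  by case: ifP => _; rewrite ?mule1 ?mule0.
pose f_ := nnsfun_approx measurableT mh.
have mf_ n : measurable_fun [set: R] (fun x => (f_ n x)%:E : \bar R).
  by apply/measurable_EFinP; exact: measurable_funP.
have ndf x i j : (i <= j)%N -> f_ i x <= f_ j x.
  by move=> ij; have /lefP := nd_nnsfun_approx measurableT mh ij; apply.
transitivity (lim (\int[normal_prob m s]_x (f_ n x)%:E @[n --> \oo])%E).
  rewrite -monotone_convergence//=.
  - by apply: eq_integral => ? ?; apply/esym/cvg_lim => //=; exact: cvg_nnsfun_approx.
  - by move=> n ? _; rewrite lee_fin.
  - by move=> x _ i j ij; rewrite lee_fin; exact: ndf.
transitivity (lim (\int[mu]_x ((f_ n x)%:E * (normal_pdf m s x)%:E) @[n --> \oo])%E).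
  by apply: congr_lim; apply/funext => n /=; exact: simple.
rewrite -monotone_convergence//=.
- apply: eq_integral => x _; apply/cvg_lim => //=.
  by apply: cvgeZr => //; exact: cvg_nnsfun_approx.
- by move=> n; apply: emeasurable_funM; [exact: mf_|exact: mpdf].
- by move=> n x _; rewrite mule_ge0// lee_fin.
- move=> x _ i j ij; rewrite lee_wpmul2r// lee_fin; exact: ndf.
Qed.

(** The image of Lebesgue measure under the affine map, multiplied by [c],
    agrees with Lebesgue measure on intervals. *)
Lemma lebesgue_integral_affine c d h : 0 < c ->
  measurable_fun [set: R] h -> (forall x, 0 <= h x)%E ->
  (\int[mu]_x h x = c%:E * \int[mu]_x h (c * x + d)%R)%E.
Proof.
move=> c0 mh h0.
pose phi (x : R) : measurableTypeR R := c * x + d.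
have mphi : measurable_fun setT (phi : measurableTypeR R -> _).
  by apply: measurable_funD => //; exact: measurable_funM.
have phi_itv a b : phi @^-1` `]a, b] = `](a - d) / c, (b - d) / c]%classic.
  apply/seteqP; split => x /=; rewrite !in_itv/= /phi.
    by rewrite ltr_pdivrMr// ler_pdivlMr// ltrBlDr lerBrDr mulrC.
  by rewrite ltr_pdivrMr// ler_pdivlMr// ltrBlDr lerBrDr mulrC.
have -> : (\int[mu]_x h (c * x + d)%R = \int[mu]_(x in phi @^-1` setT) (h \o phi) x)%E.
  by rewrite preimage_setT.
rewrite -(ge0_integral_pushforward mphi)//.
have := @ge0_integral_mscale _ _ _ (pushforward mu phi) setT measurableT (NngNum (ltW c0)).
move=> <-//.
apply: eq_measure_integral => A mA _; move: A mA.
apply: lebesgue_measure_unique => _ [[a b]] _ <-.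
rewrite /= /mscale/= /pushforward phi_itv !lebesgue_measure_itv/= !lte_fin.
rewrite ltr_pM2r ?invr_gt0// ltrD2r; case: ifPn => [ab|]; last by rewrite mule0.
by rewrite -EFinD -EFinM; congr EFin; field; rewrite gt_eqF.
Qed.

Lemma lebesgue_integral_opp h :
  measurable_fun [set: R] h -> (forall x, 0 <= h x)%E ->
  (\int[mu]_x h (- x)%R = \int[mu]_x h x)%E.
Proof.
move=> mh h0.
have mN : measurable_fun [set: measurableTypeR R] (-%R : measurableTypeR R -> measurableTypeR R).
  by [].
have -> : (\int[mu]_x h (- x)%R = \int[mu]_(x in -%R @^-1` setT) (h \o -%R) x)%E.
  by rewrite preimage_setT.
rewrite -(ge0_integral_pushforward mN)//.
by apply: eq_measure_integral => A mA _; exact: lebesgue_measureN.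
Qed.

End GaussianIntegrals.

Section StandardGaussian.
Context {R : realType}.
Local Notation mu := (@lebesgue_measure R).
Local Notation gauss := (normal_prob (0 : R) 1).
Implicit Types (h : R -> \bar R) (c x : R).

Lemma standard_normal_pdfE x :
  normal_pdf 0 1 x = normal_peak 1 * expR (- x ^+ 2 / 2).
Proof.
by rewrite normal_pdfE ?oner_eq0// /normal_fun subr0 expr1n.
Qed.

Lemma measurable_standard_pdf :
  measurable_fun [set: R] (fun x => (normal_pdf 0 1 x)%:E : \bar R).
Proof. by apply/measurable_EFinP; exact: measurable_normal_pdf. Qed.

Lemma standard_pdf_ge0 x : (0 <= (normal_pdf 0 1 x)%:E)%E.
Proof. by rewrite lee_fin normal_pdf_ge0. Qed.

Lemma gauss_integral_opp h :
  measurable_fun [set: R] h -> (forall x, 0 <= h x)%E ->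
  (\int[gauss]_x h (- x)%R = \int[gauss]_x h x)%E.
Proof.
move=> mh h0.
apply: (etrans (integral_normal_prob _ _ _ _)) => //.
  exact: (measurableT_comp mh).
apply/esym; apply: (etrans (integral_normal_prob _ _ mh h0)).
rewrite -[LHS]lebesgue_integral_opp; last 2 first.
- by apply: emeasurable_funM => //; exact: measurable_standard_pdf.
- by move=> x; rewrite mule_ge0// standard_pdf_ge0.
by apply: eq_integral => x _; rewrite !standard_normal_pdfE sqrrN.
Qed.

Lemma measurable_expRM c : measurable_fun [set: R] (fun x => expR (c * x)).
Proof. by apply: measurableT_comp => //; exact: measurable_funM. Qed.

(** Completing the square: [expR (c * x)] times the standard density is a
    multiple of the density centred at [c]. *)
Lemma gauss_mgf c :
  (\int[gauss]_x (expR (c * x))%:E = (expR (c ^+ 2 / 2))%:E)%E.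
Proof.
apply: (etrans (integral_normal_prob _ _ _ _)).
- by apply/measurable_EFinP; exact: measurable_expRM.
- by move=> x; rewrite lee_fin expR_ge0.
transitivity ((expR (c ^+ 2 / 2))%:E * \int[mu]_x (normal_pdf c 1 x)%:E)%E; last first.
  by rewrite integral_normal_pdf mule1.
apply: etrans (ge0_integralZl mu measurableT _ _ _).
- apply: eq_integral => x _; rewrite -!EFinM standard_normal_pdfE.
  rewrite normal_pdfE ?oner_eq0// /normal_fun expr1n mulrCA [in RHS]mulrCA -!expRD.
  by congr (EFin (_ * expR _)); field.
- by apply/measurable_EFinP; exact: measurable_normal_pdf.
- by move=> x _; rewrite lee_fin normal_pdf_ge0.
- by rewrite lee_fin expR_ge0.
Qed.

(** [expR (c * x ^+ 2)] times the standard density is a multiple of the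
    Gaussian density of variance [1 / (1 - 2 c)]. *)
Lemma gauss_exp_sqr c : c < 1 / 2 ->
  (\int[gauss]_x (expR (c * x ^+ 2))%:E = (Num.sqrt (1 - 2 * c))^-1%:E)%E.
Proof.
move=> c12.
have m0 : 0 < 1 - 2 * c by lra.
set s := (Num.sqrt (1 - 2 * c))^-1.
have s0 : 0 < s by rewrite invr_gt0 sqrtr_gt0.
have s2 : s ^+ 2 = (1 - 2 * c)^-1 by rewrite exprVn sqr_sqrtr// ltW.
have peakE : normal_peak 1 = s * normal_peak s.
  rewrite /normal_peak expr1n mul1r -mulrnAr sqrtrM ?sqr_ge0// sqrtr_sqr gtr0_norm//.
  by rewrite invfM mulrA divff ?mul1r// gt_eqF.
apply: (etrans (integral_normal_prob _ _ _ _)).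
- apply/measurable_EFinP; apply: measurableT_comp => //.
  by apply: measurable_funM => //; exact: measurable_funX.
- by move=> x; rewrite lee_fin expR_ge0.
transitivity (s%:E * \int[mu]_x (normal_pdf 0 s x)%:E)%E; last first.
  by rewrite integral_normal_pdf mule1.
apply: etrans (ge0_integralZl mu measurableT _ _ _).
- apply: eq_integral => x _; rewrite -!EFinM standard_normal_pdfE.
  rewrite normal_pdfE ?gt_eqF// /normal_fun peakE subr0 s2 mulrCA -expRD !mulrA.
  by congr (EFin (_ * expR _)); field; rewrite gt_eqF.
- by apply/measurable_EFinP; exact: measurable_normal_pdf.
- by move=> x _; rewrite lee_fin normal_pdf_ge0.
- by rewrite lee_fin ltW.
Qed.

(** Rotation invariance in the plane, restricted to the first coordinate. *)
Lemma gauss_convolution h :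
  measurable_fun [set: R] h -> (forall x, 0 <= h x)%E ->
  (\int[gauss]_a \int[gauss]_b h ((a + b) / Num.sqrt 2)%R = \int[gauss]_x h x)%E.
Proof.
move=> mh h0; set r := Num.sqrt 2.
have r0 : 0 < r by rewrite sqrtr_gt0.
have r2 : r ^+ 2 = 2 by rewrite sqr_sqrtr.
pose phi (x : R) : \bar R := (normal_pdf 0 1 x)%:E.
have phi0 x : (0 <= phi x)%E by exact: standard_pdf_ge0.
have mphi : measurable_fun [set: R] phi by exact: measurable_standard_pdf.
have maff (c d : R) : measurable_fun [set: R] (fun x => c * x + d : R).
  by apply: measurable_funD => //; exact: measurable_funM.
have mhr (a : R) : measurable_fun [set: R] (fun b => h ((a + b) / r)%R).
  apply: measurableT_comp => //; apply: measurable_funM => //.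
  exact: measurable_funD.
have shift (a : R) : (\int[gauss]_b h ((a + b) / r)%R
    = r%:E * \int[mu]_c (h c * phi (r * c - a)%R))%E.
  apply: (etrans (integral_normal_prob _ _ (mhr a) _)) => //.
  rewrite (lebesgue_integral_affine (- a) r0);
    [|exact: emeasurable_funM (mhr a) mphi
     |by move=> x; rewrite mule_ge0// standard_pdf_ge0].
  congr (_ * _)%E; apply: eq_integral => c _; congr (h _ * _)%E.
  by field; rewrite gt_eqF.
have mprod : measurable_fun [set: R * R] (fun z => h z.2 * phi (r * z.2 - z.1)%R * phi z.1)%E.
  apply: emeasurable_funM; last exact: (measurableT_comp mphi).
  apply: emeasurable_funM; first exact: (measurableT_comp mh).
  apply: (measurableT_comp mphi); apply: measurable_funB => //.
  exact: measurable_funM.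
have prod0 z : (0 <= h z.2 * phi (r * z.2 - z.1)%R * phi z.1)%E.
  by rewrite !mule_ge0.
under eq_integral do rewrite shift.
have mF : measurable_fun [set: R] (fun a => \int[mu]_c (h c * phi (r * c - a)%R))%E.
  apply: (@measurable_fun_fubini_tonelli_F _ _ _ _ _ mu
    (fun z : R * R => h z.2 * phi (r * z.2 - z.1)%R)%E) => /=.
    apply: emeasurable_funM; first exact: (measurableT_comp mh).
    apply: (measurableT_comp mphi); apply: measurable_funB => //.
    exact: measurable_funM.
  by move=> z; rewrite mule_ge0.
have F0 a : (0 <= \int[mu]_c (h c * phi (r * c - a)%R))%E.
  by apply: integral_ge0 => c _; rewrite mule_ge0.
rewrite [LHS]integral_normal_prob; last 2 first.
- by apply: emeasurable_funM.
- by move=> a; rewrite mule_ge0// lee_fin ltW.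
have mg a : measurable_fun [set: R] (fun c => h c * phi (r * c - a)%R)%E.
  by apply: emeasurable_funM => //; apply: (measurableT_comp mphi); exact: maff.
have inner a : (r%:E * \int[mu]_c (h c * phi (r * c - a)%R) * phi a
    = r%:E * \int[mu]_c (h c * phi (r * c - a)%R * phi a))%E.
  rewrite -muleA; congr (_ * _)%E; apply/esym.
  apply: (ge0_integralZr mu measurableT (mg a)) => //.
  by move=> c _; rewrite mule_ge0.
under eq_integral do rewrite inner.
have mG : measurable_fun [set: R]
    (fun a => \int[mu]_c (h c * phi (r * c - a)%R * phi a))%E.
  exact: (@measurable_fun_fubini_tonelli_F _ _ _ _ _ mu _ mprod prod0).
have mH : measurable_fun [set: R]
    (fun c => \int[mu]_a (h c * phi (r * c - a)%R * phi a))%E.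
  exact: (@measurable_fun_fubini_tonelli_G _ _ _ _ _ mu _ mprod prod0).
have r0e : (0 <= r%:E)%E by rewrite lee_fin ltW.
apply: (etrans (ge0_integralZl mu measurableT mG _ r0e)).
  by move=> a _; apply: integral_ge0 => c _; rewrite !mule_ge0.
have swap : (\int[mu]_a \int[mu]_c (h c * phi (r * c - a)%R * phi a) =
    \int[mu]_c \int[mu]_a (h c * phi (r * c - a)%R * phi a))%E.
  exact: (@fubini_tonelli _ _ _ _ R mu mu
    (fun z : R * R => h z.2 * phi (r * z.2 - z.1)%R * phi z.1)%E mprod prod0).
rewrite swap; apply: etrans (esym (integral_normal_prob 0 1 mh h0)).
rewrite -(ge0_integralZl mu measurableT mH _ r0e); last first.
  by move=> c _; apply: integral_ge0 => a _; rewrite !mule_ge0.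
apply: eq_integral => c _.
(* completing the square: (rc - b)^2 + b^2 = c^2 + (rb - c)^2 *)
have square b : (phi (r * c - b)%R * phi b = phi c * phi (r * b - c)%R)%E.
  rewrite /phi -!EFinM !standard_normal_pdfE; congr EFin.
  rewrite [LHS]mulrACA [RHS]mulrACA -!expRD; congr (_ * expR _).
  rewrite !sqrrB !exprMn r2; ring.
have mphir : measurable_fun [set: R] (fun b => phi (r * b - c)%R).
  by apply: (measurableT_comp mphi); apply: maff.
under eq_integral do rewrite -muleA square muleA.
have hphi0 : (0 <= h c * phi c)%E by rewrite mule_ge0.
have total : (r%:E * \int[mu]_b phi (r * b - c)%R = 1)%E.
  apply: etrans (esym (lebesgue_integral_affine (- c) r0 mphi phi0)) _.
  exact: integral_normal_pdf.
have pull : (\int[mu]_b (h c * phi c * phi (r * b - c)%R) =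
    h c * phi c * \int[mu]_b phi (r * b - c)%R)%E.
  by apply: (ge0_integralZl mu measurableT mphir).
by rewrite pull muleCA total mule1.
Qed.

End StandardGaussian.

Section GaussianMoments.
Context {R : realType}.
Local Notation gauss := (normal_prob (0 : R) 1).
Implicit Types (h : R -> \bar R) (c x : R).

Lemma integrable_gauss_exp c :
  gauss.-integrable [set: R] (fun x => (expR (c * x))%:E).
Proof.
apply/integrableP; split.
  by apply/measurable_EFinP; exact: measurable_expRM.
under eq_integral do rewrite gee0_abs ?lee_fin ?expR_ge0//.
by rewrite gauss_mgf ltry.
Qed.

(** Moments are dominated by [expR x + expR (- x)], whose integral is known. *)
Lemma ler_norm_expD x : `|x| <= expR (1 * x) + expR ((-1) * x).
Proof.
have h1 := expR_ge1Dx (1 * x); have h2 := expR_ge1Dx ((-1) * x).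
have g1 := expR_ge0 (1 * x); have g2 := expR_ge0 ((-1) * x).
by rewrite ler_norml; apply/andP; split; lra.
Qed.

Lemma ler_sqr_expD x : x ^+ 2 <= 2 * (expR (1 * x) + expR ((-1) * x)).
Proof.
wlog x0 : x / 0 <= x => [hw|].
  have [/hw//|x0] := leP 0 x.
  by have := hw (- x); rewrite sqrrN !mulrN !mulNr opprK [expR _ + _]addrC; apply; lra.
have := expR_ge1Dxn 1 x0; rewrite mul1r => h1.
have g2 := expR_ge0 ((-1) * x).
have : x ^+ 2 / 2 <= expR x by apply: le_trans h1; rewrite lerDr ler01.
lra.
Qed.

Lemma integrable_gauss_expD c :
  gauss.-integrable [set: R] (fun x => (expR (c * x) + expR (- c * x))%:E).
Proof.
by under eq_fun do rewrite EFinD; apply: integrableD => //; exact: integrable_gauss_exp.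
Qed.

Lemma integrable_gauss_id : gauss.-integrable [set: R] (fun x => x%:E).
Proof.
apply: (le_integrable _ _ _ (integrable_gauss_expD 1)) => //.
- by apply/measurable_EFinP.
- move=> x _ /=; rewrite lee_fin; apply: le_trans (ler_norm_expD x) _.
  by rewrite ler_norm.
Qed.

Lemma integrable_gauss_sqr : gauss.-integrable [set: R] (fun x => (x ^+ 2)%:E).
Proof.
have hi : gauss.-integrable [set: R]
    (fun x => 2%:E * (expR (1 * x) + expR (- 1 * x))%:E)%E.
  by apply: integrableZl => //; exact: integrable_gauss_expD.
apply: (le_integrable _ _ _ hi) => //.
- by apply/measurable_EFinP; exact: measurable_funX.
- move=> x _ /=; rewrite lee_fin ger0_norm ?sqr_ge0//.
  by apply: le_trans (ler_sqr_expD x) _; rewrite ler_norm.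
Qed.

(** Kept abstract, because it enters both sides of the comparison as the same
    nonnegative factor. *)
Definition gauss_var : R := fine (\int[gauss]_x (x ^+ 2)%:E)%E.

Lemma gauss_var_ge0 : 0 <= gauss_var.
Proof. by apply: fine_ge0; apply: integral_ge0 => x _; rewrite lee_fin sqr_ge0. Qed.

Lemma gauss_integral_id : (\int[gauss]_x x%:E = 0)%E.
Proof.
have hi := integrable_gauss_id.
have fin := integrable_pos_fin_num measurableT hi.
rewrite integralE; set p := fun x : R => x%:E : \bar R.
have -> : (\int[gauss]_x (p ^\- x) = \int[gauss]_x (p ^\+ x))%E.
  rewrite -(gauss_integral_opp (h := p^\+)%E).
  - by apply: eq_integral => x _; rewrite !unlock /p EFinN.
  - by apply: measurable_funepos; apply/measurable_EFinP.
  - by move=> x; exact: funepos_ge0.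
by rewrite subee.
Qed.

Lemma gauss_integral_sqr : (\int[gauss]_x (x ^+ 2)%:E = gauss_var%:E)%E.
Proof. by rewrite fineK//; exact: integrable_fin_num integrable_gauss_sqr. Qed.

Section Quadratic.
Variables al be ka rho c : R.
(** The shape of a second-order Taylor expansion: the odd term integrates to
    zero, and the last term bounds the remainder. *)
Let q x : R := al + be * x + ka * x ^+ 2 + rho * (expR (c * x) + expR (- c * x)).

Lemma integrable_gauss_quadratic : gauss.-integrable [set: R] (fun x => (q x)%:E).
Proof.
have i1 := integrable_gauss_id; have i2 := integrable_gauss_sqr.
have i3 := integrable_gauss_expD c.
have i0 : gauss.-integrable [set: R] (fun=> al%:E).
  exact: finite_measure_integrable_cst.
have z1 := integrableZl measurableT be i1.
have z2 := integrableZl measurableT ka i2.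
have z3 := integrableZl measurableT rho i3.
exact: (integrableD measurableT
  (integrableD measurableT (integrableD measurableT i0 z1) z2) z3).
Qed.

Lemma gauss_integral_quadratic :
  (\int[gauss]_x (q x)%:E = (al + ka * gauss_var + 2 * rho * expR (c ^+ 2 / 2))%:E)%E.
Proof.
have i1 := integrable_gauss_id; have i2 := integrable_gauss_sqr.
have i3 := integrable_gauss_expD c.
have i0 : gauss.-integrable [set: R] (fun=> al%:E).
  exact: finite_measure_integrable_cst.
have ie c' : (\int[gauss]_x (expR (c' * x))%:E = (expR (c' ^+ 2 / 2))%:E)%E.
  exact: gauss_mgf.
have z1 := integrableZl measurableT be i1.
have z2 := integrableZl measurableT ka i2.
have z3 := integrableZl measurableT rho i3.
have d1 := integrableD measurableT i0 z1.
have d2 := integrableD measurableT d1 z2.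
transitivity (\int[gauss]_x (al%:E + be%:E * x%:E + ka%:E * (x ^+ 2)%:E
    + rho%:E * (expR (c * x) + expR (- c * x))%:E))%E.
  by apply: eq_integral.
rewrite (integralD measurableT d2 z3) (integralD measurableT d1 z2).
rewrite (integralD measurableT i0 z1) (integralZl measurableT i1).
rewrite (integralZl measurableT i2) (integralZl measurableT i3).
have -> : (\int[gauss]_x (expR (c * x) + expR (- c * x))%:E
    = (2 * expR (c ^+ 2 / 2))%:E)%E.
  transitivity (\int[gauss]_x ((expR (c * x))%:E + (expR (- c * x))%:E))%E.
    by apply: eq_integral.
  rewrite (integralD measurableT (integrable_gauss_exp c) (integrable_gauss_exp (- c))).
  by rewrite !ie sqrrN -EFinD; congr EFin; ring.
rewrite gauss_integral_id gauss_integral_sqr mule0 adde0.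
have -> : (\int[gauss]_x al%:E = al%:E)%E.
  apply: (etrans (integral_cst gauss measurableT al%:E)).
  by rewrite [X in (_ * X)%E](probability_setT gauss) mule1.
rewrite -!EFinM -!EFinD; congr EFin; ring.
Qed.

Lemma gauss_integral_le_quadratic h :
  measurable_fun [set: R] h -> (forall x, 0 <= h x)%E ->
  (forall x, h x <= (q x)%:E)%E ->
  (\int[gauss]_x h x
    <= (al + ka * gauss_var + 2 * rho * expR (c ^+ 2 / 2))%:E)%E.
Proof.
move=> mh h0 hq; rewrite -gauss_integral_quadratic.
apply: ge0_le_integral => //.
by have /measurable_int := integrable_gauss_quadratic.
Qed.

Lemma gauss_integral_ge_quadratic h :
  measurable_fun [set: R] h -> (forall x, 0 <= h x)%E ->
  (forall x, (q x)%:E <= h x)%E ->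
  ((al + ka * gauss_var + 2 * rho * expR (c ^+ 2 / 2))%:E
    <= \int[gauss]_x h x)%E.
Proof.
move=> mh h0 hq; rewrite -gauss_integral_quadratic integralE.
have mq : measurable_fun [set: R] (fun x => (q x)%:E : \bar R).
  by have /measurable_int := integrable_gauss_quadratic.
apply: (@le_trans _ _ (\int[gauss]_x ((fun x => (q x)%:E)^\+ x)))%E.
  rewrite geeDl// oppe_le0; apply: integral_ge0 => x _; exact: funeneg_ge0.
apply: ge0_le_integral => //.
- by apply: measurable_funepos.
- by move=> x _; rewrite unlock ge_max hq h0.
Qed.

End Quadratic.

End GaussianMoments.

(** * Iterated Gaussian averages *)

Section GaussianAverage.
Context {R : realType} {I : Type}.
Local Notation gauss := (normal_prob (0 : R) 1).
Local Open Scope ereal_scope.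
Implicit Types (x w : I -> R) (ws : seq (I -> R)) (f g : (I -> R) -> \bar R).

Definition shift x w (a : R) : I -> R := fun i => (x i + a * w i)%R.

(** The average of [f] over the Gaussian vectors [x + a1 w1 + ... + ak wk],
    written as an iterated integral. *)
Fixpoint gauss_avg ws f x : \bar R :=
  if ws is w :: ws' then \int[gauss]_a gauss_avg ws' f (shift x w a) else f x.

(** The function space [I -> R] is given no sigma-algebra; measurability is
    tested along every measurable family of coordinates. *)
Definition borel_functional f := forall d (T : measurableType d) (X : T -> I -> R),
  (forall i, measurable_fun [set: T] (X^~ i)) ->
  measurable_fun [set: T] (fun t => f (X t)).

Definition nonneg_functional f := forall x, 0 <= f x.

Lemma gauss_avg_ge0 ws f : nonneg_functional f -> nonneg_functional (gauss_avg ws f).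
Proof. by move=> f0; elim: ws => //= w ws ih x; apply: integral_ge0 => a _. Qed.

Lemma measurable_shift d (T : measurableType d) (X : T -> I -> R) w i :
  measurable_fun [set: T] (X^~ i) ->
  measurable_fun [set: T * R] (fun z => shift (X z.1) w z.2 i).
Proof.
move=> mX; apply: measurable_funD; first exact: (measurableT_comp mX).
exact: measurable_funM.
Qed.

Lemma borel_shift f x w : borel_functional f ->
  measurable_fun [set: R] (fun a => f (shift x w a)).
Proof.
move=> bf; apply: bf => i; apply: measurable_funD => //; exact: measurable_funM.
Qed.

Lemma gauss_avg_borel ws f : borel_functional f -> nonneg_functional f ->
  borel_functional (gauss_avg ws f).
Proof.
move=> bf f0; elim: ws => //= w ws ih d T X mX.
apply: (@measurable_fun_fubini_tonelli_F _ _ _ _ R gauss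
  (fun z : T * R => gauss_avg ws f (shift (X z.1) w z.2))) => /=.
- by apply: ih => i; exact: measurable_shift.
- by move=> z; exact: gauss_avg_ge0.
Qed.

Lemma le_gauss_avg ws f g : borel_functional f -> nonneg_functional f ->
  borel_functional g -> (forall x, f x <= g x) ->
  forall x, gauss_avg ws f x <= gauss_avg ws g x.
Proof.
move=> bf f0 bg fg; have g0 : nonneg_functional g by move=> x; apply: le_trans (fg x).
elim: ws => //= w ws ih x.
apply: ge0_le_integral => //.
- by move=> a _; exact: gauss_avg_ge0.
- by apply: borel_shift; exact: gauss_avg_borel.
- by apply: borel_shift; exact: gauss_avg_borel.
Qed.

Lemma gauss_avg_cat ws1 ws2 f x :
  gauss_avg (ws1 ++ ws2) f x = gauss_avg ws1 (gauss_avg ws2 f) x.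
Proof.
elim: ws1 x => //= w ws ih x; apply: eq_integral => a _; exact: ih.
Qed.

Lemma eq_gauss_avg ws f g : f =1 g -> gauss_avg ws f =1 gauss_avg ws g.
Proof. by move=> fg; elim: ws => //= w ws ih x; apply: eq_integral => a _. Qed.

Lemma gauss_avgZ ws f (c : R) : (0 <= c)%R -> borel_functional f ->
  nonneg_functional f ->
  forall x, gauss_avg ws (fun y => c%:E * f y) x = c%:E * gauss_avg ws f x.
Proof.
move=> c0 bf f0; elim: ws => //= w ws ih x.
transitivity (\int[gauss]_a (c%:E * gauss_avg ws f (shift x w a))).
  by apply: eq_integral.
apply: ge0_integralZl => //; last by move=> a _; exact: gauss_avg_ge0.
by apply: borel_shift; exact: gauss_avg_borel.
Qed.

Lemma gauss_avgD ws f g : borel_functional f -> nonneg_functional f ->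
  borel_functional g -> nonneg_functional g ->
  forall x, gauss_avg ws (fun y => f y + g y) x = gauss_avg ws f x + gauss_avg ws g x.
Proof.
move=> bf f0 bg g0; elim: ws => //= w ws ih x.
transitivity (\int[gauss]_a (gauss_avg ws f (shift x w a) + gauss_avg ws g (shift x w a))).
  by apply: eq_integral.
apply: ge0_integralD => //.
- by move=> a _; exact: gauss_avg_ge0.
- by apply: borel_shift; exact: gauss_avg_borel.
- by move=> a _; exact: gauss_avg_ge0.
- by apply: borel_shift; exact: gauss_avg_borel.
Qed.

Lemma borel_functional_sum (J : Type) (s : seq J) (F : J -> (I -> R) -> \bar R) :
  (forall j, borel_functional (F j)) ->
  borel_functional (fun y => \sum_(j <- s) F j y).
Proof.
move=> bF; elim: s => [|j s ih].
  by move=> d T X mX; under eq_fun do rewrite big_nil; exact: measurable_cst.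
move=> d T X mX; under eq_fun do rewrite big_cons.
by apply: emeasurable_funD; [exact: bF|exact: ih].
Qed.

Lemma gauss_avg_sum ws (J : Type) (s : seq J) (F : J -> (I -> R) -> \bar R) :
  (forall j, borel_functional (F j)) -> (forall j, nonneg_functional (F j)) ->
  forall x, gauss_avg ws (fun y => \sum_(j <- s) F j y) x
            = \sum_(j <- s) gauss_avg ws (F j) x.
Proof.
move=> bF F0 x; elim: s => [|j s ih].
  rewrite big_nil; under eq_gauss_avg do rewrite big_nil.
  by elim: ws x => //= w ws ih x; apply: integral0_eq => a _.
under eq_gauss_avg do rewrite big_cons.
rewrite big_cons gauss_avgD//; [by rewrite ih|exact: borel_functional_sum|].
by move=> y; apply: sume_ge0 => k _; exact: F0.
Qed.

Lemma gauss_avg1C w w' f : borel_functional f -> nonneg_functional f ->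
  forall x, gauss_avg [:: w; w'] f x = gauss_avg [:: w'; w] f x.
Proof.
move=> bf f0 x /=.
pose F (z : R * R) := f (shift (shift x w z.1) w' z.2).
have mF : measurable_fun [set: R * R] F.
  apply: bf => i; apply: measurable_funD; last exact: measurable_funM.
  apply: measurable_funD => //; exact: measurable_funM.
transitivity (\int[gauss]_a \int[gauss]_b F (a, b)); first by [].
apply: etrans (@fubini_tonelli _ _ _ _ R gauss gauss F mF (fun z => f0 _)) _.
apply: eq_integral => b _; apply: eq_integral => a _; congr f.
by apply/funext => i; rewrite /shift/=; ring.
Qed.

Lemma gauss_avg_consC w ws f : borel_functional f -> nonneg_functional f ->
  forall x, gauss_avg (w :: ws) f x = gauss_avg ws (gauss_avg [:: w] f) x.
Proof.
move=> bf f0; elim: ws => [//|w' ws ih] x.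
transitivity (gauss_avg [:: w; w'] (gauss_avg ws f) x); first by [].
rewrite gauss_avg1C; [|exact: gauss_avg_borel|exact: gauss_avg_ge0].
by apply: eq_integral => a _; exact: ih.
Qed.

Lemma gauss_avgC ws1 ws2 f : borel_functional f -> nonneg_functional f ->
  forall x, gauss_avg ws1 (gauss_avg ws2 f) x = gauss_avg ws2 (gauss_avg ws1 f) x.
Proof.
move=> bf f0; elim: ws1 => [//|w ws1 ih] x.
transitivity (gauss_avg [:: w] (gauss_avg ws2 (gauss_avg ws1 f)) x).
  by apply: eq_integral => a _; exact: ih.
by rewrite -gauss_avg_consC //=; [exact: gauss_avg_borel|exact: gauss_avg_ge0].
Qed.

Definition scale_dirs (c : R) ws := map (fun w i => (c * w i)%R) ws.

(** [(a + b) / sqrt 2] is standard Gaussian when [a] and [b] are independent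
    and standard Gaussian. *)
Lemma gauss_avg1_halve w f : borel_functional f -> nonneg_functional f ->
  forall x, let ws := scale_dirs (Num.sqrt 2)^-1%R [:: w] in
  gauss_avg [:: w] f x = gauss_avg ws (gauss_avg ws f) x.
Proof.
move=> bf f0 x /=.
rewrite -(@gauss_convolution _ (fun a => f (shift x w a))); last 2 first.
- exact: borel_shift.
- by move=> a; exact: f0.
apply: eq_integral => a _; apply: eq_integral => b _; congr f.
by apply/funext => i; rewrite /shift/=; ring.
Qed.

(** Each direction is halved separately; the copies are regrouped by
    commutation. *)
Lemma gauss_avg_halve ws f : borel_functional f -> nonneg_functional f ->
  forall x, let ws' := scale_dirs (Num.sqrt 2)^-1%R ws in
  gauss_avg ws f x = gauss_avg ws' (gauss_avg ws' f) x.
Proof.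
move=> bf f0 /=; set c : R := (Num.sqrt 2)^-1%R; elim: ws => [//|w ws ih] x.
rewrite -[w :: ws]cat1s /scale_dirs map_cat -!/(scale_dirs _ _).
rewrite gauss_avg_cat gauss_avg1_halve; [|exact: gauss_avg_borel|exact: gauss_avg_ge0].
rewrite gauss_avg_cat; apply: eq_gauss_avg => y.
transitivity (gauss_avg (scale_dirs c [:: w])
    (gauss_avg (scale_dirs c ws) (gauss_avg (scale_dirs c ws) f)) y).
  exact: eq_gauss_avg.
rewrite gauss_avgC; [|exact: gauss_avg_borel|exact: gauss_avg_ge0].
by apply: eq_gauss_avg => z; rewrite gauss_avg_cat.
Qed.

Lemma iter_gauss_avg_borel n ws f : borel_functional f -> nonneg_functional f ->
  borel_functional (iter n (gauss_avg ws) f) /\ nonneg_functional (iter n (gauss_avg ws) f).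
Proof.
move=> bf f0; elim: n => //= n [bi i0].
by split; [exact: gauss_avg_borel|exact: gauss_avg_ge0].
Qed.

(** Iterating [gauss_avg_halve] makes the directions arbitrarily short, hence
    accessible to a Taylor expansion. *)
Lemma gauss_avg_split k ws f : borel_functional f -> nonneg_functional f ->
  forall x, gauss_avg ws f x
    = iter (2 ^ k) (gauss_avg (scale_dirs (((Num.sqrt 2)^-1 ^+ k)%R) ws)) f x.
Proof.
move=> bf f0; elim: k ws => [|k ih] ws x.
  rewrite /= /scale_dirs expr0; congr (gauss_avg _ _ _).
  by rewrite -[LHS]map_id; apply: eq_map => w; apply/funext => i; rewrite mul1r.
rewrite ih; set ws' := scale_dirs _ ws.
have -> : scale_dirs (((Num.sqrt 2)^-1 ^+ k.+1)%R) ws = scale_dirs (Num.sqrt 2)^-1%R ws'.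
  rewrite /scale_dirs -map_comp; apply: eq_map => w; apply/funext => i /=.
  by rewrite exprS mulrA.
set ws'' := scale_dirs _ ws'.
have -> : (2 ^ k.+1 = 2 * 2 ^ k)%N by rewrite expnS.
elim: (2 ^ k)%N x => [//|n ihn] x.
rewrite mulnS /= -/(muln 2 n); have [bi i0] := iter_gauss_avg_borel n ws' bf f0.
rewrite gauss_avg_halve//; apply: eq_gauss_avg => y; apply: eq_gauss_avg => z.
exact: ihn.
Qed.

(** A one-step comparison with a multiplicative error propagates, because
    averages over different directions commute. *)
Lemma iter_gauss_avg_le (n : nat) ws ws' f (e : R) : (0 <= e)%R ->
  borel_functional f -> nonneg_functional f ->
  (forall x, gauss_avg ws f x <= e%:E * gauss_avg ws' f x) ->
  forall x, iter n (gauss_avg ws) f x <= (e ^+ n)%:E * iter n (gauss_avg ws') f x.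
Proof.
move=> e0 bf f0 step; elim: n => [|n ih] x; first by rewrite expr0 mul1e.
have iterC m vs ws0 y : gauss_avg ws0 (iter m (gauss_avg vs) f) y
    = iter m (gauss_avg vs) (gauss_avg ws0 f) y.
  elim: m y => [//|m ihm] y /=.
  have [bi i0] := iter_gauss_avg_borel m vs bf f0.
  by rewrite gauss_avgC//; apply: eq_gauss_avg => z; exact: ihm.
have [bn n0] := iter_gauss_avg_borel n ws bf f0.
have [bn' n0'] := iter_gauss_avg_borel n ws' bf f0.
have bgf ws0 : borel_functional (gauss_avg ws0 f) by exact: gauss_avg_borel.
have gf0 ws0 : nonneg_functional (gauss_avg ws0 f) by exact: gauss_avg_ge0.
have iterZ m y : iter m (gauss_avg ws) (fun z => e%:E * gauss_avg ws' f z) y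
    = e%:E * iter m (gauss_avg ws) (gauss_avg ws' f) y.
  elim: m y => [//|m ihm] y /=.
  have [bi i0] := iter_gauss_avg_borel m ws (bgf ws') (gf0 ws').
  by rewrite -gauss_avgZ//; apply: eq_gauss_avg => z; exact: ihm.
have be : borel_functional (fun z => e%:E * gauss_avg ws' f z).
  by move=> d T X mX; apply: measurable_funeM; exact: bgf.
have e0' : nonneg_functional (fun z => e%:E * gauss_avg ws' f z).
  by move=> z; apply: mule_ge0; [rewrite lee_fin|exact: gf0].
have mono m y : iter m (gauss_avg ws) (gauss_avg ws f) y
    <= iter m (gauss_avg ws) (fun z => e%:E * gauss_avg ws' f z) y.
  elim: m y => [y|m ihm y]; first exact: step.
  have [bi i0] := iter_gauss_avg_borel m ws (bgf ws) (gf0 ws).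
  have [bj j0] := iter_gauss_avg_borel m ws be e0'.
  by apply: le_gauss_avg.
rewrite {1}/iter -/(iter n _ _) iterC; apply: le_trans (mono n x) _.
rewrite iterZ -iterC exprS EFinM -muleA; apply: lee_wpmul2l; first by rewrite lee_fin.
rewrite /= -gauss_avgZ ?exprn_ge0//; apply: le_gauss_avg => //.
by move=> d T X mX; apply: measurable_funeM; exact: bn'.
Qed.

End GaussianAverage.

Section LinearImage.
Context {R : realType} {I I' : Type}.
Local Open Scope ereal_scope.

(** Used to move an average over vectors of a process to an average over the
    coordinates that drive it. *)
Lemma gauss_avg_linear (L : (I' -> R) -> I -> R)
    (Lshift : forall x w a, L (shift x w a) = shift (L x) (L w) a)
    (ws : seq (I' -> R)) (f : (I -> R) -> \bar R) x :
  gauss_avg (map L ws) f (L x) = gauss_avg ws (f \o L) x.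
Proof.
by elim: ws x => //= w ws ih x; apply: eq_integral => a _; rewrite -Lshift ih.
Qed.

End LinearImage.

Section GaussianProduct.
Context {R : realType} {I : finType}.
Local Open Scope ereal_scope.
Implicit Types (th y : I -> R).

Definition basis (k : I) : I -> R := fun i => (i == k)%:R%R.

Definition exp_quad th y : \bar R := (expR (\sum_k th k * y k ^+ 2)%R)%:E.

Lemma exp_quad_borel th : borel_functional (exp_quad th).
Proof.
move=> d T X mX; apply/measurable_EFinP; apply: measurableT_comp => //.
apply: measurable_sum => k; apply: measurable_funM => //.
by apply: measurable_funX; exact: mX.
Qed.

Lemma exp_quad_ge0 th : nonneg_functional (exp_quad th).
Proof. by move=> y; rewrite lee_fin expR_ge0. Qed.

Lemma gauss_avg_exp_quad th (s : seq I) y :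
  (forall k, th k < 1 / 2)%R -> uniq s -> (forall k, k \in s -> y k = 0%R) ->
  gauss_avg (map basis s) (exp_quad th) y =
  (\prod_(k <- s) (Num.sqrt (1 - 2 * th k))^-1)%R%:E * exp_quad th y.
Proof.
move=> th12; elim: s y => [|k s ih] y /=.
  by rewrite big_nil mul1e.
move=> /andP[ks us] y0.
have stepE a : exp_quad th (shift y (basis k) a)
    = exp_quad th y * (expR (th k * a ^+ 2))%:E.
  rewrite -EFinM -expRD; congr (expR _)%:E.
  rewrite (bigD1 k)//= [in RHS](bigD1 k)//= /shift /basis eqxx y0 ?mem_head//.
  rewrite expr0n/= mulr0 !add0r mulr1 addrC; congr (_ + _)%R.
  by apply: eq_bigr => i /negbTE ->; rewrite mulr0 addr0.
transitivity (\int[normal_prob 0%R 1%R]_a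
    ((\prod_(k <- s) (Num.sqrt (1 - 2 * th k))^-1)%R%:E * exp_quad th y
      * (expR (th k * a ^+ 2))%:E)).
  apply: eq_integral => a _; rewrite ih//; first by rewrite stepE muleA.
  move=> i si; rewrite /shift /basis y0 ?inE ?si ?orbT//.
  by case: eqP => [ik|_]; [move: ks; rewrite -ik si|rewrite mulr0 addr0].
have prod0 : (0 <= \prod_(k <- s) (Num.sqrt (1 - 2 * th k))^-1)%R.
  by apply: prodr_ge0 => i _; rewrite invr_ge0.
apply: (etrans (ge0_integralZl _ measurableT _ _ _)).
- apply/measurable_EFinP; apply: measurableT_comp => //.
  by apply: measurable_funM => //; exact: measurable_funX.
- by move=> a _; rewrite lee_fin expR_ge0.
- by rewrite mule_ge0 ?lee_fin// expR_ge0.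
- by rewrite gauss_exp_sqr// big_cons EFinM muleC muleA.
Qed.

End GaussianProduct.

(** * Expectations as Gaussian averages *)

Section GaussianLaw.
Context {d : measure_display} {T : measurableType d} {R : realType}
  {P : probability T R} {J : finType}.
Variable X : J -> {RV P >-> R}.
Hypothesis indepX : mutually_independent X.
Hypothesis normalX : forall j, standard_normal (X j).
Local Notation gauss := (normal_prob (0 : R) 1).
Local Open Scope ereal_scope.

Lemma measurable_preimage_RV (Y : {RV P >-> R}) (B : set R) :
  measurable B -> measurable (Y @^-1` B).
Proof. by move=> mB; apply: measurable_funPTI. Qed.

Section SplitOne.
Variables (j : J) (S : {set J}).
Hypothesis jS : j \notin S.

Definition cylinders : set (set T) :=
  [set D | exists B : J -> set R, (forall i, measurable (B i)) /\
     D = \bigcap_(i in [set` S]) (X i @^-1` B i)].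

Lemma cylinders_measurable : cylinders `<=` measurable.
Proof.
move=> _ [B [mB ->]]; apply: fin_bigcap_measurable => // i _.
exact: measurable_preimage_RV.
Qed.

Lemma cylinders_setI : setI_closed cylinders.
Proof.
move=> _ _ [B [mB ->]] [C [mC ->]]; exists (fun i => B i `&` C i); split.
  by move=> i; exact: measurableI.
by rewrite -bigcapI; apply: eq_bigcapr => i _; rewrite preimage_setI.
Qed.

Lemma cylinders_setT : cylinders setT.
Proof.
exists (fun=> setT); split=> //; apply/esym/seteqP; split=> // t _ i _.
Qed.

Lemma normal_preimage (A : set R) i : measurable A -> P (X i @^-1` A) = gauss A.
Proof. exact: normalX. Qed.

(** Both sides are finite measures in [D]; by independence they agree on the
    cylinders, which are stable under intersection. *)
Lemma indep_cylinder (A : set R) (D : set T) : measurable A -> <<s cylinders >> D ->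
  P (X j @^-1` A `&` D) = gauss A * P D.
Proof.
move=> mA; have mXA := measurable_preimage_RV (X j) mA.
pose gA : {nonneg R} := NngNum (fine_ge0 (measure_ge0 gauss A)).
have gAE : gA%:num%:E = gauss A by rewrite /= fineK// fin_num_measure.
have mscaleE E : mscale gA P E = gauss A * P E by rewrite -gAE.
suff : forall D, <<s cylinders >> D -> mrestr P mXA D = mscale gA P D.
  by move=> /[apply]; rewrite mscaleE /mrestr setIC.
apply: (g_sigma_algebra_measure_unique cylinders cylinders_measurable (fun=> setT)).
- by move=> _; exact: cylinders_setT.
- by rewrite bigcup_const.
- exact: cylinders_setI.
- move=> _ [B [mB ->]]; apply: etrans _ (esym (mscaleE _)).
  rewrite /= /mrestr (indepX S mB) setIC.
  pose B' i := if i == j then A else B i.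
  have mB' i : measurable (B' i) by rewrite /B'; case: ifP.
  have inS i : i \in S -> B' i = B i.
    by rewrite /B'; case: eqP => // ->; rewrite (negbTE jS).
  have -> : X j @^-1` A `&` \bigcap_(i in [set` S]) (X i @^-1` B i)
      = \bigcap_(i in [set` j |: S]%SET) (X i @^-1` B' i).
    apply/seteqP; split=> t.
      move=> [Aj BS] i /=; rewrite !inE => /orP[/eqP ->|iS].
        by rewrite /B' eqxx.
      by rewrite inS//; exact: BS.
    move=> Bt; split.
      by have := Bt j; rewrite /= setU11 /B' eqxx; apply.
    by move=> i iS; rewrite -inS//; apply: Bt; rewrite /= setU1r.
  rewrite (indepX _ mB') big_setU1//= /B' eqxx normal_preimage//; congr (_ * _).
  by apply: eq_bigr => i iS; rewrite -/(B' i) inS.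
- by move=> _; rewrite /= /mrestr setTI (le_lt_trans (probability_le1 P mXA))// ltry.
Qed.

Local Notation T' := (g_sigma_algebraType cylinders).

(** The joint law of [X j] and of the identity of [T], the latter carrying only
    the sigma-algebra of the coordinates in [S], is a product; Tonelli's
    theorem integrates [X j] out first. *)
Lemma integral_split_coordinate (g : R -> T -> \bar R) :
  measurable_fun [set: R * T'] (fun z => g z.1 z.2) -> (forall a t, 0 <= g a t) ->
  \int[P]_t g (X j t) t = \int[gauss]_a \int[P]_t g a t.
Proof.
move=> mg g0.
have mid : measurable_fun [set: T] (id : T -> T').
  move=> _ D mD; rewrite setTI preimage_id.
  apply: (smallest_sub (@sigma_algebra_measurable _ T) cylinders_measurable) => //.
pose idm : {mfun T >-> T'} := HB.pack (id : T -> T') (isMeasurableFun.Build _ _ _ _ _ mid).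
pose phi (t : T) : measurableTypeR R * T' := (X j t, t).
have mphi : measurable_fun [set: T] phi.
  by apply: measurable_fun_pair; [exact: (measurable_funPT (X j))|exact: mid].
pose phim : {mfun T >-> (measurableTypeR R * T')%type} := HB.pack phi (isMeasurableFun.Build _ _ _ _ _ mphi).
pose P' := distribution P idm.
have rect (A : set R) (D : set T') : measurable A -> measurable D ->
    distribution P phim (A `*` D) = gauss A * P' D.
  by move=> mA mD; rewrite [RHS](_ : _ = gauss A * P D)// -indep_cylinder.
pose joint := @product_measure_unique _ _ _ _ R gauss P' (distribution P phim) rect.
transitivity (\int[distribution P phim]_z g z.1 z.2).
  rewrite ge0_integral_distribution//.
transitivity (\int[gauss \x P']_z g z.1 z.2).
  by apply: eq_measure_integral => E mE _; exact/esym/joint.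
rewrite fubini_tonelli1//; apply: eq_integral => a _.
rewrite /fubini_F ge0_integral_distribution//.
exact: (measurableT_comp mg (measurable_pair1 a)).
Qed.

End SplitOne.

(** The coordinates are integrated out one at a time; independence makes each
    of them Gaussian whatever the values of the others. *)
Lemma expectation_gauss_avg {I : Type} (w : J -> I -> R) (s : seq J)
    (f : (I -> R) -> \bar R) (x : I -> R) :
  uniq s -> borel_functional f -> nonneg_functional f ->
  \int[P]_t f (fun i => x i + \sum_(j <- s) X j t * w j i)%R = gauss_avg (map w s) f x.
Proof.
move=> us bf f0; elim: s x us => [|j s ih] x /=.
  move=> _; transitivity (\int[P]_t f x).
    by apply: eq_integral => t _; congr f; apply/funext => i; rewrite big_nil addr0.
  apply: (etrans (integral_cst P measurableT (f x))).
  by rewrite [X in _ * X](probability_setT P) mule1.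
move=> /andP[js us].
have jS : j \notin [set i in s]%SET by rewrite inE.
pose g a t := f (fun i => shift x (w j) a i + \sum_(k <- s) X k t * w k i)%R.
transitivity (\int[P]_t g (X j t) t).
  apply: eq_integral => t _; congr f; apply/funext => i.
  by rewrite big_cons /shift addrA.
rewrite (integral_split_coordinate jS); last 2 first.
- apply: bf => i; apply: measurable_funD.
    by apply: measurable_funD => //; exact: measurable_funM.
  have -> : (fun z : R * g_sigma_algebraType (cylinders [set i in s]%SET) =>
      \sum_(k <- s) X k z.2 * w k i)%R =
      (fun z => \sum_(k <- s) (if k \in s then X k z.2 else 0) * w k i)%R.
    apply/funext => z; rewrite big_seq [RHS]big_seq.
    by apply: eq_bigr => k ks; rewrite ks.
  apply: measurable_sum => k; apply: measurable_funM => //.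
  case: (boolP (k \in s)) => ks; last exact: measurable_cst.
  apply: (@measurableT_comp _ _ _ _ _ _
    (X k : g_sigma_algebraType (cylinders [set i in s]%SET) -> R)) => //.
  move=> _ B mB; rewrite setTI; apply: sub_sigma_algebra.
  exists (fun i => if i == k then B else setT); split.
    by move=> l; case: ifP.
  apply/seteqP; split=> t.
    by move=> Bt l _; rewrite /preimage/=; case: eqP => // ->.
  by move=> /(_ k); rewrite /preimage/= inE ks eqxx; apply.
- by move=> a t; exact: f0.
by apply: eq_integral => a _; exact: ih.
Qed.

End GaussianLaw.

(** * Second-order calculus on the line *)

Section Calculus.
Context {R : realType}.
Implicit Types (g h : R -> R) (s t E : R).

Lemma is_derive_exp g s dg : is_derive s (1 : R) g dg ->
  is_derive s (1 : R) (fun t => expR (g t)) (expR (g s) * dg).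
Proof. by move=> dg1; apply: (@is_derive1_comp _ expR g); exact: is_derive_expR. Qed.

Lemma is_derive_log g s dg : 0 < g s -> is_derive s (1 : R) g dg ->
  is_derive s (1 : R) (fun t => ln (g t)) (dg / g s).
Proof.
move=> g0 dg1; rewrite mulrC; apply: (@is_derive1_comp _ (@ln R) g) => //.
exact: is_derive1_ln.
Qed.

Lemma is_derive_fsum (K : finType) (G dG : K -> R -> R) s :
  (forall k, is_derive s (1 : R) (G k) (dG k s)) ->
  is_derive s (1 : R) (fun t => \sum_k G k t) (\sum_k dG k s).
Proof.
move=> dk; have -> : (fun t => \sum_k G k t) = \sum_(i < #|K|) G (enum_val i).
  apply/funext => t; rewrite (reindex_onto (@enum_val K predT) enum_rank)/=; last first.
    by move=> k _; exact: enum_rankK.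
  by rewrite fct_sumE; apply: eq_bigl => i; rewrite enum_valK eqxx.
have -> : \sum_k dG k s = \sum_(i < #|K|) dG (enum_val i) s.
  rewrite (reindex_onto (@enum_val K predT) enum_rank)/=; last first.
    by move=> k _; exact: enum_rankK.
  by apply: eq_bigl => i; rewrite enum_valK eqxx.
by apply: is_derive_sum => i; exact: dk.
Qed.

Lemma is_derive_mul g h s dg dh :
  is_derive s (1 : R) g dg -> is_derive s (1 : R) h dh ->
  is_derive s (1 : R) (fun t => g t * h t) (dg * h s + g s * dh).
Proof.
move=> dg1 dh1; have := @is_deriveM _ _ g h s 1 dg dh dg1 dh1.
by move=> H; apply: is_derive_eq H _; rewrite addrC /GRing.scale/= [h s * _]mulrC.
Qed.

Lemma is_derive_scale g (c : R) s dg :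
  is_derive s (1 : R) g dg -> is_derive s (1 : R) (fun t => c * g t) (c * dg).
Proof. by move=> dg1; exact: (@is_deriveZ _ _ _ g c). Qed.

Lemma is_derive_quot g h s dg dh : 0 < h s ->
  is_derive s (1 : R) g dg -> is_derive s (1 : R) h dh ->
  is_derive s (1 : R) (fun t => g t / h t) (dg / h s - g s / h s * (dh / h s)).
Proof.
move=> h0 dg1 dh1.
have dV := @is_deriveV _ h s dh 1 (lt0r_neq0 h0) dh1.
apply: is_derive_eq (is_derive_mul dg1 dV) _.
by rewrite /GRing.scale/=; field; exact: lt0r_neq0.
Qed.

Lemma is_derive_affine (c b s : R) : is_derive s (1 : R) (fun t => c + t * b) b.
Proof.
have := @is_deriveD _ _ _ (cst c) (fun t => b * t) s 1 0 (b * 1)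
  (is_derive_cst _ _ _) (is_derive_scale b (is_derive_id _ _)).
rewrite add0r mulr1 => H; have -> // : (fun t => c + t * b) = cst c + (fun t => b * t).
by apply/funext => t; rewrite /GRing.add/= mulrC.
Qed.

Lemma derivative_bound g dg E s :
  (forall t, is_derive t (1 : R) g (dg t)) ->
  (forall t, `|t| <= `|s| -> `|dg t| <= E) -> `|g s - g 0| <= E * `|s|.
Proof.
move=> dgP bound.
have cg a b : {within `[a, b], continuous g}.
  apply: continuous_subspaceT => t; apply/differentiable_continuous/derivable1_diffP.
  by case: (dgP t).
have [s0|s0] := leP 0 s.
  have [t] := MVT_segment s0 (fun t _ => dgP t) (cg _ _).
  rewrite in_itv/= subr0 => /andP[t0 ts] ->.
  rewrite normrM ler_wpM2r// bound// !ger0_norm//.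
have [t] := MVT_segment (ltW s0) (fun t _ => dgP t) (cg _ _).
rewrite in_itv/= => /andP[ts t0] gE.
rewrite distrC gE normrM sub0r normrN ler_wpM2r// bound//.
by rewrite !ler0_norm ?lerN2// ltW.
Qed.

(** The error is expressed by the oscillation of [g2] and not by a third
    derivative, because the functional of interest controls the oscillation of
    its own second derivative. *)
Lemma taylor2_bound g g1 g2 E s :
  (forall t, is_derive t (1 : R) g (g1 t)) ->
  (forall t, is_derive t (1 : R) g1 (g2 t)) ->
  (forall t, `|t| <= `|s| -> `|g2 t - g2 0| <= E) ->
  `|g s - (g 0 + g1 0 * s + g2 0 / 2 * s ^+ 2)| <= E * `|s| ^+ 2.
Proof.
move=> dg dg1 bound.
have dpoly (c b a t : R) : is_derive t (1 : R) (fun r => c + r * b + r * r * a)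
    (b + 2 * t * a).
  have h1 := is_derive_affine c b t.
  have h2 := is_derive_mul (is_derive_id t 1) (is_derive_id t 1).
  have h3 := is_derive_scale a h2.
  have -> : b + 2 * t * a = b + a * (1 * t + t * 1) by ring.
  have := is_deriveD h1 h3; have -> // : (fun r => c + r * b + r * r * a)
     = (fun t => c + t * b) + (fun t => a * (t * t)).
  by apply/funext => r; rewrite /GRing.add/= [a * _]mulrC.
have dB h dh (p dp : R -> R) t : is_derive t (1 : R) h dh -> is_derive t (1 : R) p (dp t) ->
    is_derive t (1 : R) (fun r => h r - p r) (dh - dp t).
  by move=> H1 H2; exact: is_deriveB.
have E0 : 0 <= E by apply: le_trans (bound 0 _); rewrite ?normr0.
have first_order t : `|t| <= `|s| -> `|g1 t - (g1 0 + t * g2 0)| <= E * `|s|.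
  move=> ts; have := @derivative_bound (fun r => g1 r - (g1 0 + r * g2 0))
    (fun r => g2 r - g2 0) E t.
  rewrite mul0r addr0 subrr subr0 => H; apply: le_trans (H _ _) _.
  - by move=> r; apply: (dB _ _ _ (fun=> g2 0)) => //; exact: is_derive_affine.
  - by move=> r rt; apply: bound; exact: le_trans ts.
  - by rewrite ler_wpM2l.
have := @derivative_bound (fun r => g r - (g 0 + r * g1 0 + r * r * (g2 0 / 2)))
  (fun r => g1 r - (g1 0 + r * g2 0)) (E * `|s|) s.
rewrite !mul0r !addr0 subrr subr0 => H.
have -> : g 0 + g1 0 * s + g2 0 / 2 * s ^+ 2 = g 0 + s * g1 0 + s * s * (g2 0 / 2) by ring.
have -> : E * `|s| ^+ 2 = E * `|s| * `|s| by rewrite expr2 mulrA.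
apply: H => // t; have -> : g1 t - (g1 0 + t * g2 0) = g1 t - (g1 0 + 2 * t * (g2 0 / 2)) by field.
by apply: (dB _ _ _ (fun t => g1 0 + 2 * t * (g2 0 / 2))).
Qed.

End Calculus.

(** * The soft minimax and its derivatives *)

Section WeightedAverages.
Context {R : realType} {K : finType}.
Implicit Types (p g : K -> R).

Lemma avg_bound p g G : (forall k, 0 <= p k) -> \sum_k p k = 1 ->
  (forall k, `|g k| <= G) -> `|\sum_k p k * g k| <= G.
Proof.
move=> p0 p1 gG; apply: le_trans (ler_norm_sum _ _ _) _.
rewrite -[leRHS]mul1r -p1 mulr_suml; apply: ler_sum => k _.
by rewrite normrM ger0_norm// ler_wpM2l.
Qed.

Lemma avg_perturb p p' g g' (tau G E : R) :
  (forall k, 0 <= p k) -> \sum_k p k = 1 ->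
  (forall k, p' k <= tau * p k) -> (forall k, p k <= tau * p' k) -> 1 <= tau ->
  (forall k, `|g' k| <= G) -> (forall k, `|g' k - g k| <= E) ->
  `|\sum_k p' k * g' k - \sum_k p k * g k| <= (tau - 1) * G + E.
Proof.
move=> p0 p1 up lo tau1 gG gE.
have dp k : `|p' k - p k| <= (tau - 1) * p k.
  have u := up k; have l := lo k; have p0k := p0 k.
  have t0 : 0 < tau by lra.
  rewrite ler_norml; apply/andP; split; last by lra.
  (* p' >= p / tau >= (2 - tau) p *)
  have : tau * (2 - tau) * p k <= tau * p' k.
    apply: le_trans l; rewrite ler_piMl//.
    have : 0 <= (tau - 1) ^+ 2 by exact: sqr_ge0.
    by nra.
  by rewrite -mulrA ler_pM2l//; lra.
have -> : \sum_k p' k * g' k - \sum_k p k * g k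
    = \sum_k (p' k - p k) * g' k + \sum_k p k * (g' k - g k).
  by rewrite -sumrB -big_split; apply: eq_bigr => k _ /=; ring.
apply: le_trans (ler_normD _ _) _; apply: lerD; last exact: avg_bound.
apply: le_trans (ler_norm_sum _ _ _) _.
have -> : (tau - 1) * G = \sum_k (tau - 1) * p k * G.
  by rewrite -mulr_suml -mulr_sumr p1 mulr1.
apply: ler_sum => k _.
by rewrite normrM; apply: ler_pM.
Qed.

End WeightedAverages.

Section SoftMinimax.
Context {R : realType} (Iu Iv : finType) (u0 : Iu) (v0 : Iv).
Variables (lam bet sig : R).
Hypotheses (lam0 : 0 < lam) (lambet : lam <= bet) (sig1 : `|sig| <= 1).
Local Notation I := (Iu * Iv)%type.
Implicit Types (x w h : I -> R) (u : Iu) (v : Iv).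

Definition rowsum x u : R := \sum_v expR (bet * x (u, v)).
Definition rowpow x u : R := expR (sig * ln (rowsum x u)).
Definition total x : R := \sum_u rowpow x u.

(** A smooth proxy for [exp (lam * max x)] when [sig = 1], and for
    [exp (- lam * min_u max_v x)] when [sig = -1]. *)
Definition softmm x : R := expR (lam / bet * ln (total x)).

(** [colwt] and [rowwt] are the Gibbs weights: the logarithmic derivatives of
    [rowsum] and [total] are averages against them. *)
Definition colwt x u v : R := expR (bet * x (u, v)) / rowsum x u.
Definition rowwt x u : R := rowpow x u / total x.
Definition colavg x h u : R := \sum_v colwt x u v * h (u, v).
Definition rowavg x (g : Iu -> R) : R := \sum_u rowwt x u * g u.

Let bet0 : 0 < bet. Proof. exact: lt_le_trans lambet. Qed.

Lemma fsum_gt0 (K : finType) (k0 : K) (F : K -> R) : (forall k, 0 < F k) -> 0 < \sum_k F k.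
Proof.
move=> F0; rewrite (bigD1 k0)//= ltr_pwDl// sumr_ge0// => k _; exact: ltW.
Qed.

Lemma rowsum_gt0 x u : 0 < rowsum x u.
Proof. by apply: (fsum_gt0 v0) => v; exact: expR_gt0. Qed.

Lemma total_gt0 x : 0 < total x.
Proof. by apply: (fsum_gt0 u0) => u; exact: expR_gt0. Qed.

Lemma softmm_gt0 x : 0 < softmm x. Proof. exact: expR_gt0. Qed.

Lemma colwt_ge0 x u v : 0 <= colwt x u v.
Proof. by rewrite divr_ge0 ?expR_ge0// ltW// rowsum_gt0. Qed.

Lemma rowwt_ge0 x u : 0 <= rowwt x u.
Proof. by rewrite divr_ge0 ?expR_ge0// ltW// total_gt0. Qed.

Lemma sum_colwt x u : \sum_v colwt x u v = 1.
Proof. by rewrite -mulr_suml mulfV// gt_eqF// rowsum_gt0. Qed.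

Lemma sum_rowwt x : \sum_u rowwt x u = 1.
Proof. by rewrite -mulr_suml mulfV// gt_eqF// total_gt0. Qed.

Definition close (m : R) x x' := forall i, `|x' i - x i| <= m.

Lemma close_sym m x x' : close m x x' -> close m x' x.
Proof. by move=> c i; rewrite distrC. Qed.

Section Perturb.
Variables (m : R) (x x' : I -> R).
Hypothesis cl : close m x x'.

Lemma close_exp u v : expR (bet * x' (u, v)) <= expR (bet * m) * expR (bet * x (u, v)).
Proof.
rewrite -expRD ler_expR -mulrDr ler_pM2l//.
by have := cl (u, v); rewrite ler_norml => /andP[_]; lra.
Qed.

Lemma close_rowsum u : rowsum x' u <= expR (bet * m) * rowsum x u.
Proof. by rewrite mulr_sumr; apply: ler_sum => v _; exact: close_exp. Qed.
End Perturb.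

Lemma close_ln_rowsum m x x' u : close m x x' ->
  `|ln (rowsum x' u) - ln (rowsum x u)| <= bet * m.
Proof.
have half y y' : close m y y' -> ln (rowsum y' u) <= bet * m + ln (rowsum y u).
  move=> cl; rewrite -{1}(expRK (bet * m)) -lnM ?posrE ?expR_gt0 ?rowsum_gt0//.
  by rewrite ler_ln ?posrE ?mulr_gt0 ?expR_gt0 ?rowsum_gt0//; exact: close_rowsum.
move=> cl; have h1 := half _ _ cl; have h2 := half _ _ (close_sym cl).
by rewrite ler_norml; apply/andP; split; lra.
Qed.

Lemma close_rowpow m x x' u : close m x x' -> rowpow x' u <= expR (bet * m) * rowpow x u.
Proof.
move=> cl; rewrite -expRD ler_expR -lerBlDr -mulrBr.
apply: le_trans (ler_norm _) _; rewrite normrM.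
apply: le_trans (close_ln_rowsum u cl); rewrite ler_piMl//.
Qed.

Lemma close_total m x x' : close m x x' -> total x' <= expR (bet * m) * total x.
Proof. by move=> cl; rewrite mulr_sumr; apply: ler_sum => u _; exact: close_rowpow. Qed.

(** The exponent [lam / bet] turns the Lipschitz constant [bet] of the
    logarithm of [total] into [lam]. *)
Lemma close_softmm m x x' : close m x x' -> softmm x' <= expR (lam * m) * softmm x.
Proof.
move=> cl; rewrite -expRD ler_expR.
have -> : lam * m = lam / bet * (bet * m) by field; exact: lt0r_neq0.
rewrite -mulrDr ler_pM2l ?divr_gt0// -{1}(expRK (bet * m)).
rewrite -lnM ?posrE ?expR_gt0 ?total_gt0// ler_ln ?posrE ?mulr_gt0 ?expR_gt0 ?total_gt0//.
exact: close_total.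
Qed.

Let ratio_le (a a' b b' e : R) : 0 < b -> 0 < b' -> 0 <= a -> 0 <= a' -> 0 < e ->
  a' <= e * a -> b <= e * b' -> a' / b' <= e ^+ 2 * (a / b).
Proof.
move=> b0 b0' a0 a0' e0 ha hb.
rewrite ler_pdivrMr//.
have -> : e ^+ 2 * (a / b) * b' = e * a * (e * b') / b by field; rewrite gt_eqF.
by rewrite ler_pdivlMr//; apply: ler_pM => //; exact: ltW.
Qed.

Lemma close_colwt m x x' u v : close m x x' ->
  colwt x' u v <= expR (2 * bet * m) * colwt x u v.
Proof.
move=> cl; have -> : expR (2 * bet * m) = expR (bet * m) ^+ 2.
  by rewrite expr2 -expRD; congr expR; ring.
apply: ratio_le; rewrite ?rowsum_gt0 ?expR_ge0 ?expR_gt0//.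
  exact: close_exp.
exact: close_rowsum (close_sym cl) u.
Qed.

Lemma close_rowwt m x x' u : close m x x' ->
  rowwt x' u <= expR (2 * bet * m) * rowwt x u.
Proof.
move=> cl; have -> : expR (2 * bet * m) = expR (bet * m) ^+ 2.
  by rewrite expr2 -expRD; congr expR; ring.
apply: ratio_le; rewrite ?total_gt0 ?expR_ge0 ?expR_gt0//.
  exact: close_rowpow.
exact: close_total (close_sym cl).
Qed.

Lemma colavg_bound x h u G : (forall i, `|h i| <= G) -> `|colavg x h u| <= G.
Proof. by move=> hG; apply: avg_bound => // *; rewrite ?colwt_ge0 ?sum_colwt. Qed.

Lemma rowavg_bound x g G : (forall u, `|g u| <= G) -> `|rowavg x g| <= G.
Proof. by move=> hG; apply: avg_bound => // *; rewrite ?rowwt_ge0 ?sum_rowwt. Qed.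

(** Bounds the relative change of a Gibbs weight when the entries move by at
    most [m]: numerator and denominator each contribute a factor [expR (bet *
    m)]. *)
Definition gap (m : R) := expR (2 * bet * m) - 1.

Lemma gap_ge0 m : 0 <= m -> 0 <= gap m.
Proof. by move=> m0; rewrite subr_ge0 -expR0 ler_expR !mulr_ge0// ltW. Qed.

Lemma close_colavg m x x' h u G : 0 <= m -> close m x x' -> (forall i, `|h i| <= G) ->
  `|colavg x' h u - colavg x h u| <= gap m * G.
Proof.
move=> m0 cl hG; rewrite -[leRHS]addr0; apply: avg_perturb => //.
- by move=> v; exact: colwt_ge0.
- exact: sum_colwt.
- by move=> v; exact: close_colwt.
- by move=> v; apply: close_colwt; exact: close_sym.
- by have := gap_ge0 m0; rewrite subr_ge0.
- by move=> v; rewrite subrr normr0.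
Qed.

Lemma close_rowavg m x x' g g' G E : 0 <= m -> close m x x' ->
  (forall u, `|g' u| <= G) -> (forall u, `|g' u - g u| <= E) ->
  `|rowavg x' g' - rowavg x g| <= gap m * G + E.
Proof.
move=> m0 cl gG gE; apply: avg_perturb => //.
- by move=> v; exact: rowwt_ge0.
- exact: sum_rowwt.
- by move=> v; exact: close_rowwt.
- by move=> v; apply: close_rowwt; exact: close_sym.
- by have := gap_ge0 m0; rewrite subr_ge0.
Qed.

(** With [E_u] the average in the row [u] and [E] the average over rows,
    [meanA], [meanB] and [meanC] are [E (E_u w)], [E ((E_u w) ^ 2)] and [E (E_u
    (w ^ 2))]. *)
Definition meanA w x := rowavg x (colavg x w).
Definition meanB w x := rowavg x (fun u => colavg x w u ^+ 2).
Definition meanC w x := rowavg x (colavg x (fun i => w i ^+ 2)).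

(** The second derivative of [softmm] in direction [w], divided by [softmm]. *)
Definition d2_ratio w x := lam * ((lam - bet) * sig ^+ 2 * meanA w x ^+ 2
  + bet * (sig ^+ 2 - sig) * meanB w x + bet * sig * meanC w x).

Section AlongLine.
Variables (x w : I -> R).
Local Notation X t := (shift x w t).
Implicit Types t : R.

Lemma is_derive_exp_entry u v t : is_derive t (1 : R)
  (fun t => expR (bet * X t (u, v))) (expR (bet * X t (u, v)) * (bet * w (u, v))).
Proof. by apply: is_derive_exp; apply: is_derive_scale; exact: is_derive_affine. Qed.

Lemma is_derive_rowsum u t : is_derive t (1 : R)
  (fun t => rowsum (X t) u) (bet * colavg (X t) w u * rowsum (X t) u).
Proof.
have -> : bet * colavg (X t) w u * rowsum (X t) u
    = \sum_v expR (bet * X t (u, v)) * (bet * w (u, v)).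
  rewrite /colavg [in LHS]mulr_sumr [in LHS]mulr_suml.
  apply: eq_bigr => v _; rewrite /colwt.
  by field; rewrite gt_eqF// rowsum_gt0.
apply: (is_derive_fsum (G := fun v t => expR (bet * X t (u, v)))
  (dG := fun v t => expR (bet * X t (u, v)) * (bet * w (u, v)))) => v.
exact: is_derive_exp_entry.
Qed.

Lemma is_derive_rowpow u t : is_derive t (1 : R)
  (fun t => rowpow (X t) u) (rowpow (X t) u * (bet * sig * colavg (X t) w u)).
Proof.
have -> : bet * sig * colavg (X t) w u
    = sig * (bet * colavg (X t) w u * rowsum (X t) u / rowsum (X t) u).
  by field; rewrite gt_eqF// rowsum_gt0.
apply: is_derive_exp; apply: is_derive_scale; apply: is_derive_log.
  exact: rowsum_gt0.
exact: is_derive_rowsum.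
Qed.

Lemma is_derive_total t : is_derive t (1 : R)
  (fun t => total (X t)) (bet * sig * meanA w (X t) * total (X t)).
Proof.
have -> : bet * sig * meanA w (X t) * total (X t)
    = \sum_u rowpow (X t) u * (bet * sig * colavg (X t) w u).
  rewrite /meanA /rowavg [in LHS]mulr_sumr [in LHS]mulr_suml.
  apply: eq_bigr => u _; rewrite /rowwt.
  by field; rewrite gt_eqF// total_gt0.
apply: (is_derive_fsum (G := fun u t => rowpow (X t) u)
  (dG := fun u t => rowpow (X t) u * (bet * sig * colavg (X t) w u))) => u.
exact: is_derive_rowpow.
Qed.

Lemma is_derive_softmm t : is_derive t (1 : R)
  (fun t => softmm (X t)) (lam * sig * meanA w (X t) * softmm (X t)).
Proof.
have -> : lam * sig * meanA w (X t) * softmm (X t) = softmm (X t) *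
    (lam / bet * (bet * sig * meanA w (X t) * total (X t) / total (X t))).
  by field; rewrite !gt_eqF// total_gt0.
apply: is_derive_exp; apply: is_derive_scale; apply: is_derive_log.
  exact: total_gt0.
exact: is_derive_total.
Qed.

Lemma is_derive_colavg u t : is_derive t (1 : R) (fun t => colavg (X t) w u)
  (bet * (colavg (X t) (fun i => w i ^+ 2) u - colavg (X t) w u ^+ 2)).
Proof.
pose N t := \sum_v expR (bet * X t (u, v)) * w (u, v).
have NE t' : colavg (X t') w u = N t' / rowsum (X t') u.
  by rewrite /N /colavg [in RHS]mulr_suml; apply: eq_bigr => v _; rewrite /colwt mulrAC.
have dN : is_derive t (1 : R) N
    (\sum_v expR (bet * X t (u, v)) * (bet * w (u, v)) * w (u, v)).
  apply: (is_derive_fsum (G := fun v t => expR (bet * X t (u, v)) * w (u, v))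
    (dG := fun v t => expR (bet * X t (u, v)) * (bet * w (u, v)) * w (u, v))) => v.
  have := is_derive_scale (w (u, v)) (is_derive_exp_entry u v t).
  rewrite mulrC; have -> // : (fun t0 => w (u, v) * expR (bet * X t0 (u, v)))
    = (fun t0 => expR (bet * X t0 (u, v)) * w (u, v)).
  by apply/funext => t0; rewrite mulrC.
have := is_derive_quot (rowsum_gt0 (X t) u) dN (is_derive_rowsum u t).
have -> : (fun t => N t / rowsum (X t) u) = (fun t => colavg (X t) w u).
  by apply/funext => t'; rewrite NE.
rewrite -NE => H; apply: is_derive_eq H _; rewrite mulrBr; congr (_ - _).
  rewrite /colavg [in RHS]mulr_sumr [in LHS]mulr_suml.
  apply: eq_bigr => v _; rewrite /colwt.
  by field; rewrite gt_eqF// rowsum_gt0.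
by field; rewrite gt_eqF// rowsum_gt0.
Qed.

Lemma is_derive_meanA t : is_derive t (1 : R) (fun t => meanA w (X t))
  (bet * (sig * (meanB w (X t) - meanA w (X t) ^+ 2) + meanC w (X t) - meanB w (X t))).
Proof.
pose N t := \sum_u rowpow (X t) u * colavg (X t) w u.
have NE t' : meanA w (X t') = N t' / total (X t').
  by rewrite /N /meanA /rowavg [in RHS]mulr_suml; apply: eq_bigr => u _; rewrite /rowwt mulrAC.
pose dG u t := rowpow (X t) u * (bet * sig * colavg (X t) w u) * colavg (X t) w u +
  rowpow (X t) u * (bet * (colavg (X t) (fun i => w i ^+ 2) u - colavg (X t) w u ^+ 2)).
have dN : is_derive t (1 : R) N (\sum_u dG u t).
  apply: (is_derive_fsum (G := fun u t => rowpow (X t) u * colavg (X t) w u)) => u.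
  apply: is_derive_mul; [exact: is_derive_rowpow|exact: is_derive_colavg].
have := is_derive_quot (total_gt0 (X t)) dN (is_derive_total t).
have -> : (fun t => N t / total (X t)) = (fun t => meanA w (X t)).
  by apply/funext => t'; rewrite NE.
rewrite -NE => H; apply: is_derive_eq H _.
have -> : (\sum_u dG u t) / total (X t)
    = bet * (sig * meanB w (X t) + meanC w (X t) - meanB w (X t)).
  rewrite /meanB /meanC /rowavg [in RHS]mulr_sumr -big_split -sumrB [in RHS]mulr_sumr.
  rewrite [in LHS]mulr_suml; apply: eq_bigr => u _.
  by rewrite /dG /rowwt /=; field; rewrite gt_eqF// total_gt0.
by field; rewrite gt_eqF// total_gt0.
Qed.

Lemma is_derive2_softmm t : is_derive t (1 : R)
  (fun t => lam * sig * meanA w (X t) * softmm (X t)) (d2_ratio w (X t) * softmm (X t)).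
Proof.
have := is_derive_mul (is_derive_scale (lam * sig) (is_derive_meanA t)) (is_derive_softmm t).
move=> H; apply: is_derive_eq H _; rewrite /d2_ratio; ring.
Qed.

End AlongLine.

End SoftMinimax.

(** * Expansion of short Gaussian averages *)

Section Expansion.
Context {R : realType} (Iu Iv : finType) (u0 : Iu) (v0 : Iv).
Variables (lam bet sig : R).
Hypotheses (lam0 : 0 < lam) (lambet : lam <= bet) (sig1 : `|sig| <= 1).
Local Notation I := (Iu * Iv)%type.
Local Notation f := (softmm lam bet sig).
Local Notation ff := (fun x : I -> R => (f x)%:E).
Implicit Types (x w : I -> R) (ws : seq (I -> R)) (a eta : R).

Definition dir_le1 w := forall i, `|w i| <= 1.

Let bet0 : 0 < bet. Proof. exact: lt_le_trans lambet. Qed.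

Let sig2 : 0 <= sig ^+ 2 <= 1.
Proof. by rewrite sqr_ge0 -real_normK ?num_real// expr_le1. Qed.

Let sigb : -1 <= sig <= 1. Proof. by rewrite -ler_norml. Qed.

Let mean_bounds w x : dir_le1 w ->
  [/\ `|meanA bet sig w x| <= 1, 0 <= meanB bet sig w x <= 1
    & 0 <= meanC bet sig w x <= 1].
Proof.
move=> w1.
have hcol u : `|colavg bet x w u| <= 1 by exact: colavg_bound.
have sq1 (r : R) : `|r| <= 1 -> `|r ^+ 2| <= 1 by move=> r1; rewrite normrX expr_le1.
have c0 u : 0 <= colavg bet x (fun i => w i ^+ 2) u.
  by apply: sumr_ge0 => v _; rewrite mulr_ge0 ?sqr_ge0// colwt_ge0.
split; first exact: rowavg_bound.
  apply/andP; split.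
    by apply: sumr_ge0 => u _; rewrite mulr_ge0 ?sqr_ge0// rowwt_ge0.
  by apply: le_trans (ler_norm _) _; apply: rowavg_bound => // u; exact: sq1.
apply/andP; split.
  by apply: sumr_ge0 => u _; rewrite mulr_ge0 ?rowwt_ge0.
apply: le_trans (ler_norm _) _; apply: rowavg_bound => // u.
by apply: colavg_bound => // i; exact: sq1.
Qed.

Lemma d2_ratio_bound w x : dir_le1 w -> `|d2_ratio lam bet sig w x| <= 4 * lam * bet.
Proof.
move=> w1; have [A1 /andP[B0 B1] /andP[C0 C1]] := mean_bounds x w1.
have /andP[s20 s21] := sig2; have /andP[s0 s1] := sigb.
have l0 : 0 < lam := lam0; have lb : lam <= bet := lambet.
have A2 : 0 <= meanA bet sig w x ^+ 2 <= 1.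
  by rewrite sqr_ge0 -real_normK ?num_real// expr_le1.
have -> : 4 * lam * bet = lam * (bet + 2 * bet + bet) by ring.
rewrite /d2_ratio normrM (gtr0_norm lam0) ler_pM2l//.
move/andP: A2 => [A20 A21].
apply: le_trans (ler_normD _ _) _; apply: lerD.
  apply: le_trans (ler_normD _ _) _; apply: lerD.
    rewrite -mulrA normrM -[leRHS]mulr1; apply: ler_pM => //.
      by rewrite ler_norml; apply/andP; split; lra.
    by rewrite ger0_norm; [apply: mulr_ile1|apply: mulr_ge0].
  rewrite normrM normrM (gtr0_norm bet0) -[2 * bet]mulrC -mulrA ler_pM2l//.
  rewrite -[leRHS]mulr1; apply: ler_pM => //.
    by rewrite ler_norml; apply/andP; split; lra.
  by rewrite ger0_norm.
rewrite -mulrA normrM (gtr0_norm bet0) -[leRHS]mulr1 ler_pM2l// normrM.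
by apply: mulr_ile1 => //; rewrite ger0_norm.
Qed.

Lemma d2_ratio_perturb w m x x' : 0 <= m -> dir_le1 w -> close m x x' ->
  `|d2_ratio lam bet sig w x' - d2_ratio lam bet sig w x| <= 12 * lam * bet * gap bet m.
Proof.
move=> m0 w1 cl; set g := gap bet m.
have g0 : 0 <= g by exact: (gap_ge0 lam0 lambet m0).
have sq1 (r : R) : `|r| <= 1 -> `|r ^+ 2| <= 1 by move=> r1; rewrite normrX expr_le1.
have hcol y u : `|colavg bet y w u| <= 1 by exact: colavg_bound.
have dcol u : `|colavg bet x' w u - colavg bet x w u| <= g.
  by rewrite -[g]mulr1; exact: (close_colavg v0 lam0 lambet u m0 cl).
have dsq (r s e : R) : `|r| <= 1 -> `|s| <= 1 -> `|r - s| <= e -> `|r ^+ 2 - s ^+ 2| <= 2 * e.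
  move=> r1 s1 rs; rewrite subr_sqr normrM mulrC; apply: ler_pM => //.
  by apply: le_trans (ler_normD _ _) _; lra.
have dA : `|meanA bet sig w x' - meanA bet sig w x| <= 2 * g.
  have -> : 2 * g = g * 1 + g by ring.
  by apply: (close_rowavg u0 v0 lam0 lambet sig1 m0 cl).
have dB : `|meanB bet sig w x' - meanB bet sig w x| <= 3 * g.
  have -> : 3 * g = g * 1 + 2 * g by ring.
  apply: (close_rowavg u0 v0 lam0 lambet sig1 m0 cl) => // u; first exact: sq1.
  exact: dsq.
have dC : `|meanC bet sig w x' - meanC bet sig w x| <= 2 * g.
  have -> : 2 * g = g * 1 + g by ring.
  apply: (close_rowavg u0 v0 lam0 lambet sig1 m0 cl) => // u.
    by apply: colavg_bound => // i; exact: sq1.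
  by rewrite -[g]mulr1; apply: (close_colavg v0 lam0 lambet u m0 cl) => // i; exact: sq1.
have [A1 _ _] := mean_bounds x w1; have [A1' _ _] := mean_bounds x' w1.
have dA2 := dsq _ _ _ A1' A1 dA.
have /andP[s20 s21] := sig2; have /andP[s0 s1] := sigb.
have l0 : 0 < lam := lam0; have lb : lam <= bet := lambet.
have -> : d2_ratio lam bet sig w x' - d2_ratio lam bet sig w x = lam * (
    (lam - bet) * sig ^+ 2 * (meanA bet sig w x' ^+ 2 - meanA bet sig w x ^+ 2)
  + bet * (sig ^+ 2 - sig) * (meanB bet sig w x' - meanB bet sig w x)
  + bet * sig * (meanC bet sig w x' - meanC bet sig w x)) by rewrite /d2_ratio; ring.
have -> : 12 * lam * bet * g
    = lam * (bet * 1 * (2 * (2 * g)) + bet * 2 * (3 * g) + bet * 1 * (2 * g)) by ring.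
rewrite normrM (gtr0_norm lam0) ler_pM2l//.
apply: le_trans (ler_normD _ _) _; apply: lerD.
  apply: le_trans (ler_normD _ _) _; apply: lerD.
    rewrite normrM; apply: ler_pM => //; rewrite normrM; apply: ler_pM => //.
      by rewrite ler_norml; apply/andP; split; lra.
    by rewrite ger0_norm.
  rewrite normrM; apply: ler_pM => //; rewrite normrM (gtr0_norm bet0) ler_pM2l//.
  by rewrite ler_norml; apply/andP; split; lra.
rewrite normrM; apply: ler_pM => //; rewrite normrM (gtr0_norm bet0) ler_pM2l//.
Qed.

Definition softmm2 w x := d2_ratio lam bet sig w x * f x.

Lemma softmm2_bound w x : dir_le1 w -> `|softmm2 w x| <= 4 * lam * bet * f x.
Proof.
move=> w1; rewrite normrM (gtr0_norm (softmm_gt0 _ _ _ _)).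
by rewrite ler_pM2r ?softmm_gt0// d2_ratio_bound.
Qed.

Lemma softmm2_perturb w m x x' : 0 <= m -> dir_le1 w -> close m x x' ->
  `|softmm2 w x' - softmm2 w x| <= 16 * lam * bet * gap bet m * f x.
Proof.
move=> m0 w1 cl; have fx := softmm_gt0 lam bet sig x.
have l0 : 0 < lam := lam0; have lb : lam <= bet := lambet.
have g0 := gap_ge0 lam0 lambet m0.
have -> : softmm2 w x' - softmm2 w x = d2_ratio lam bet sig w x' * (f x' - f x)
    + (d2_ratio lam bet sig w x' - d2_ratio lam bet sig w x) * f x.
  by rewrite /softmm2 mulrBr mulrBl addrA subrK.
rewrite [leRHS](_ : _ = 4 * lam * bet * (gap bet m * f x)
    + 12 * lam * bet * gap bet m * f x); last first.
  by move: (gap bet m) (f x) => g y; ring.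
have e1 : expR (lam * m) <= expR (2 * bet * m).
  by rewrite ler_expR ler_wpM2r//; lra.
have df : `|f x' - f x| <= gap bet m * f x.
  have up := close_softmm u0 v0 lam0 lambet sig1 cl.
  have lo := close_softmm u0 v0 lam0 lambet sig1 (close_sym cl).
  have fx' := softmm_gt0 lam bet sig x'.
  have e0 : 1 <= expR (lam * m) by rewrite -expR0 ler_expR mulr_ge0// ltW.
  move: (expR (lam * m)) (f x) (f x') up lo fx' fx e0 e1 => e y y' up lo fy' fy e0.
  rewrite /gap; move: (expR _) => E e1.
  rewrite ler_norml; apply/andP; split; last by nra.
  (* f x' >= f x / e >= (2 - e) f x *)
  have : e * ((2 - e) * y) <= e * y'.
    by apply: le_trans lo; have := sqr_ge0 (e - 1); nra.
  by rewrite ler_pM2l; [nra|lra].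
apply: le_trans (ler_normD _ _) _; apply: lerD.
  by rewrite normrM; apply: ler_pM => //; exact: d2_ratio_bound.
by rewrite normrM (gtr0_norm fx) ler_pM2r//; exact: d2_ratio_perturb.
Qed.

Lemma gap_le m : 0 <= m -> gap bet m <= 2 * bet * m * expR (2 * bet * m).
Proof.
move=> m0; rewrite /gap; set t := 2 * bet * m.
have := expR_ge1Dx (- t); rewrite expRN => h.
have e0 := expR_gt0 t.
have : (1 - t) * expR t <= 1 by rewrite -ler_pdivlMr// div1r.
lra.
Qed.

Lemma close_shift x w a : dir_le1 w -> close `|a| x (shift x w a).
Proof.
by move=> w1 i; rewrite /shift addrC addKr normrM -[leRHS]mulr1 ler_wpM2l.
Qed.

(* the Gibbs weights vary at rate 2 bet; the additional 1 absorbs powers of |a| *)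
Let c := 2 * bet + 1.
Definition cosh2 a : R := expR (c * a) + expR (- c * a).

Let exp_abs_le_cosh2 a : expR (c * `|a|) <= cosh2 a.
Proof.
rewrite /cosh2; have [a0|a0] := ger0P a.
  by rewrite lerDl expR_ge0.
by rewrite mulrN -mulNr lerDr expR_ge0.
Qed.

Let K0 := 32 * lam * bet ^+ 2.

Let K00 : 0 <= K0. Proof. by rewrite !mulr_ge0 ?sqr_ge0// ltW. Qed.

(** When the entries move by [eta * `|a|], the relative change is [eta] times a
    function of [a] that [cosh2] dominates. *)
Let softmm2_cosh2 w w' x eta a : 0 <= eta <= 1 -> dir_le1 w -> dir_le1 w' ->
  `|softmm2 w' (shift x w (eta * a)) - softmm2 w' x| <= K0 * eta * f x * cosh2 a.
Proof.
move=> /andP[e0 e1] w1 w1'.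
have cl := close_shift x (eta * a) w1.
apply: le_trans (softmm2_perturb (normr_ge0 _) w1' cl) _.
have fx := softmm_gt0 lam bet sig x.
rewrite [leRHS](_ : _ = 16 * lam * bet * (2 * bet * eta * cosh2 a) * f x); last first.
  by rewrite /K0; move: (cosh2 a) (f x) => g y; ring.
rewrite ler_pM2r// ler_pM2l; last by rewrite !mulr_gt0.
apply: le_trans (gap_le (normr_ge0 _)) _.
rewrite normrM (ger0_norm e0).
have -> : 2 * bet * (eta * `|a|) * expR (2 * bet * (eta * `|a|))
  = 2 * bet * eta * (`|a| * expR (2 * bet * (eta * `|a|))).
  by move: (expR _) => g; ring.
apply: ler_wpM2l; first by rewrite !mulr_ge0// ltW.
apply: le_trans (exp_abs_le_cosh2 a).
have -> : c * `|a| = `|a| + 2 * bet * `|a| by rewrite /c; ring.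
rewrite expRD; apply: ler_pM; rewrite ?expR_ge0//.
  by apply: le_trans (expR_ge1Dx _); rewrite lerDr.
by rewrite ler_expR ler_wpM2l ?ler_piMl// mulr_ge0// ltW.
Qed.

Let softmm_taylor w x eta a : 0 <= eta <= 1 -> dir_le1 w ->
  `|f (shift x w (eta * a)) - (f x + (eta * lam * sig * meanA bet sig w x * f x) * a
      + (eta ^+ 2 / 2 * softmm2 w x) * a ^+ 2)|
    <= 6 * K0 * eta ^+ 3 * f x * cosh2 a.
Proof.
move=> /andP[e0 e1] w1; set s := eta * a.
have x0 : shift x w 0 = x by apply/funext => i; rewrite /shift mul0r addr0.
have := @taylor2_bound _ (fun t => f (shift x w t))
  (fun t => lam * sig * meanA bet sig w (shift x w t) * f (shift x w t))
  (fun t => softmm2 w (shift x w t)) (16 * lam * bet * gap bet `|s| * f x) s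
  (is_derive_softmm u0 v0 sig lam0 lambet x w) (is_derive2_softmm u0 v0 sig lam0 lambet x w).
rewrite /= x0 => H.
have -> : f x + (eta * lam * sig * meanA bet sig w x * f x) * a
      + (eta ^+ 2 / 2 * softmm2 w x) * a ^+ 2
    = f x + lam * sig * meanA bet sig w x * f x * s + softmm2 w x / 2 * s ^+ 2.
  by rewrite /s; move: (f x) (softmm2 w x) (meanA bet sig w x) => g y z; field.
have fx := softmm_gt0 lam bet sig x.
apply: le_trans (H _) _.
  move=> t ts; apply: softmm2_perturb => // i.
  by apply: le_trans (close_shift x t w1 i) _.
have s0 := normr_ge0 s.
have -> : 6 * K0 * eta ^+ 3 * f x * cosh2 a
    = 16 * lam * bet * (2 * bet * (6 * eta ^+ 3 * cosh2 a)) * f x.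
  by rewrite /K0; move: (cosh2 a) (f x) => g y; ring.
rewrite [leLHS](_ : _ = 16 * lam * bet * (gap bet `|s| * `|s| ^+ 2) * f x); last first.
  by move: (gap bet _) (f x) => *; ring.
rewrite ler_pM2r// ler_pM2l; last by rewrite !mulr_gt0.
apply: le_trans (ler_wpM2r (exprn_ge0 _ s0) (gap_le s0)) _.
have -> : 2 * bet * `|s| * expR (2 * bet * `|s|) * `|s| ^+ 2
  = 2 * bet * (`|s| ^+ 3 * expR (2 * bet * `|s|)).
  by move: (expR _) => g; ring.
apply: ler_wpM2l; first by rewrite mulr_ge0// ltW.
have -> : `|s| = eta * `|a| by rewrite /s normrM (ger0_norm e0).
have -> : (eta * `|a|) ^+ 3 * expR (2 * bet * (eta * `|a|))
  = eta ^+ 3 * (`|a| ^+ 3 * expR (2 * bet * (eta * `|a|))).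
  by move: (expR _) => g; ring.
have -> : 6 * eta ^+ 3 * cosh2 a = eta ^+ 3 * (6 * cosh2 a).
  by move: (cosh2 a) => g; ring.
apply: ler_wpM2l; first exact: exprn_ge0.
have := exp_abs_le_cosh2 a.
have -> : c * `|a| = `|a| + 2 * bet * `|a| by rewrite /c; ring.
rewrite expRD => h; apply: (@le_trans _ _ (6 * (expR `|a| * expR (2 * bet * `|a|)))); last first.
  by rewrite ler_pM2l.
rewrite [leRHS]mulrA; apply: ler_pM; rewrite ?exprn_ge0 ?expR_ge0//.
  have := expR_ge1Dxn 2 (normr_ge0 a).
  have -> : (3`!)%:R = 6 :> R by [].
  lra.
by rewrite ler_expR ler_wpM2l ?ler_piMl// mulr_ge0// ltW.
Qed.

Let softmm_cosh2 w x eta a : 0 <= eta <= 1 -> dir_le1 w ->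
  f (shift x w (eta * a)) <= f x * cosh2 a.
Proof.
move=> /andP[e0 e1] w1.
apply: le_trans (close_softmm u0 v0 lam0 lambet sig1 (close_shift x (eta * a) w1)) _.
rewrite mulrC ler_pM2l ?softmm_gt0//; apply: le_trans (exp_abs_le_cosh2 a).
rewrite ler_expR normrM (ger0_norm e0) mulrA.
apply: ler_wpM2r => //; rewrite /c.
apply: le_trans (ler_piMr (ltW lam0) e1) _; have := bet0; have := lambet; lra.
Qed.

(** The sum of the second derivatives along the directions, which is the
    infinitesimal generator of the Gaussian average up to a constant factor. *)
Definition laplacian ws x := \sum_(w <- ws) softmm2 w x.

Lemma laplacian_nil x : laplacian [::] x = 0. Proof. by rewrite /laplacian big_nil. Qed.

Lemma laplacian_cons w ws x : laplacian (w :: ws) x = softmm2 w x + laplacian ws x.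
Proof. by rewrite /laplacian big_cons. Qed.

Lemma softmm_borel : borel_functional ff.
Proof.
move=> d T X mX; apply/measurable_EFinP; apply: measurableT_comp => //.
apply: measurable_funM => //; apply: measurableT_comp => //.
apply: measurable_sum => u; apply: measurableT_comp => //.
apply: measurable_funM => //; apply: measurableT_comp => //.
apply: measurable_sum => v; apply: measurableT_comp => //.
exact: measurable_funM.
Qed.

Lemma softmm_nonneg : nonneg_functional ff.
Proof. by move=> x; rewrite lee_fin ltW// softmm_gt0. Qed.

Lemma laplacian_bound ws x : (forall w, List.In w ws -> dir_le1 w) ->
  `|laplacian ws x| <= (size ws)%:R * (4 * lam * bet) * f x.
Proof.
rewrite /laplacian; elim: ws => [|w ws ih] ws1.
  by rewrite big_nil normr0 !mul0r.
rewrite big_cons /=; apply: le_trans (ler_normD _ _) _.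
have := ih (fun w' h => ws1 w' (or_intror h)).
have := softmm2_bound x (ws1 w (or_introl erefl)).
rewrite -natr1; lra.
Qed.

Let laplacian_cosh2 ws w x eta a : 0 <= eta <= 1 -> dir_le1 w ->
  (forall w, List.In w ws -> dir_le1 w) ->
  `|laplacian ws (shift x w (eta * a)) - laplacian ws x| <= (size ws)%:R * K0 * eta * f x * cosh2 a.
Proof.
move=> he w1; elim: ws => [|w' ws ih] ws1.
  rewrite !laplacian_nil subr0 normr0.
  apply: mulr_ge0; last by rewrite addr_ge0 ?expR_ge0.
  by rewrite /= -!mulrA mul0r.
rewrite !laplacian_cons opprD addrACA; apply: le_trans (ler_normD _ _) _.
have := ih (fun w' h => ws1 w' (or_intror h)).
have := softmm2_cosh2 x a he w1 (ws1 w' (or_introl erefl)).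
rewrite [size (_ :: _)]/= -natr1.
move: (laplacian ws _ - _) (softmm2 w' _ - _) K0 (f x) (cosh2 a) (size ws).
move=> A B K y h n h1 h2; apply: le_trans (lerD h1 h2) _.
by rewrite le_eqVlt; apply/orP; left; apply/eqP; ring.
Qed.

Let abs_sandwich (p q k E : R) : `|p - q| + k <= E -> q - E <= p - k /\ p + k <= q + E.
Proof.
move=> h; have := ler_norm (p - q); have := ler_norm (- (p - q)).
by rewrite normrN => h1 h2; split; lra.
Qed.

(** Directions are added one at a time: the average over the remaining ones is
    expanded at the shifted point, and its expansion is then expanded along the
    new direction. The errors remain proportional to [f x], so that they act as
    multiplicative errors. *)
Lemma gauss_avg_expansion ws : (forall w, List.In w ws -> dir_le1 w) ->
  exists2 K, 0 <= K & forall eta x, 0 <= eta <= 1 ->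
    ((f x + eta ^+ 2 * gauss_var / 2 * laplacian ws x - K * eta ^+ 3 * f x)%:E
       <= gauss_avg (scale_dirs eta ws) ff x)%E /\
    (gauss_avg (scale_dirs eta ws) ff x
       <= (f x + eta ^+ 2 * gauss_var / 2 * laplacian ws x + K * eta ^+ 3 * f x)%:E)%E.
Proof.
have v0' := @gauss_var_ge0 R.
elim: ws => [|w ws ih] ws1.
  exists 0 => // eta x _; rewrite /= /laplacian big_nil; split; rewrite lee_fin; lra.
have ws1' : forall w, List.In w ws -> dir_le1 w by move=> w' h; apply: ws1; right.
have w1 : dir_le1 w by apply: ws1; left.
have [K K_ge0 hK] := ih ws1'.
pose K1 := 6 * K0 + gauss_var / 2 * ((size ws)%:R * K0) + K.
have K10 : 0 <= K1.
  apply: addr_ge0 => //; apply: addr_ge0; first exact: mulr_ge0.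
  by apply: mulr_ge0; [apply: divr_ge0|apply: mulr_ge0].
exists (2 * K1 * expR (c ^+ 2 / 2)); first by rewrite mulr_ge0 ?expR_ge0// mulr_ge0.
move=> eta x he; have /andP[e0 e1] := he.
have fx := softmm_gt0 lam bet sig x.
have scaleE a : shift x (fun i => eta * w i) a = shift x w (eta * a).
  by apply/funext => i; rewrite /shift; ring.
pose al := f x + eta ^+ 2 * gauss_var / 2 * laplacian ws x.
pose be := eta * lam * sig * meanA bet sig w x * f x.
pose ka := eta ^+ 2 / 2 * softmm2 w x.
have main a : `|f (shift x w (eta * a))
      + eta ^+ 2 * gauss_var / 2 * laplacian ws (shift x w (eta * a))
      - (al + be * a + ka * a ^+ 2)|
    + K * eta ^+ 3 * f (shift x w (eta * a)) <= K1 * eta ^+ 3 * f x * cosh2 a.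
  have h1 := softmm_taylor x a he w1.
  have h2 := laplacian_cosh2 x a he w1 ws1'.
  have h3 := softmm_cosh2 x a he w1.
  have q0 : 0 <= eta ^+ 2 * gauss_var / 2 by rewrite divr_ge0// mulr_ge0// sqr_ge0.
  have h2' := ler_wpM2l q0 h2.
  have h3' := ler_wpM2l (mulr_ge0 K_ge0 (exprn_ge0 3 e0)) h3.
  set y := shift x w (eta * a) in h1 h2 h2' h3 h3' *.
  have -> : f y + eta ^+ 2 * gauss_var / 2 * laplacian ws y - (al + be * a + ka * a ^+ 2)
     = (f y - (f x + be * a + ka * a ^+ 2))
       + eta ^+ 2 * gauss_var / 2 * (laplacian ws y - laplacian ws x).
    by rewrite /al; move: (f x) (f y) (laplacian ws x) (laplacian ws y) => *; ring.
  have -> : K1 * eta ^+ 3 * f x * cosh2 a = 6 * K0 * eta ^+ 3 * f x * cosh2 a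
      + eta ^+ 2 * gauss_var / 2 * ((size ws)%:R * K0 * eta * f x * cosh2 a)
      + K * eta ^+ 3 * (f x * cosh2 a).
    by rewrite /K1; move: (f x) (cosh2 a) K0 => *; ring.
  apply: lerD => //; apply: le_trans (ler_normD _ _) _; apply: lerD => //.
  by rewrite normrM (ger0_norm q0).
have mh : measurable_fun [set: R]
    (fun a => gauss_avg (scale_dirs eta ws) ff (shift x (fun i => eta * w i) a)).
  by apply: borel_shift; apply: gauss_avg_borel; [exact: softmm_borel|exact: softmm_nonneg].
have h0 a : (0 <= gauss_avg (scale_dirs eta ws) ff (shift x (fun i => eta * w i)%R a))%E.
  by apply: gauss_avg_ge0; exact: softmm_nonneg.
have sumE : laplacian (w :: ws) x = softmm2 w x + laplacian ws x by rewrite /laplacian big_cons.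
split.
- have -> : f x + eta ^+ 2 * gauss_var / 2 * laplacian (w :: ws) x
      - 2 * K1 * expR (c ^+ 2 / 2) * eta ^+ 3 * f x
    = al + ka * gauss_var + 2 * (- (K1 * eta ^+ 3 * f x)) * expR (c ^+ 2 / 2).
    rewrite sumE /al /ka; move: (f x) (softmm2 w x) (laplacian ws x) (expR _) => *.
    by field.
  apply: (gauss_integral_ge_quadratic (be := be)) => // a.
  rewrite scaleE; apply: le_trans (hK eta _ he).1; rewrite lee_fin -/(cosh2 a).
  by rewrite mulNr; exact: (abs_sandwich (main a)).1.
- have -> : f x + eta ^+ 2 * gauss_var / 2 * laplacian (w :: ws) x
      + 2 * K1 * expR (c ^+ 2 / 2) * eta ^+ 3 * f x
    = al + ka * gauss_var + 2 * (K1 * eta ^+ 3 * f x) * expR (c ^+ 2 / 2).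
    rewrite sumE /al /ka; move: (f x) (softmm2 w x) (laplacian ws x) (expR _) => *.
    by field.
  apply: (gauss_integral_le_quadratic (be := be)) => // a.
  rewrite scaleE; apply: le_trans (hK eta _ he).2 _; rewrite lee_fin -/(cosh2 a).
  exact: (abs_sandwich (main a)).2.
Qed.

End Expansion.

(** * Comparison of Gaussian averages *)

(** The square of the scale [eta] is the inverse of the number [2 ^ k] of
    steps, so that second-order terms add up to order one and third-order terms
    to order [eta]. *)
Lemma halving_scale (R : realType) (Q : R) : 0 < Q -> exists k eta,
  [/\ eta = (Num.sqrt 2)^-1 ^+ k, 0 < eta, eta ^+ 2 * (2 ^ k)%:R = 1 & eta * Q <= 1].
Proof.
move=> Q0; pose k := (Num.truncn (Q ^+ 2)).+1.
have Qk : Q ^+ 2 <= (2 ^ k)%:R.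
  apply: le_trans (ltW (truncnS_gt _)) _.
  by rewrite ler_nat ltnW// ltn_expl.
move: k Qk => k Qk; exists k, ((Num.sqrt 2)^-1 ^+ k).
have r0 : 0 < Num.sqrt (2 : R) by rewrite sqrtr_gt0.
have eta0 : 0 < (Num.sqrt (2 : R))^-1 ^+ k by rewrite exprn_gt0// invr_gt0.
have eta2 : ((Num.sqrt (2 : R))^-1 ^+ k) ^+ 2 * (2 ^ k)%:R = 1.
  by rewrite -exprM mulnC exprM exprVn sqr_sqrtr// natrX exprVn mulVf.
split => //; rewrite -(@expr_le1 _ 2)//; last by rewrite mulr_ge0 ?ltW.
by rewrite exprMn -[leRHS]eta2 ler_pM2l// exprn_gt0.
Qed.

Section Comparison.
Context {R : realType} (Iu Iv : finType) (u0 : Iu) (v0 : Iv).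
Variables (lam bet sig : R).
Hypotheses (lam0 : 0 < lam) (lambet : lam <= bet) (sig1 : `|sig| <= 1).
Local Notation I := (Iu * Iv)%type.
Local Notation f := (softmm lam bet sig).
Local Notation ff := (fun x : I -> R => (f x)%:E).
Local Notation laplacian := (laplacian lam bet sig).
Implicit Types (x w : I -> R) (ws : seq (I -> R)).

Let step_arith (K D eta y SA SB : R) : 0 <= K -> 0 <= eta -> 0 <= y ->
  SA <= SB -> `|SB| <= D * y -> eta ^+ 2 * D + K * eta ^+ 3 <= 1 / 2 ->
  y + eta ^+ 2 * SA + K * eta ^+ 3 * y
    <= (1 + 4 * K * eta ^+ 3) * (y + eta ^+ 2 * SB - K * eta ^+ 3 * y).
Proof.
move=> K0 e0 y0 SAB SBD small.
have k0 : 0 <= K * eta ^+ 3 by rewrite mulr_ge0// exprn_ge0.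
rewrite -[4 * K * _]mulrA; move: (K * eta ^+ 3) k0 small => k k0 small.
have s0 : 0 <= eta ^+ 2 by exact: sqr_ge0.
move: (eta ^+ 2) s0 small => s s0 small.
have half : y / 2 <= y + s * SB - k * y.
  have : - (D * y) <= SB by move: SBD; rewrite ler_norml => /andP[].
  move=> h; have := ler_wpM2l s0 h; have := ler_wpM2r y0 small; lra.
have := ler_wpM2l k0 half; have := ler_wpM2l s0 SAB; lra.
Qed.

(** In one short step the second-order terms are ordered and the error is a
    factor [1 + O (eta ^ 3)]; over [2 ^ k = eta ^ -2] steps these factors
    multiply to at most [expR 1] once [eta] is small. *)
Lemma gauss_avg_compare wsA wsB :
  (forall w, List.In w wsA -> dir_le1 w) -> (forall w, List.In w wsB -> dir_le1 w) ->
  (forall x, laplacian wsA x <= laplacian wsB x) ->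
  forall x, (gauss_avg wsA ff x <= (expR 1)%:E * gauss_avg wsB ff x)%E.
Proof.
move=> A1 B1 AB x.
have [KA KA0 hA] := gauss_avg_expansion u0 v0 lam0 lambet sig1 A1.
have [KB KB0 hB] := gauss_avg_expansion u0 v0 lam0 lambet sig1 B1.
pose K := KA + KB.
have K0 : 0 <= K by exact: addr_ge0.
have gv := @gauss_var_ge0 R.
have bet0 : 0 < bet by exact: lt_le_trans lambet.
pose D := gauss_var / 2 * ((size wsB)%:R * (4 * lam * bet)).
have D0 : 0 <= D.
  by apply: mulr_ge0; [apply: divr_ge0|rewrite !mulr_ge0// ltW].
pose Q := 4 * K + 2 * D + 2.
have Q0 : 0 < Q by rewrite /Q; lra.
(* n = 2 ^ k steps of size eta = 2 ^ (- k / 2), with eta <= 1 / Q *)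
have [k [eta [etaE eta0 eta2 etaQ]]] := halving_scale Q0.
have eta1 : 0 <= eta <= 1.
  apply/andP; split; first exact: ltW.
  by apply: le_trans etaQ; apply: ler_peMr; [exact: ltW|rewrite /Q; lra].
have step y : (gauss_avg (scale_dirs eta wsA) ff y
    <= (1 + 4 * K * eta ^+ 3)%:E * gauss_avg (scale_dirs eta wsB) ff y)%E.
  have fy := softmm_gt0 lam bet sig y.
  have k30 : 0 <= K * eta ^+ 3 by rewrite mulr_ge0// exprn_ge0// ltW.
  apply: le_trans (hA eta y eta1).2 _.
  apply: (@le_trans _ _ ((1 + 4 * K * eta ^+ 3)%:E *
      (f y + eta ^+ 2 * gauss_var / 2 * laplacian wsB y - KB * eta ^+ 3 * f y)%:E)%E); last first.
    apply: lee_wpmul2l (hB eta y eta1).1.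
    by rewrite lee_fin -mulrA addr_ge0// mulr_ge0.
  have e30 : 0 <= eta ^+ 3 by rewrite exprn_ge0// ltW.
  have S_bound := laplacian_bound u0 v0 lam0 lambet sig1 y B1.
  have ord := AB y.
  rewrite -EFinM lee_fin; move: (laplacian wsA y) (laplacian wsB y) (f y) fy S_bound ord.
  move=> SA SB z z0 S_bound ord.
  have g2 : 0 <= gauss_var / 2 :> R by rewrite divr_ge0.
  apply: (@le_trans _ _ (z + eta ^+ 2 * (gauss_var / 2 * SA) + K * eta ^+ 3 * z)).
    apply: lerD; first by rewrite !mulrA.
    by apply: ler_wpM2r; [exact: ltW|apply: ler_wpM2r => //; rewrite /K lerDl].
  apply: le_trans (step_arith (D := D) K0 (ltW eta0) (ltW z0) _ _ _) _.
  - exact: ler_wpM2l ord.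
  - by rewrite normrM (ger0_norm g2) /D -[in leRHS]mulrA ler_wpM2l.
  - have h1 : eta ^+ 2 * D + K * eta ^+ 3 <= eta * D + K * eta.
      case/andP: eta1 => e0 e1.
      apply: lerD; first by rewrite ler_wpM2r// expr2 ler_piMr.
      by rewrite ler_wpM2l// exprS ler_piMr// exprn_ile1.
    move: etaQ; rewrite /Q; have := mulr_ge0 (ltW eta0) D0.
    have := mulr_ge0 (ltW eta0) K0; have := ltW eta0; move: h1; nra.
  - apply: ler_wpM2l; first by rewrite -mulrA addr_ge0// mulr_ge0.
    apply: lerD; first by rewrite !mulrA.
    rewrite lerN2; apply: ler_wpM2r; first exact: ltW.
    by apply: ler_wpM2r => //; rewrite /K lerDr.
have fb := @softmm_borel R Iu Iv lam bet sig.
have f0 := @softmm_nonneg R Iu Iv lam bet sig.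
rewrite (gauss_avg_split k)// (gauss_avg_split k wsB)// -etaE.
have e0 : 0 <= 1 + 4 * K * eta ^+ 3.
  by apply: addr_ge0 => //; apply: mulr_ge0; [apply: mulr_ge0|rewrite exprn_ge0// ltW].
apply: le_trans (iter_gauss_avg_le (2 ^ k) e0 fb f0 step x) _.
apply: lee_wpmul2r; first exact: (iter_gauss_avg_borel _ _ fb f0).2.
rewrite lee_fin; apply: (@le_trans _ _ (expR (4 * K * eta ^+ 3) ^+ (2 ^ k))).
  by rewrite lerXn2r ?nnegrE ?expR_ge0// expR_ge1Dx.
rewrite -expRM_natl ler_expR.
have -> : (2 ^ k)%:R * (4 * K * eta ^+ 3) = 4 * K * eta * (eta ^+ 2 * (2 ^ k)%:R) by ring.
rewrite eta2 mulr1; apply: le_trans etaQ; rewrite mulrC ler_pM2l// /Q; lra.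
Qed.

End Comparison.

(** * Gordon's comparison of bilinear and separable processes *)

Section Gordon.
Context {R : realType} (Iu Iv J1 J2 : finType) (u0 : Iu) (v0 : Iv).
Variables (U : Iu -> J1 -> R) (V : Iv -> J2 -> R).
Hypothesis Uunit : forall u, \sum_i U u i ^+ 2 = 1.
Hypothesis Vunit : forall v, \sum_j V v j ^+ 2 = 1.
Local Notation I := (Iu * Iv)%type.

(** Directions of the bilinear process [(u, v) |-> <G u, v>] and of the
    separable process [(u, v) |-> <g, u> + <h, v>]. *)
Definition bilin_dir (k : J1 * J2) : I -> R := fun p => U p.1 k.1 * V p.2 k.2.
Definition one_dir : I -> R := fun=> 1.
Definition sep_dir (k : J1 + J2) : I -> R := fun p =>
  match k with inl i => U p.1 i | inr j => V p.2 j end.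

Definition bilin_dirs := [seq bilin_dir k | k <- enum {: J1 * J2}].
Definition sep_dirs := [seq sep_dir k | k <- enum {: J1 + J2}].

Lemma unit_coord (J : finType) (z : J -> R) k : \sum_i z i ^+ 2 = 1 -> `|z k| <= 1.
Proof.
move=> z1; rewrite -(@expr_le1 _ 2)// real_normK ?num_real// -z1 (bigD1 k)//= lerDl.
by apply: sumr_ge0 => i _; exact: sqr_ge0.
Qed.

Lemma unit_inner (J : finType) (y z : J -> R) :
  \sum_i y i ^+ 2 = 1 -> \sum_i z i ^+ 2 = 1 -> \sum_i y i * z i <= 1.
Proof.
move=> y1 z1; have -> : 1 = \sum_i (y i ^+ 2 + z i ^+ 2) / 2.
  by rewrite -mulr_suml big_split /= y1 z1; field.
by apply: ler_sum => i _; have := sqr_ge0 (y i - z i); rewrite sqrrB; lra.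
Qed.

Lemma In_map_dir_le1 (K : finType) (w : K -> I -> R) (s : seq K) :
  (forall k, dir_le1 (w k)) -> forall d, List.In d (map w s) -> dir_le1 d.
Proof. by move=> w1 d; elim: s => //= k s ih [<-|/ih]. Qed.

Lemma bilin_dir_le1 k : dir_le1 (bilin_dir k).
Proof. by move=> p; rewrite normrM mulr_ile1// unit_coord. Qed.

Lemma sep_dir_le1 k : dir_le1 (sep_dir k).
Proof. by move=> p; case: k => k; rewrite /sep_dir unit_coord. Qed.

Lemma one_dir_le1 : dir_le1 one_dir.
Proof. by move=> p; rewrite normr1. Qed.

Section FixedPoint.
Variables (lam bet sig : R).
Hypotheses (lam0 : 0 < lam) (lambet : lam <= bet) (sig2 : sig ^+ 2 = 1).
Local Notation f := (softmm lam bet sig).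
Local Notation ff := (fun x : I -> R => (f x)%:E).

Let sig1 : `|sig| <= 1.
Proof. by rewrite -(@expr_le1 _ 2)// real_normK ?num_real// sig2. Qed.

Variable x : I -> R.
Local Notation rw := (rowwt bet sig x).
Local Notation cw := (colwt bet x).
Local Notation A w := (meanA bet sig w x).
Local Notation B w := (meanB bet sig w x).
Local Notation C w := (meanC bet sig w x).

Let rw0 u : 0 <= rw u. Proof. exact: rowwt_ge0. Qed.
Let cw0 u v : 0 <= cw u v. Proof. exact: colwt_ge0. Qed.
Let cw1 u : \sum_v cw u v = 1. Proof. exact: sum_colwt. Qed.

Let pr (p : I) := rw p.1 * cw p.1 p.2.
Let pr0 p : 0 <= pr p. Proof. by rewrite mulr_ge0. Qed.

Let meanAE w : A w = \sum_p pr p * w p.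
Proof.
rewrite /meanA /rowavg /colavg (eq_bigr (fun u => \sum_v pr (u, v) * w (u, v))).
  by rewrite pair_bigA /=; apply: eq_bigr => -[].
by move=> u _; rewrite mulr_sumr; apply: eq_bigr => v _; rewrite mulrA.
Qed.

(** The Gibbs weights form a probability on pairs of indices, so the square of
    a mean is a double sum in which only the covariances of the process enter.
    *)
Lemma sum_meanA2 (K : finType) (w : K -> I -> R) :
  \sum_k A (w k) ^+ 2 = \sum_p \sum_q pr p * pr q * \sum_k w k p * w k q.
Proof.
transitivity (\sum_k \sum_p \sum_q pr p * pr q * (w k p * w k q)).
  apply: eq_bigr => k _; rewrite meanAE expr2 mulr_suml; apply: eq_bigr => p _.
  by rewrite mulr_sumr; apply: eq_bigr => q _; ring.
rewrite exchange_big; apply: eq_bigr => p _; rewrite exchange_big.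
by apply: eq_bigr => q _; rewrite mulr_sumr.
Qed.

Lemma sum_pair_prod (F : J1 -> R) (G : J2 -> R) :
  \sum_(k : J1 * J2) F k.1 * G k.2 = (\sum_i F i) * (\sum_j G j).
Proof.
rewrite big_distrl /= -(pair_bigA _ (fun i j => F i * G j)) /=.
by apply: eq_bigr => i _; rewrite big_distrr.
Qed.

Lemma sum_sum (F : J1 + J2 -> R) :
  \sum_k F k = \sum_i F (inl i) + \sum_j F (inr j).
Proof. by rewrite big_sumType. Qed.

(** The covariances of [<G u, v> + gamma] exceed those of [<g, u> + <h, v>] by
    [(1 - <u, u'>) (1 - <v, v'>) >= 0]. *)
Lemma sum_meanA2_ge :
  \sum_k A (sep_dir k) ^+ 2 <= \sum_k A (bilin_dir k) ^+ 2 + A one_dir ^+ 2.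
Proof.
have -> : A one_dir ^+ 2 = \sum_p \sum_q pr p * pr q.
  rewrite meanAE /one_dir; under eq_bigr do rewrite mulr1.
  by rewrite expr2 big_distrlr.
rewrite !sum_meanA2 -big_split; apply: ler_sum => p _.
rewrite -big_split; apply: ler_sum => q _.
rewrite /= -[X in _ + X]mulr1 -mulrDr; apply: ler_wpM2l; first by rewrite mulr_ge0.
have -> : \sum_k bilin_dir k p * bilin_dir k q
    = (\sum_i U p.1 i * U q.1 i) * (\sum_j V p.2 j * V q.2 j).
  rewrite -sum_pair_prod; apply: eq_bigr => k _; rewrite /bilin_dir; ring.
rewrite sum_sum /sep_dir /=.
have := unit_inner (Uunit p.1) (Uunit q.1).
have := unit_inner (Vunit p.2) (Vunit q.2).
move: (\sum_i U _ i * _) (\sum_j V _ j * _) => a b a1 b1.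
have : 0 <= (1 - a) * (1 - b) by rewrite mulr_ge0 ?subr_ge0.
lra.
Qed.

Let colavg_unit h u : (forall v, h (u, v) = 1) -> colavg bet x h u = 1.
Proof.
move=> h1; rewrite /colavg -[RHS](cw1 u); apply: eq_bigr => v _.
by rewrite h1 mulr1.
Qed.

Let colavg_row (g : Iu -> R) u : colavg bet x (fun p => g p.1) u = g u.
Proof. by rewrite /colavg /= -mulr_suml cw1 mul1r. Qed.

Let rowavg_sum (K : finType) (g : K -> Iu -> R) :
  \sum_k rowavg bet sig x (g k) = rowavg bet sig x (fun u => \sum_k g k u).
Proof.
rewrite /rowavg exchange_big; apply: eq_bigr => u _.
by rewrite mulr_sumr.
Qed.

Let colavg_sum (K : finType) (g : K -> I -> R) u :
  \sum_k colavg bet x (g k) u = colavg bet x (fun p => \sum_k g k p) u.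
Proof.
rewrite /colavg exchange_big; apply: eq_bigr => v _.
by rewrite mulr_sumr.
Qed.

Let rowavgD g g' : rowavg bet sig x g + rowavg bet sig x g'
  = rowavg bet sig x (fun u => g u + g' u).
Proof. by rewrite /rowavg -big_split; apply: eq_bigr => u _; rewrite /= mulrDr. Qed.

(** All the variables of both processes have variance 2, once the shared
    Gaussian is added to the bilinear one. *)
Lemma sum_meanC_eq :
  \sum_k C (bilin_dir k) + C one_dir = \sum_k C (sep_dir k).
Proof.
rewrite /meanC !rowavg_sum rowavgD; apply: eq_bigr => u _; congr (_ * _).
rewrite !colavg_sum; set c1 := colavg _ _ (fun i => one_dir i ^+ 2) u.
have -> : c1 = 1 by apply: colavg_unit => v; rewrite expr1n.
have -> : colavg bet x (fun p => \sum_k bilin_dir k p ^+ 2) u = 1.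
  apply: colavg_unit => v.
  under eq_bigr do rewrite /bilin_dir exprMn.
  by rewrite (sum_pair_prod (fun i => U u i ^+ 2) (fun j => V v j ^+ 2)) Uunit Vunit mulr1.
have -> : colavg bet x (fun p => \sum_k sep_dir k p ^+ 2) u
    = colavg bet x (fun=> 1) u + colavg bet x (fun=> 1) u.
  rewrite /colavg -big_split; apply: eq_bigr => v _.
  by rewrite sum_sum /sep_dir /= Uunit Vunit -mulrDr.
by rewrite colavg_unit.
Qed.

(** Within a row [u] both processes have the covariances [1 + <v, v'>]. *)
Lemma sum_meanB_eq :
  \sum_k B (bilin_dir k) + B one_dir = \sum_k B (sep_dir k).
Proof.
rewrite /meanB !rowavg_sum rowavgD; apply: eq_bigr => u _; congr (_ * _).
pose m j := colavg bet x (fun p => V p.2 j) u.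
have -> : colavg bet x one_dir u = 1 by apply: colavg_unit.
have -> : \sum_k colavg bet x (bilin_dir k) u ^+ 2 = \sum_j m j ^+ 2.
  have mE k : colavg bet x (bilin_dir k) u ^+ 2 = U u k.1 ^+ 2 * m k.2 ^+ 2.
    rewrite -exprMn; congr (_ ^+ 2); rewrite /m /colavg mulr_sumr.
    by apply: eq_bigr => v _; rewrite /bilin_dir /=; ring.
  under eq_bigr do rewrite mE.
  by rewrite (sum_pair_prod (fun i => U u i ^+ 2) (fun j => m j ^+ 2)) Uunit mul1r.
rewrite sum_sum /sep_dir expr1n addrC; congr (_ + _).
by rewrite -(Uunit u); apply: eq_bigr => i _; rewrite (colavg_row (fun u => U u i)).
Qed.

Let laplacian_map (K : finType) (w : K -> I -> R) :
  laplacian lam bet sig [seq w k | k <- enum K] x = lam * ((lam - bet) * sig ^+ 2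
    * (\sum_k A (w k) ^+ 2) + bet * (sig ^+ 2 - sig) * (\sum_k B (w k))
    + bet * sig * (\sum_k C (w k))) * f x.
Proof.
rewrite /laplacian big_map big_enum /= /softmm2 /d2_ratio -mulr_suml; congr (_ * _).
by rewrite !mulr_sumr -!big_split /= mulr_sumr; apply: eq_bigr.
Qed.

(** Only the terms in [meanA] differ, and their coefficient [lam - bet] is
    nonpositive. *)
Lemma laplacian_gordon :
  laplacian lam bet sig (bilin_dirs ++ [:: one_dir]) x <= laplacian lam bet sig sep_dirs x.
Proof.
rewrite {1}/laplacian big_cat /= big_seq1 -/(laplacian _ _ _ bilin_dirs x).
rewrite /bilin_dirs /sep_dirs !laplacian_map /softmm2 /d2_ratio -sum_meanB_eq -sum_meanC_eq.
have := sum_meanA2_ge; have := softmm_gt0 lam bet sig x.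
have l0 : 0 < lam := lam0; have lb : lam <= bet := lambet; rewrite sig2.
move: (f x) (\sum_k A (sep_dir k) ^+ 2) (\sum_k A (bilin_dir k) ^+ 2) (A one_dir ^+ 2)
  (\sum_k B (bilin_dir k)) (B one_dir) (\sum_k C (bilin_dir k)) (C one_dir).
move=> y S1 S2 S3 b b1 c c1 y0 S123.
rewrite -mulrDl ler_pM2r// -mulrDr ler_pM2l//.
have : (lam - bet) * (S2 + S3) <= (lam - bet) * S1 by rewrite ler_wnM2l// subr_le0.
lra.
Qed.

End FixedPoint.

Lemma softmm_shift_one lam bet sig (x : I -> R) a : 0 < bet ->
  softmm lam bet sig (shift x one_dir a) = softmm lam bet sig x * expR (lam * sig * a).
Proof.
move=> bet0.
have rowE u : rowsum bet (shift x one_dir a) u = expR (bet * a) * rowsum bet x u.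
  rewrite /rowsum mulr_sumr; apply: eq_bigr => v _.
  by rewrite -expRD /shift /one_dir; congr expR; ring.
have powE u : rowpow bet sig (shift x one_dir a) u
    = expR (bet * sig * a) * rowpow bet sig x u.
  rewrite /rowpow rowE lnM ?posrE ?expR_gt0 ?rowsum_gt0// expRK -expRD.
  by congr expR; ring.
have totE : total bet sig (shift x one_dir a) = expR (bet * sig * a) * total bet sig x.
  by rewrite /total mulr_sumr; apply: eq_bigr.
rewrite /softmm totE lnM ?posrE ?expR_gt0 ?total_gt0// expRK -expRD.
by congr expR; move: (ln _) => l; field; rewrite gt_eqF.
Qed.

(** The additional Gaussian, common to all entries, multiplies the average of
    [softmm] by exactly [expR (lam ^+ 2 / 2)]; taking it out is what makes the
    resulting tail bounds sharp. *)
Lemma gordon_comparison lam bet sig : 0 < lam -> lam <= bet -> sig ^+ 2 = 1 ->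
  (gauss_avg bilin_dirs (fun x => (softmm lam bet sig x)%:E) (fun=> 0%R)
   <= (expR (1 - lam ^+ 2 / 2))%:E
      * gauss_avg sep_dirs (fun x => (softmm lam bet sig x)%:E) (fun=> 0%R))%E.
Proof.
move=> lam0 lambet sig2.
have bet0 : 0 < bet by exact: lt_le_trans lambet.
have sig1 : `|sig| <= 1 by rewrite -(@expr_le1 _ 2)// real_normK ?num_real// sig2.
set ff := fun x => _.
have fb : borel_functional ff by exact: softmm_borel.
have f0 : nonneg_functional ff by exact: softmm_nonneg.
have main : (gauss_avg (bilin_dirs ++ [:: one_dir]) ff (fun=> 0%R)
    <= (expR 1)%:E * gauss_avg sep_dirs ff (fun=> 0%R))%E.
  apply: (gauss_avg_compare u0 v0 lam0 lambet sig1).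
  - move=> w /List.in_app_iff[|/= [<-|//]]; last exact: one_dir_le1.
    by apply: In_map_dir_le1; exact: bilin_dir_le1.
  - by apply: In_map_dir_le1; exact: sep_dir_le1.
  - by move=> x; exact: laplacian_gordon.
have oneE x : gauss_avg [:: one_dir] ff x = ((expR (lam ^+ 2 / 2))%:E * ff x)%E.
  transitivity (\int[normal_prob 0 1]_a (ff x * (expR (lam * sig * a))%:E))%E.
    by apply: eq_integral => a _; rewrite /ff /= softmm_shift_one// EFinM.
  apply: (etrans (ge0_integralZl _ measurableT _ _ (f0 x))).
  - by apply/measurable_EFinP; exact: measurable_expRM.
  - by move=> a _; rewrite lee_fin expR_ge0.
  - by rewrite gauss_mgf exprMn sig2 mulr1 muleC.
move: main; rewrite gauss_avg_cat (eq_gauss_avg _ oneE) gauss_avgZ ?expR_ge0// => main.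
have eE : expR (lam ^+ 2 / 2) * expR (1 - lam ^+ 2 / 2) = expR 1.
  by rewrite -expRD addrC subrK.
have e0 : 0 < expR (lam ^+ 2 / 2) by exact: expR_gt0.
rewrite -(@lee_pmul2l _ (expR (lam ^+ 2 / 2))%:E)//.
by rewrite muleA -EFinM eE.
Qed.

End Gordon.

(** * Bounds for the soft minimax and for chi variables *)

Section SoftmmBounds.
Context {R : realType} (Iu Iv : finType) (u0 : Iu) (v0 : Iv).
Variables (lam : R).
Hypothesis lam0 : 0 < lam.
Local Notation I := (Iu * Iv)%type.
Implicit Types (x : I -> R) (s : R).

(** So large that the cardinalities of the index sets only cost a factor [e]. *)
Definition temperature : R := lam * (1 + ln #|Iu|%:R + ln #|Iv|%:R).
Local Notation bet := temperature.

Let cardu : 1 <= #|Iu|%:R :> R. Proof. by rewrite ler1n; apply/card_gt0P; exists u0. Qed.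
Let cardv : 1 <= #|Iv|%:R :> R. Proof. by rewrite ler1n; apply/card_gt0P; exists v0. Qed.

Lemma lam_le_temperature : lam <= bet.
Proof.
have := ln_ge0 cardu; have := ln_ge0 cardv; have := lam0.
by rewrite /temperature => l0 h1 h2; apply: ler_peMr; [exact: ltW|lra].
Qed.

Let bet0 : 0 < bet. Proof. exact: lt_le_trans lam_le_temperature. Qed.

Let lnE (K : finType) (k0 : K) : expR (ln #|K|%:R) = #|K|%:R :> R.
Proof. by apply: lnK; rewrite posrE ltr0n; apply/card_gt0P; exists k0. Qed.

Let cost (r : R) : r <= ln #|Iu|%:R + ln #|Iv|%:R -> lam / bet * r <= 1.
Proof.
move=> h; rewrite mulrAC ler_pdivrMr// mul1r /temperature ler_pM2l//.
by apply: le_trans h _; lra.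
Qed.

Let sum_le_card (K : finType) (k0 : K) (F : K -> R) c : (forall k, F k <= expR c) ->
  \sum_k F k <= expR (ln #|K|%:R + c).
Proof.
move=> Fc; apply: le_trans (ler_sum _ (fun k _ => Fc k)) _.
by rewrite sumr_const expRD (lnE k0) mulr_natl.
Qed.

Let le_sum_expR (K : finType) (F : K -> R) k : (forall k, 0 <= F k) -> F k <= \sum_k F k.
Proof. by move=> F0; rewrite (bigD1 k)//= lerDl sumr_ge0. Qed.

Let rowsum_le x u s : (forall v, x (u, v) <= s) ->
  rowsum bet x u <= expR (ln #|Iv|%:R + bet * s).
Proof. by move=> xs; apply: sum_le_card => // v; rewrite ler_expR ler_pM2l. Qed.

Let le_rowsum x u v s : s <= x (u, v) -> expR (bet * s) <= rowsum bet x u.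
Proof.
move=> sx; apply: le_trans (le_sum_expR v _); last by move=> w; exact: expR_ge0.
by rewrite ler_expR ler_pM2l.
Qed.

Let ln_le (y r : R) : 0 < y -> y <= expR r -> ln y <= r.
Proof. by move=> y0 yr; rewrite -[leRHS]expRK ler_ln ?posrE ?expR_gt0. Qed.

Let le_ln (y r : R) : expR r <= y -> r <= ln y.
Proof.
by move=> ry; rewrite -[leLHS]expRK ler_ln ?posrE ?expR_gt0//; apply: lt_le_trans ry; exact: expR_gt0.
Qed.

Lemma softmm_max_ge x u v s : s <= x (u, v) -> expR (lam * s) <= softmm lam bet 1 x.
Proof.
move=> sx; rewrite ler_expR.
have -> : lam * s = lam / bet * (bet * s) by field; rewrite gt_eqF.
rewrite ler_pM2l ?divr_gt0//; apply: le_ln.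
apply: le_trans (le_sum_expR u _); last by move=> w; exact: expR_ge0.
by rewrite ler_expR mul1r; apply: le_ln; exact: le_rowsum sx.
Qed.

Lemma softmm_max_le x s : (forall p, x p <= s) -> softmm lam bet 1 x <= expR (1 + lam * s).
Proof.
move=> xs; rewrite ler_expR.
have := cost (lexx _); set l := ln _ + ln _ => lc.
have -> : lam * s = lam / bet * (bet * s) by field; rewrite gt_eqF.
apply: le_trans (lerD lc (lexx _)); rewrite -mulrDr ler_pM2l ?divr_gt0//.
apply: ln_le; first exact: total_gt0.
rewrite -addrA; apply: sum_le_card => // u.
by rewrite ler_expR mul1r; apply: ln_le; [exact: rowsum_gt0|exact: rowsum_le].
Qed.

Lemma softmm_minmax_ge x u s : (forall v, x (u, v) <= s) ->
  expR (- 1 - lam * s) <= softmm lam bet (- 1) x.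
Proof.
move=> xs; rewrite ler_expR.
have lc : lam / bet * ln #|Iv|%:R <= 1.
  by apply: cost; rewrite lerDr; exact: ln_ge0.
have -> : lam * s = lam / bet * (bet * s) by field; rewrite gt_eqF.
apply: (@le_trans _ _ (lam / bet * (- (ln #|Iv|%:R + bet * s)))).
  by rewrite mulrN mulrDr opprD lerB// lerN2.
rewrite ler_pM2l ?divr_gt0//; apply: le_ln.
apply: le_trans (le_sum_expR u _); last by move=> w; exact: expR_ge0.
rewrite ler_expR mulN1r lerN2; apply: ln_le; first exact: rowsum_gt0.
exact: rowsum_le.
Qed.

Lemma softmm_minmax_le x s : (forall u, exists v, s <= x (u, v)) ->
  softmm lam bet (- 1) x <= expR (1 - lam * s).
Proof.
move=> xs; rewrite ler_expR.
have lc : lam / bet * ln #|Iu|%:R <= 1.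
  by apply: cost; rewrite lerDl; exact: ln_ge0.
have -> : lam * s = lam / bet * (bet * s) by field; rewrite gt_eqF.
apply: (@le_trans _ _ (lam / bet * (ln #|Iu|%:R - bet * s))); last first.
  by rewrite mulrBr lerB.
rewrite ler_pM2l ?divr_gt0//; apply: ln_le; first exact: total_gt0.
apply: sum_le_card => // u; have [v sx] := xs u.
by rewrite ler_expR mulN1r lerN2; apply: le_ln; exact: le_rowsum sx.
Qed.

End SoftmmBounds.

Section ChiBounds.
Context {R : realType}.
Implicit Types (n : nat) (lam r : R).

(** The exponent whose Gaussian average realises the sharp bound
    [E exp (lam |g|) <= exp (lam sqrt n + lam ^ 2 / 2)], through the tangent
    inequality [|g| <= |g|^2 / (2 a) + a / 2] at [a = sqrt n + lam]. *)
Definition chi_exponent n lam : R := lam / (2 * (Num.sqrt n%:R + lam)).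

Lemma chi_upper_tangent n lam r : (0 < n)%N -> 0 < lam ->
  lam * r <= chi_exponent n lam * r ^+ 2 + lam * (Num.sqrt n%:R + lam) / 2.
Proof.
move=> n0 l0; rewrite /chi_exponent.
have s0 : 0 < Num.sqrt n%:R :> R by rewrite sqrtr_gt0 ltr0n.
set a := _ + lam; have a0 : 0 < a by rewrite addr_gt0.
have -> : lam / (2 * a) * r ^+ 2 + lam * a / 2 = lam * r + lam / (2 * a) * (r - a) ^+ 2.
  by field; rewrite gt_eqF.
by rewrite lerDl mulr_ge0 ?sqr_ge0// divr_ge0 ?mulr_ge0// ltW.
Qed.

Lemma chi_exponent_lt n lam : (0 < n)%N -> 0 < lam -> chi_exponent n lam < 1 / 2.
Proof.
move=> n0 l0; have s0 : 0 < Num.sqrt n%:R :> R by rewrite sqrtr_gt0 ltr0n.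
rewrite /chi_exponent ltr_pdivrMr; last by rewrite mulr_gt0// addr_gt0.
lra.
Qed.

(** [ln (1 + x) <= x] at [x = lam / sqrt n], as [1 - 2 * chi_exponent n lam] is
    [1 / (1 + x)]. *)
Lemma chi_upper_factor n lam : (0 < n)%N -> 0 < lam ->
  (Num.sqrt (1 - 2 * chi_exponent n lam))^-1 ^+ n <= expR (lam * Num.sqrt n%:R / 2).
Proof.
move=> n0 l0; set s := Num.sqrt n%:R.
have s0 : 0 < s :> R by rewrite sqrtr_gt0 ltr0n.
have s2 : s ^+ 2 = n%:R by rewrite sqr_sqrtr.
have sl0 : 0 < s + lam by rewrite addr_gt0.
have -> : lam * s / 2 = n%:R * (lam / (2 * s)).
  by rewrite -s2; field; rewrite gt_eqF.
rewrite expRM_natl lerXn2r ?nnegrE ?invr_ge0 ?expR_ge0//.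
have -> : 1 - 2 * chi_exponent n lam = s / (s + lam).
  by rewrite /chi_exponent -/s; field; rewrite gt_eqF.
rewrite -(@ler_pXn2r _ 2)// ?nnegrE ?invr_ge0 ?expR_ge0//.
have d0 : 0 <= s / (s + lam) by rewrite divr_ge0// ltW.
rewrite exprVn (sqr_sqrtr d0) invf_div -expRM_natl.
have -> : 2 * (lam / (2 * s)) = lam / s by field; rewrite gt_eqF.
apply: le_trans _ (expR_ge1Dx _).
by rewrite mulrDl divff ?gt_eqF.
Qed.

(** A majorant of [expR (- lam * r)] of the form [expR (c - theta * r ^+ 2)] is
    sharp only near one value of [r]. Hence [r / sqrt n] is localised in the
    cells [[j / n, (j + 1) / n]], with right endpoints [chi_cell n j], and each
    cell has its own majorant; summing over the cells costs a factor [n]. The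
    choice [1 + 2 * theta = (chi_cell n j)^-1] gives [theta = 0] in the last
    cell, whose majorant therefore also serves all larger [r]. *)
Definition chi_cell n (j : nat) : R := j.+1%:R / n%:R.
Definition chi_lower_exponent n j : R := - ((chi_cell n j)^-1 - 1) / 2.
Definition chi_lower_weight n lam j : R :=
  lam / Num.sqrt n%:R - lam * Num.sqrt n%:R * chi_cell n j
    + n%:R * chi_cell n j * (1 - chi_cell n j) / 2.

Lemma chi_cell_gt0 n j : (0 < n)%N -> 0 < chi_cell n j.
Proof. by move=> n0; rewrite divr_gt0 ?ltr0n. Qed.

Lemma chi_cell_le1 n j : (j < n)%N -> chi_cell n j <= 1.
Proof. by move=> jn; rewrite ler_pdivrMr ?mul1r ?ler_nat// ltr0n (leq_ltn_trans _ jn). Qed.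

Lemma chi_lower_pointwise n lam r : (0 < n)%N -> 0 <= lam -> 0 <= r ->
  expR (- lam * r) <= \sum_(j < n)
    expR (chi_lower_weight n lam j + chi_lower_exponent n j * r ^+ 2).
Proof.
move=> n0 l0 r0; pose s : R := Num.sqrt n%:R.
have n0' : 0 < n%:R :> R by rewrite ltr0n.
have s0 : 0 < s :> R by rewrite sqrtr_gt0.
have s2 : s ^+ 2 = n%:R by rewrite sqr_sqrtr// ltW.
(* the cell containing r, the last one if r is larger than sqrt n *)
have [j lowj upj] : exists2 j : 'I_n, s * (j%:R / n%:R) <= r &
    chi_lower_exponent n j * (s * chi_cell n j) ^+ 2 <= chi_lower_exponent n j * r ^+ 2
    \/ r <= s * chi_cell n j.
  pose q := n%:R * r / s.
  have q0 : 0 <= q by rewrite divr_ge0 ?mulr_ge0// ltW.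
  have rE : r = s * (q / n%:R) by rewrite /q; field; rewrite !gt_eqF.
  have [qn|qn] := ltnP (Num.truncn q) n.
    exists (Ordinal qn).
      by rewrite rE ler_pM2l// ler_pM2r ?invr_gt0//= truncn_le.
    right; rewrite [leLHS]rE ler_pM2l// /chi_cell ler_pM2r ?invr_gt0//=.
    by rewrite ltW// truncnS_gt.
  have jn : (n.-1 < n)%N by rewrite prednK.
  exists (Ordinal jn) => /=.
    rewrite rE ler_pM2l// ler_pM2r ?invr_gt0//.
    apply: (@le_trans _ _ n%:R); first by rewrite ler_nat leq_pred.
    by apply: (@le_trans _ _ (Num.truncn q)%:R); rewrite ?ler_nat// truncn_le.
  left; rewrite /chi_lower_exponent /chi_cell prednK// divff ?gt_eqF//.
  by rewrite invr1 subrr oppr0 !mul0r.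
apply: (@le_trans _ _ (expR (chi_lower_weight n lam j + chi_lower_exponent n j * r ^+ 2))); last first.
  by rewrite (bigD1 j)//= lerDl sumr_ge0// => i _; exact: expR_ge0.
rewrite ler_expR /chi_lower_weight -/s.
have c0 := chi_cell_gt0 j n0; have c1 := chi_cell_le1 (ltn_ord j).
set c := chi_cell n j in c0 c1 upj *.
have th0 : chi_lower_exponent n j <= 0.
  rewrite /chi_lower_exponent -/c mulNr oppr_le0 divr_ge0// subr_ge0.
  by rewrite invf_ge1.
have upj' : chi_lower_exponent n j * (s * c) ^+ 2 <= chi_lower_exponent n j * r ^+ 2.
  case: upj => // rc; apply: ler_wnM2l => //.
  by rewrite lerXn2r ?nnegrE// mulr_ge0// ltW.
have e1 : chi_lower_exponent n j * (s * c) ^+ 2 = - (n%:R * c * (1 - c) / 2).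
  by rewrite /chi_lower_exponent -/c exprMn s2; field; rewrite gt_eqF.
have e2 : lam / s - lam * s * c = - (lam * (s * (j%:R / n%:R))).
  rewrite /c /chi_cell -natr1 -s2; field; rewrite gt_eqF//.
have := ler_wpM2l l0 lowj.
rewrite e1 in upj'; rewrite e2 mulNr; lra.
Qed.

Lemma chi_lower_exponent_lt n j : (j < n)%N -> chi_lower_exponent n j < 1 / 2.
Proof.
move=> jn; have n0 : (0 < n)%N by apply: leq_ltn_trans jn.
have := chi_cell_gt0 j n0; rewrite -invr_gt0 /chi_lower_exponent; lra.
Qed.

Lemma chi_lower_factor n lam j : (j < n)%N -> 0 <= lam ->
  expR (chi_lower_weight n lam j) * (Num.sqrt (1 - 2 * chi_lower_exponent n j))^-1 ^+ n
    <= expR (lam / Num.sqrt n%:R - lam * Num.sqrt n%:R + lam ^+ 2 / 2).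
Proof.
move=> jn l0; have n0 : (0 < n)%N by apply: leq_ltn_trans jn.
have n0' : 0 < n%:R :> R by rewrite ltr0n.
have c0 := chi_cell_gt0 j n0; rewrite /chi_lower_weight.
have -> : 1 - 2 * chi_lower_exponent n j = (chi_cell n j)^-1.
  by rewrite /chi_lower_exponent; field; rewrite gt_eqF.
set c := chi_cell n j in c0 *; set s := Num.sqrt n%:R.
have s0 : 0 < s :> R by rewrite sqrtr_gt0.
have s2 : s ^+ 2 = n%:R by rewrite sqr_sqrtr// ltW.
have h : (Num.sqrt c^-1)^-1 <= expR (- (1 - c) / 2).
  rewrite -(@ler_pXn2r _ 2)// ?nnegrE ?invr_ge0 ?expR_ge0//.
  have ci0 : 0 <= c^-1 by rewrite invr_ge0 ltW.
  rewrite exprVn (sqr_sqrtr ci0) invrK -expRM_natl.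
  have -> : 2 * (- (1 - c) / 2) = c - 1 by field.
  by have := expR_ge1Dx (c - 1); rewrite addrC subrK.
have hn : (Num.sqrt c^-1)^-1 ^+ n <= expR (n%:R * (- (1 - c) / 2)).
  by rewrite expRM_natl lerXn2r ?nnegrE ?invr_ge0 ?expR_ge0.
apply: le_trans (ler_wpM2l (expR_ge0 _) hn) _; rewrite -expRD ler_expR -s2.
(* equality holds at lam = sqrt n * (1 - c) *)
have := sqr_ge0 (lam - s * (1 - c)); move: (lam / s) => q; nra.
Qed.

End ChiBounds.

(** * Tails of the bilinear process *)

Lemma markov_set {d} {T : measurableType d} {R : realType} (P : probability T R)
    (g : T -> R) (c b : R) :
  measurable_fun [set: T] g -> (forall t, 0 <= g t) -> 0 < c ->
  (\int[P]_t (g t)%:E <= (c * b)%:E)%E ->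
  measurable [set t | c <= g t] /\ (P [set t | (c <= g t)%R] <= b%:E)%E.
Proof.
move=> mg g0 c0 hb.
have mE : measurable [set t | c <= g t].
  have -> : [set t | c <= g t] = g @^-1` `[c, +oo[%classic.
    by apply/seteqP; split=> t /=; rewrite in_itv/= andbT.
  by rewrite -[X in measurable X]setTI; exact: mg.
split=> //; rewrite -(@lee_pmul2l _ c%:E)// -EFinM.
apply: le_trans hb.
have -> : (c%:E * P [set t | (c <= g t)%R] = \int[P]_(t in [set t | (c <= g t)%R]) (cst c%:E t))%E.
  by rewrite integral_cst.
apply: (@le_trans _ _ (\int[P]_(t in [set t | (c <= g t)%R]) (g t)%:E)%E).
  apply: ge0_le_integral => //.
  - by move=> t _; rewrite lee_fin ltW.
  - by apply: measurable_funTS; exact/measurable_EFinP.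
apply: ge0_subset_integral => //.
- exact/measurable_EFinP.
- by move=> t _; rewrite lee_fin.
Qed.

Section CauchySchwarz.
Context {R : realType} {J : finType}.
Implicit Types y z : J -> R.

Definition norm2 z : R := Num.sqrt (\sum_j z j ^+ 2).

Lemma norm2_ge0 z : 0 <= norm2 z. Proof. exact: sqrtr_ge0. Qed.

Lemma norm2_sqr z : norm2 z ^+ 2 = \sum_j z j ^+ 2.
Proof. by rewrite sqr_sqrtr// sumr_ge0// => j _; exact: sqr_ge0. Qed.

Lemma norm2_eq0 z : norm2 z = 0 -> forall j, z j = 0.
Proof.
move=> z0 j; have := norm2_sqr z; rewrite z0 expr0n /= => /esym/eqP.
rewrite psumr_eq0; last by move=> k _; exact: sqr_ge0.
by move=> /allP /(_ j (mem_index_enum _)); rewrite sqrf_eq0 => /eqP.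
Qed.

Lemma inner_le_norm2 y z : \sum_j y j ^+ 2 = 1 -> \sum_j z j * y j <= norm2 z.
Proof.
move=> y1; have := norm2_ge0 z; rewrite le_eqVlt => /orP[/eqP z0|z0].
  by rewrite -z0 big1// => j _; rewrite norm2_eq0 ?mul0r.
rewrite -(ler_pM2l z0); set r := norm2 z in z0 *.
have -> : r * r = \sum_j (z j ^+ 2 + r ^+ 2 * y j ^+ 2) / 2.
  by rewrite -mulr_suml big_split /= -mulr_sumr y1 -norm2_sqr -/r; field.
rewrite mulr_sumr; apply: ler_sum => j _.
have := sqr_ge0 (z j - r * y j); rewrite sqrrB exprMn; lra.
Qed.

Lemma inner_ge_norm2 y z : \sum_j y j ^+ 2 = 1 -> - norm2 z <= \sum_j z j * y j.
Proof.
move=> y1; rewrite lerNl -sumrN.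
have := inner_le_norm2 (fun j => - z j) y1.
have -> : norm2 (fun j => - z j) = norm2 z.
  by congr Num.sqrt; apply: eq_bigr => j _; rewrite sqrrN.
by under eq_bigr do rewrite mulNr.
Qed.

End CauchySchwarz.

Section Tails.
Context {R : realType} (Iu Iv J1 J2 : finType) (u0 : Iu) (v0 : Iv).
Variables (U : Iu -> J1 -> R) (V : Iv -> J2 -> R).
Hypothesis Uunit : forall u, \sum_i U u i ^+ 2 = 1.
Hypothesis Vunit : forall v, \sum_j V v j ^+ 2 = 1.
Local Notation I := (Iu * Iv)%type.
Local Notation J := (J1 + J2)%type.
Local Notation M := #|J1|.
Local Notation K := #|J2|.
Hypotheses (M0 : (0 < M)%N) (K0 : (0 < K)%N).

Definition sep_process (y : J -> R) : I -> R := fun p =>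
  \sum_i y (inl i) * U p.1 i + \sum_j y (inr j) * V p.2 j.

Lemma sep_process_shift x w a :
  sep_process (shift x w a) = shift (sep_process x) (sep_process w) a.
Proof.
apply/funext => p; rewrite /sep_process /shift mulrDr !mulr_sumr addrACA.
by rewrite -!big_split; congr (_ + _); apply: eq_bigr => k _ /=; ring.
Qed.

Lemma sep_process_basis k : sep_process (basis k) = sep_dir U V k.
Proof.
apply/funext => p; rewrite /sep_process /basis /sep_dir; case: k => k.
  rewrite (bigD1 k)//= eqxx mul1r [X in _ + X]big1 ?addr0; last by move=> j _; rewrite mul0r.
  by rewrite big1 ?addr0// => i ik; rewrite [inl i == _](negbTE ik) mul0r.
rewrite big1 ?add0r; last by move=> j _; rewrite mul0r.
rewrite (bigD1 k)//= eqxx mul1r big1 ?addr0// => i ik.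
by rewrite [inr i == _](negbTE ik) mul0r.
Qed.

Lemma gauss_avg_sep_dirs f : gauss_avg (sep_dirs U V) f (fun=> 0)
  = gauss_avg [seq basis k | k <- enum {: J}] (f \o sep_process) (fun=> 0).
Proof.
rewrite -(gauss_avg_linear sep_process_shift) -map_comp.
have -> : sep_process (fun=> 0) = fun=> 0.
  by apply/funext => p; rewrite /sep_process !big1 ?addr0// => k _; rewrite mul0r.
by congr (gauss_avg _ _ _); apply: eq_map => k /=; rewrite sep_process_basis.
Qed.

Lemma borel_sep_process f : borel_functional f -> borel_functional (f \o sep_process).
Proof.
move=> bf d T X mX; apply: bf => p; apply: measurable_funD.
  by apply: measurable_sum => i; apply: measurable_funM => //; exact: mX.
by apply: measurable_sum => i; apply: measurable_funM => //; exact: mX.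
Qed.

Definition block_exponent (t1 t2 : R) (k : J) : R :=
  match k with inl _ => t1 | inr _ => t2 end.

Lemma block_exp_quad t1 t2 y : exp_quad (block_exponent t1 t2) y
  = (expR (t1 * norm2 (y \o inl) ^+ 2 + t2 * norm2 (y \o inr) ^+ 2))%:E.
Proof. by rewrite /exp_quad sum_sum !norm2_sqr !mulr_sumr. Qed.

Lemma gauss_avg_block t1 t2 : t1 < 1 / 2 -> t2 < 1 / 2 ->
  gauss_avg [seq basis k | k <- enum {: J}] (exp_quad (block_exponent t1 t2)) (fun=> 0)
  = ((Num.sqrt (1 - 2 * t1))^-1 ^+ M * (Num.sqrt (1 - 2 * t2))^-1 ^+ K)%:E.
Proof.
move=> h1 h2; rewrite gauss_avg_exp_quad ?enum_uniq//; last by case.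
have -> : exp_quad (block_exponent t1 t2) (fun=> 0) = 1%E.
  by rewrite /exp_quad big1 ?expR0// => k _; rewrite expr0n /= mulr0.
by rewrite mule1 big_enum /= big_sumType /= !prodr_const.
Qed.

Section FixedRate.
Variable lam : R.
Hypothesis lam0 : 0 < lam.
Local Notation bet := (temperature Iu Iv lam).
Local Notation rM := (Num.sqrt M%:R : R).
Local Notation rK := (Num.sqrt K%:R : R).
Local Notation ff sig := (fun x : I -> R => (softmm lam bet sig x)%:E).

Let g_norm (y : J -> R) := norm2 (y \o inl).
Let h_norm (y : J -> R) := norm2 (y \o inr).

Lemma sep_process_le y p : sep_process y p <= g_norm y + h_norm y.
Proof.
apply: lerD; first exact: (inner_le_norm2 (y \o inl) (Uunit p.1)).
exact: (inner_le_norm2 (y \o inr) (Vunit p.2)).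
Qed.

(** [<g, u> + <h, v> <= |g| + |h|], and the tangent bound separates the two
    norms. *)
Lemma gauss_avg_sep_max :
  (gauss_avg (sep_dirs U V) (ff 1) (fun=> 0%R)
    <= (expR (1 + lam * rM + lam * rK + lam ^+ 2))%:E)%E.
Proof.
rewrite gauss_avg_sep_dirs.
pose c := 1 + lam * (rM + lam) / 2 + lam * (rK + lam) / 2.
pose th := block_exponent (chi_exponent M lam) (chi_exponent K lam).
have bq := exp_quad_borel th; have q0 := exp_quad_ge0 th.
have bf : borel_functional (ff 1 \o sep_process).
  by apply: borel_sep_process; exact: softmm_borel.
apply: (@le_trans _ _ (gauss_avg [seq basis k | k <- enum {: J}]
    (fun y => (expR c)%:E * exp_quad th y) (fun=> 0%R))%E).
  apply: le_gauss_avg => //.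
  - by move=> y; rewrite lee_fin ltW// softmm_gt0.
  - by move=> d T X mX; apply: measurable_funeM; exact: bq.
  - move=> y; rewrite /th block_exp_quad -EFinM lee_fin -expRD.
    apply: le_trans (softmm_max_le u0 v0 lam0 (sep_process_le y)) _.
    rewrite ler_expR /c mulrDr.
    have := chi_upper_tangent (g_norm y) M0 lam0.
    have := chi_upper_tangent (h_norm y) K0 lam0.
    rewrite /g_norm /h_norm; lra.
rewrite gauss_avgZ ?expR_ge0// gauss_avg_block ?chi_exponent_lt// -EFinM lee_fin.
have h1 := chi_upper_factor M0 lam0; have h2 := chi_upper_factor K0 lam0.
apply: (@le_trans _ _ (expR c * (expR (lam * rM / 2) * expR (lam * rK / 2)))).
  apply: ler_wpM2l; first exact: expR_ge0.
  by apply: ler_pM => //; rewrite exprn_ge0// invr_ge0.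
rewrite -!expRD ler_expR /c; move: rM rK => a b; nra.
Qed.

Section MinMax.
Variable del : R.
Hypotheses (del0 : 0 <= del) (del1 : del <= 1).
Hypothesis Vnet : forall h : J2 -> R, exists v, (1 - del) * norm2 h <= \sum_j h j * V v j.

Let lam' := (1 - del) * lam.

(** By the net property, [max_v (<g, u> + <h, v>)] is at least [(1 - del) * |h|
    - |g|] for every [u]. *)
Lemma gauss_avg_sep_minmax :
  (gauss_avg (sep_dirs U V) (ff (- 1)) (fun=> 0%R)
    <= (K%:R * expR (1 + lam * rM + lam ^+ 2 + lam / rK - lam' * rK))%:E)%E.
Proof.
have l0 : 0 < lam := lam0.
have l'0 : 0 <= lam' by rewrite mulr_ge0 ?subr_ge0// ltW.
have l'l : lam' <= lam.
  by rewrite /lam'; apply: ler_piMl; [exact: ltW|rewrite lerBlDr lerDl].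
rewrite gauss_avg_sep_dirs.
pose c j := 1 + lam * (rM + lam) / 2 + chi_lower_weight K lam' j.
pose th j := block_exponent (chi_exponent M lam) (chi_lower_exponent K j).
have bf : borel_functional (ff (- 1) \o sep_process).
  by apply: borel_sep_process; exact: softmm_borel.
pose F (j : 'I_K) y := ((expR (c j))%:E * exp_quad (th j) y)%E.
have bF j : borel_functional (F j).
  by move=> d T X mX; apply: measurable_funeM; exact: exp_quad_borel.
have F0 j : nonneg_functional (F j).
  by move=> y; apply: mule_ge0; [rewrite lee_fin expR_ge0|exact: exp_quad_ge0].
apply: (@le_trans _ _ (gauss_avg [seq basis k | k <- enum {: J}]
    (fun y => \sum_(j < K) F j y)%E (fun=> 0%R))).
  apply: le_gauss_avg => //.
  - by move=> y; rewrite lee_fin ltW// softmm_gt0.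
  - exact: borel_functional_sum.
  - move=> y; rewrite /F.
    have [v hv] := Vnet (y \o inr).
    have low u : exists v, (1 - del) * h_norm y - g_norm y <= sep_process y (u, v).
      exists v; rewrite addrC; apply: lerD => //.
      exact: (inner_ge_norm2 (y \o inl) (Uunit u)).
    under eq_bigr do rewrite block_exp_quad -EFinM -expRD.
    rewrite sumEFin lee_fin.
    apply: le_trans (softmm_minmax_le u0 v0 lam0 low) _.
    have := chi_lower_pointwise K0 l'0 (norm2_ge0 (y \o inr)).
    set S := \sum_(j < K) _ => pw.
    apply: (@le_trans _ _ (expR (1 + lam * (rM + lam) / 2
        + chi_exponent M lam * g_norm y ^+ 2) * S)).
      apply: le_trans (ler_wpM2l (expR_ge0 _) pw); rewrite -expRD ler_expR.
      have := chi_upper_tangent (g_norm y) M0 lam0.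
      rewrite /lam' -/(h_norm y); move: (h_norm y) (g_norm y) (chi_exponent M lam) => a b e.
      by move=> h; rewrite mulrBr; lra.
    rewrite /S mulr_sumr; apply: ler_sum => j _; rewrite -expRD ler_expR /c.
    by rewrite /g_norm; lra.
rewrite gauss_avg_sum//.
apply: (@le_trans _ _ (\sum_(j < K)
    (expR (1 + lam * rM + lam ^+ 2 + lam / rK - lam' * rK))%:E)%E); last first.
  by rewrite sumEFin sumr_const card_ord mulr_natl.
apply: lee_sum => j _; rewrite /F gauss_avgZ ?expR_ge0//; last 2 first.
- exact: exp_quad_borel.
- exact: exp_quad_ge0.
rewrite gauss_avg_block ?chi_exponent_lt ?chi_lower_exponent_lt// -EFinM lee_fin.
have h1 := chi_upper_factor M0 lam0; have h2 := chi_lower_factor (ltn_ord j) l'0.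
rewrite /c expRD mulrACA.
apply: (@le_trans _ _ (expR (1 + lam * (rM + lam) / 2) * expR (lam * rM / 2)
    * expR (lam' / rK - lam' * rK + lam' ^+ 2 / 2))).
  apply: ler_pM => //.
  by apply: ler_wpM2l => //; exact: expR_ge0.
have rK0 : 0 < rK by rewrite sqrtr_gt0 ltr0n.
have hd : lam' / rK <= lam / rK by rewrite ler_pM2r ?invr_gt0.
have hs : lam' ^+ 2 <= lam ^+ 2 by rewrite lerXn2r ?nnegrE// ltW.
rewrite -!expRD ler_expR; move: hd; move: (lam' / rK) (lam / rK) (lam' * rK) => p q r; nra.
Qed.

End MinMax.

Section Probability.
Context {d : measure_display} {T : measurableType d} {P : probability T R}.
Variable X : J1 * J2 -> {RV P >-> R}.
Hypothesis indepX : mutually_independent X.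
Hypothesis normalX : forall k, standard_normal (X k).

Definition bilin_process (t : T) : I -> R := fun p =>
  \sum_k X k t * (U p.1 k.1 * V p.2 k.2).

Lemma expectation_bilin_process sig : sig ^+ 2 = 1 ->
  (\int[P]_t (softmm lam bet sig (bilin_process t))%:E <=
    (expR (1 - lam ^+ 2 / 2))%:E * gauss_avg (sep_dirs U V) (ff sig) (fun=> 0%R))%E.
Proof.
move=> sig2; apply: le_trans (gordon_comparison u0 v0 Uunit Vunit lam0
  (lam_le_temperature u0 v0 lam0) sig2).
rewrite -(expectation_gauss_avg indepX normalX (bilin_dir U V) _ (enum_uniq _)); last 2 first.
- exact: softmm_borel.
- exact: softmm_nonneg.
rewrite le_eqVlt; apply/orP; left; apply/eqP; apply: eq_integral => t _.
congr (softmm _ _ _ _)%:E; apply/funext => p.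
by rewrite add0r big_enum.
Qed.

Lemma measurable_bilin_process sig :
  measurable_fun [set: T] (fun t => softmm lam bet sig (bilin_process t)).
Proof.
apply/measurable_EFinP; apply: (@softmm_borel _ _ _ lam bet sig _ _ bilin_process) => p.
by apply: measurable_sum => k; exact: measurable_funM.
Qed.

(** Over nets of unit vectors [bilin_process] approaches the largest singular
    value from below; the exceptional set is that of Markov's inequality for
    [softmm] at the rate [lam] equal to the deviation. *)
Lemma bilin_max_tail : exists2 E : set T, measurable E &
  (P E <= (expR (2 - lam ^+ 2 / 2))%:E)%E /\
  forall t u v, rM + rK + lam <= bilin_process t (u, v) -> E t.
Proof.
pose s := rM + rK + lam.
have hE := expectation_bilin_process (expr1n _ 2).
have := @markov_set _ _ _ P (fun t => softmm lam bet 1 (bilin_process t))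
  (expR (lam * s)) (expR (2 - lam ^+ 2 / 2)) (measurable_bilin_process 1).
move=> H; have [] := H.
- by move=> t; rewrite ltW// softmm_gt0.
- exact: expR_gt0.
- apply: le_trans hE _; apply: le_trans (lee_wpmul2l _ gauss_avg_sep_max) _.
    by rewrite lee_fin expR_ge0.
  by rewrite -!EFinM lee_fin -!expRD ler_expR /s; nra.
move=> mE PE; exists [set t | expR (lam * s) <= softmm lam bet 1 (bilin_process t)] => //.
by split=> // t u v h; exact: (softmm_max_ge u0 v0 lam0 h).
Qed.

(** The counterpart of [bilin_max_tail] for the smallest singular value. The
    mesh [del] is so small that the loss [(1 - del) * |h|] costs a bounded
    factor. *)
Lemma bilin_minmax_tail (del : R) : 0 <= del <= 1 ->
  (forall h : J2 -> R, exists v, (1 - del) * norm2 h <= \sum_j h j * V v j) ->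
  lam <= rK -> del * (lam * rK) <= 1 ->
  exists2 E : set T, measurable E &
    (P E <= (K%:R * expR (5 - lam ^+ 2 / 2))%:E)%E /\
    forall t u, (forall v, bilin_process t (u, v) <= rK - rM - lam) -> E t.
Proof.
move=> /andP[del0 del1] Vnet lamK delK.
pose s := rK - rM - lam.
have rK0 : 0 < rK by rewrite sqrtr_gt0 ltr0n.
have lK1 : lam / rK <= 1 by rewrite ler_pdivrMr// mul1r.
have sig2 : (- 1) ^+ 2 = 1 :> R by rewrite sqrrN expr1n.
have hE := expectation_bilin_process sig2.
have := @markov_set _ _ _ P (fun t => softmm lam bet (- 1) (bilin_process t))
  (expR (- 1 - lam * s)) (K%:R * expR (5 - lam ^+ 2 / 2)) (measurable_bilin_process (- 1)).
move=> H; have [] := H.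
- by move=> t; rewrite ltW// softmm_gt0.
- exact: expR_gt0.
- apply: le_trans hE _.
  apply: le_trans (lee_wpmul2l _ (gauss_avg_sep_minmax del0 del1 Vnet)) _.
    by rewrite lee_fin expR_ge0.
  rewrite -!EFinM lee_fin mulrCA [leRHS]mulrCA ler_wpM2l// -!expRD ler_expR /s.
  by move: lK1 delK; move: (lam / rK) rK rM => q a b; nra.
move=> mE PE.
exists [set t | expR (- 1 - lam * s) <= softmm lam bet (- 1) (bilin_process t)] => //.
by split=> // t u h; exact: (softmm_minmax_ge u0 v0 lam0 h).
Qed.

End Probability.

End FixedRate.

End Tails.

(** * Nets, singular values and condition numbers *)

Section Nets.
Context {R : realType}.

(** One representative per nonempty cell of a grid on the unit sphere. *)
Lemma sphere_net (J : finType) (j0 : J) (del : R) : 0 < del ->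
  exists (K : finType) (k0 : K) (U : K -> J -> R),
    (forall k, \sum_j U k j ^+ 2 = 1) /\
    (forall z : J -> R, \sum_j z j ^+ 2 = 1 ->
      exists k, norm2 (fun j => U k j - z j) <= del).
Proof.
move=> del0; pose N := #|J|.
have N0 : 0 < N%:R :> R by rewrite ltr0n; apply/card_gt0P; exists j0.
pose q := (Num.truncn (N%:R / del)).+1.
have q0 : 0 < q%:R :> R by rewrite ltr0n.
have qN : N%:R / del <= q%:R by rewrite ltW// truncnS_gt.
move: q q0 qN => q q0 qN.
pose pos (r : R) := Num.truncn ((r + 1) * q%:R).
pose cell (z : J -> R) : {ffun J -> 'I_(2 * q).+1} := [ffun j => inord (pos (z j))].
have posP (r : R) : `|r| <= 1 -> [/\ (pos r <= 2 * q)%N, (pos r)%:R <= (r + 1) * q%:R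
    & (r + 1) * q%:R <= (pos r).+1%:R].
  rewrite ler_norml => /andP[r1 r2].
  have p0 : 0 <= (r + 1) * q%:R by apply: mulr_ge0; [lra|exact: ltW].
  have le1 : (pos r)%:R <= (r + 1) * q%:R by rewrite truncn_le.
  split=> //; last by rewrite ltW// truncnS_gt.
  rewrite -(ler_nat R); apply: le_trans le1 _; rewrite natrM ler_pM2r//; lra.
have [U hU] : {U : {ffun J -> 'I_(2 * q).+1} -> J -> R & forall k,
    \sum_j U k j ^+ 2 = 1 /\
    ((exists2 z : J -> R, \sum_j z j ^+ 2 = 1 & cell z = k) -> cell (U k) = k)}.
  apply: (@choice _ _ (fun k (y : J -> R) => \sum_j y j ^+ 2 = 1 /\
    ((exists2 z : J -> R, \sum_j z j ^+ 2 = 1 & cell z = k) -> cell y = k))) => k.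
  have [[z z1 zk]|no] := pselect (exists2 z : J -> R, \sum_j z j ^+ 2 = 1 & cell z = k).
    by exists z.
  exists (fun j => (j == j0)%:R); split=> //.
  by rewrite (bigD1 j0)//= eqxx expr1n big1 ?addr0// => j /negbTE ->; rewrite expr0n.
exists {ffun J -> 'I_(2 * q).+1}, [ffun=> ord0], U; split=> [k|z z1].
  by case: (hU k).
exists (cell z); have [U1 Ucell] := hU (cell z).
have {}Ucell := Ucell (ex_intro2 _ _ z z1 erefl).
move: (U (cell z)) U1 Ucell => y y1 yz.
have close j : `|y j - z j| <= q%:R^-1.
  have [p1 p2 p3] := posP _ (unit_coord j y1).
  have [r1 r2 r3] := posP _ (unit_coord j z1).
  have pr : pos (y j) = pos (z j).
    by move/ffunP: yz => /(_ j); rewrite !ffunE => /(congr1 val); rewrite /= !inordK// ltnS.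
  rewrite pr -!natr1 in p2 p3 r2 r3 *.
  rewrite -(ler_pM2r q0) mulVf ?gt_eqF// -{1}(ger0_norm (ltW q0)) -normrM.
  by rewrite ler_norml; apply/andP; split; lra.
rewrite -(@ler_pXn2r _ 2)// ?nnegrE ?norm2_ge0 ?(ltW del0)// norm2_sqr.
apply: (@le_trans _ _ (\sum_(j : J) q%:R^-1 ^+ 2)).
  apply: ler_sum => j _; rewrite -[leLHS]real_normK ?num_real//.
  by rewrite lerXn2r ?nnegrE ?invr_ge0 ?ler0n.
rewrite sumr_const -[_ *+ _]mulr_natl -/N.
have Nq : N%:R <= del * q%:R by rewrite mulrC -ler_pdivrMr.
have N1 : 1 <= N%:R :> R by rewrite ler1n; apply/card_gt0P; exists j0.
rewrite exprVn ler_pdivrMr ?exprn_gt0// -exprMn.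
apply: (@le_trans _ _ (N%:R ^+ 2)); first by rewrite expr2 ler_peMr// ltW.
by rewrite lerXn2r ?nnegrE ?mulr_ge0 ?(ltW N0) ?(ltW del0) ?(ltW q0).
Qed.

(** For unit vectors, [|v - z| ^ 2 = 2 - 2 <v, z>]. *)
Lemma net_inner (J K : finType) (V : K -> J -> R) (k0 : K) (del : R) :
  0 <= del <= 1 -> (forall k, \sum_j V k j ^+ 2 = 1) ->
  (forall z : J -> R, \sum_j z j ^+ 2 = 1 -> exists k, norm2 (fun j => V k j - z j) <= del) ->
  forall h : J -> R, exists k, (1 - del) * norm2 h <= \sum_j h j * V k j.
Proof.
move=> /andP[del0 del1] Vunit net h; have := norm2_ge0 h; rewrite le_eqVlt => /orP[/eqP h0|h0].
  exists k0; rewrite -h0 mulr0; apply: le_trans (inner_ge_norm2 h (Vunit k0)).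
  by rewrite -h0 oppr0.
pose z j := h j / norm2 h.
have z1 : \sum_j z j ^+ 2 = 1.
  rewrite /z; under eq_bigr do rewrite expr_div_n.
  by rewrite -mulr_suml -norm2_sqr divff// expf_eq0 gt_eqF.
have [k Vk] := net z z1; exists k.
have hE : \sum_j h j * V k j = norm2 h * \sum_j z j * V k j.
  by rewrite mulr_sumr; apply: eq_bigr => j _; rewrite /z; field; rewrite gt_eqF.
rewrite hE mulrC ler_pM2l//.
have : norm2 (fun j => V k j - z j) ^+ 2 <= del ^+ 2.
  by rewrite lerXn2r ?nnegrE ?norm2_ge0.
rewrite norm2_sqr.
have -> : \sum_j (V k j - z j) ^+ 2 = 2 - 2 * \sum_j z j * V k j.
  transitivity (\sum_j (V k j ^+ 2 + z j ^+ 2 - 2 * (z j * V k j))).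
    by apply: eq_bigr => j _; ring.
  by rewrite sumrB big_split /= Vunit z1 -mulr_sumr.
have : del ^+ 2 <= del by rewrite expr2 ler_piMr.
lra.
Qed.

End Nets.

Section OperatorBounds.
Context {R : realType} {J1 J2 : finType}.
Variable A : J1 -> J2 -> R.

Definition lcomb (z : J1 -> R) (j : J2) : R := \sum_i z i * A i j.

Definition bilin (y : J1 -> R) (z : J2 -> R) : R := \sum_j lcomb y j * z j.

Lemma lcombZ (c : R) z : lcomb (fun i => c * z i) = fun j => c * lcomb z j.
Proof. by apply/funext => j; rewrite /lcomb mulr_sumr; apply: eq_bigr => i _; rewrite mulrA. Qed.

Lemma norm2Z (J : finType) (c : R) (z : J -> R) : 0 <= c ->
  norm2 (fun j => c * z j) = c * norm2 z.
Proof.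
move=> c0; rewrite /norm2; under eq_bigr do rewrite exprMn.
by rewrite -mulr_sumr sqrtrM ?sqr_ge0// sqrtr_sqr ger0_norm.
Qed.

Lemma norm2_normalize (J : finType) (z : J -> R) : 0 < norm2 z ->
  \sum_j ((norm2 z)^-1 * z j) ^+ 2 = 1.
Proof.
move=> z0; under eq_bigr do rewrite exprMn.
by rewrite -mulr_sumr -norm2_sqr -exprMn mulVf ?gt_eqF// expr1n.
Qed.

Lemma inner_le_norm2M (J : finType) (y z : J -> R) : \sum_j y j * z j <= norm2 y * norm2 z.
Proof.
have := norm2_ge0 z; rewrite le_eqVlt => /orP[/eqP z0|z0].
  by rewrite -z0 mulr0 big1// => j _; rewrite [z j]norm2_eq0 ?mulr0.
rewrite -(ler_pM2l (x := (norm2 z)^-1)) ?invr_gt0// mulrCA mulVf ?gt_eqF// mulr1.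
apply: le_trans (inner_le_norm2 y (norm2_normalize z0)); rewrite mulr_sumr.
by apply: ler_sum => j _; rewrite mulrCA.
Qed.

Section FromNets.
Variables (Iu Iv : finType) (U : Iu -> J1 -> R) (V : Iv -> J2 -> R) (del S s : R).
Hypotheses (del0 : 0 <= del) (del1 : del < 1) (S0 : 0 <= S).
Hypothesis Uunit : forall u, \sum_i U u i ^+ 2 = 1.
Hypothesis Vunit : forall v, \sum_j V v j ^+ 2 = 1.
Hypothesis Unet : forall z : J1 -> R, \sum_j z j ^+ 2 = 1 ->
  exists u, norm2 (fun j => U u j - z j) <= del.
Hypothesis Uinner : forall h : J1 -> R, exists u, (1 - del) * norm2 h <= \sum_i h i * U u i.
Hypothesis Vinner : forall h : J2 -> R, exists v, (1 - del) * norm2 h <= \sum_j h j * V v j.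
Hypothesis upper : forall u v, bilin (U u) (V v) <= S.

Local Notation S1 := (S / (1 - del) ^+ 2).

Let k0 : 0 < 1 - del. Proof. by rewrite subr_gt0. Qed.

(** With [w] the image of [z], [|w| ^ 2] is the inner product of [z] with the
    transposed image of [w]; the nets on the two sides each lose one factor [1
    - del]. *)
Lemma lcomb_upper z : \sum_i z i ^+ 2 = 1 -> norm2 (lcomb z) <= S1.
Proof.
move=> z1; set w := lcomb z; rewrite ler_pdivlMr ?exprn_gt0//.
have := norm2_ge0 w; rewrite le_eqVlt => /orP[/eqP w0|w0].
  by rewrite -w0 mul0r.
pose Aw i := \sum_j w j * A i j.
have exch y : \sum_i Aw i * y i = \sum_j w j * lcomb y j.
  transitivity (\sum_i \sum_j w j * A i j * y i).
    by apply: eq_bigr => i _; rewrite mulr_suml.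
  rewrite exchange_big; apply: eq_bigr => j _; rewrite /lcomb mulr_sumr.
  by apply: eq_bigr => i _; ring.
have w2 : norm2 w ^+ 2 <= norm2 Aw.
  apply: le_trans (inner_le_norm2 Aw z1); rewrite exch norm2_sqr.
  by apply: ler_sum => j _; rewrite expr2.
have [u hu] := Uinner Aw.
have [v hv] := Vinner (lcomb (U u)).
rewrite exch in hu.
have h1 := inner_le_norm2M w (lcomb (U u)).
have h2 : (1 - del) * norm2 w <= norm2 (lcomb (U u)).
  rewrite -(ler_pM2l w0); apply: le_trans h1; apply: le_trans hu.
  by rewrite mulrCA -expr2 ler_pM2l.
apply: le_trans (upper u v); apply: le_trans hv.
by rewrite mulrC expr2 -mulrA ler_pM2l.
Qed.

(** The net comes within [del] of [z], and [lcomb_upper] bounds the image of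
    the difference. *)
Lemma lcomb_lower z : (forall u, exists v, s <= bilin (U u) (V v)) ->
  \sum_i z i ^+ 2 = 1 -> s - del * S1 <= norm2 (lcomb z).
Proof.
move=> lower z1; have [u uz] := Unet z1; have [v sv] := lower u.
pose dz i := U u i - z i.
have split_bilin : bilin (U u) (V v) = bilin z (V v) + bilin dz (V v).
  rewrite /bilin -big_split; apply: eq_bigr => j _ /=; rewrite -mulrDl; congr (_ * _).
  by rewrite /lcomb -big_split; apply: eq_bigr => i _ /=; rewrite /dz; ring.
have dz_le : norm2 (lcomb dz) <= del * S1.
  have S10 : 0 <= S1 by rewrite divr_ge0// sqr_ge0.
  have := norm2_ge0 dz; rewrite le_eqVlt => /orP[/eqP d0|d0].
    have dz0 i : dz i = 0 by exact: norm2_eq0.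
    have -> : norm2 (lcomb dz) = 0; last exact: mulr_ge0.
    rewrite /norm2 big1 ?sqrtr0// => j _.
    by rewrite /lcomb big1 ?expr0n// => i _; rewrite dz0 mul0r.
  have := lcomb_upper (norm2_normalize d0).
  rewrite lcombZ norm2Z ?invr_ge0 ?norm2_ge0// => h.
  apply: (@le_trans _ _ (norm2 dz * S1)); last exact: ler_wpM2r.
  by rewrite -ler_pdivrMl.
have h1 : bilin z (V v) <= norm2 (lcomb z) by exact: inner_le_norm2.
have h2 : bilin dz (V v) <= norm2 (lcomb dz) by exact: inner_le_norm2.
move: sv h1 h2 dz_le; rewrite split_bilin; lra.
Qed.

End FromNets.

End OperatorBounds.

Section ConditionNumber.
Context {R : realType}.

Lemma norm2_row m (v : 'rV[R]_m) : (v *m v^T) 0 0 = norm2 (fun i => v 0 i) ^+ 2.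
Proof. by rewrite norm2_sqr mxE; apply: eq_bigr => i _; rewrite mxE expr2. Qed.

Lemma lcomb_row m k (A : 'M[R]_(m, k)) (v : 'rV[R]_m) :
  (fun j => (v *m A) 0 j) = lcomb (fun i j => A i j) (fun i => v 0 i).
Proof. by apply/funext => j; rewrite mxE. Qed.

Lemma norm2_row_gt0 m (v : 'rV[R]_m) : v != 0 -> 0 < norm2 (fun i => v 0 i).
Proof.
move=> v0; rewrite lt_neqAle norm2_ge0 andbT eq_sym; apply: contra v0 => /eqP n0.
apply/eqP/rowP => i; rewrite mxE.
exact: (norm2_eq0 n0).
Qed.

Variables (m k : nat) (A : 'M[R]_(m, k)) (s S : R).
Hypothesis s0 : 0 < s.
Hypothesis bounds : forall z : 'I_m -> R, \sum_i z i ^+ 2 = 1 ->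
  s <= norm2 (lcomb (fun i j => A i j) z) <= S.

Let row_bounds (v : 'rV[R]_m) : let n := norm2 (fun i => v 0 i) in 0 < n ->
  s * n <= norm2 (fun j => (v *m A) 0 j) <= S * n.
Proof.
move=> n n0; have := bounds (norm2_normalize n0).
rewrite lcombZ norm2Z ?invr_ge0 ?norm2_ge0// -lcomb_row mulrC => /andP[h1 h2].
by rewrite -ler_pdivlMr// h1 -ler_pdivrMr.
Qed.

(** For an eigenvector [v] of [A *m A^T], the eigenvalue times [|v| ^ 2] is [|v
    A| ^ 2]. *)
Lemma eigenvalue_bounds a : eigenvalue (A *m A^T) a -> s ^+ 2 <= a <= S ^+ 2.
Proof.
move=> /eigenvalueP[v va v0]; have n0 := norm2_row_gt0 v0.
set n := norm2 (fun i => v 0 i) in n0.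
have /andP[h1 h2] := row_bounds n0.
have e : a * n ^+ 2 = norm2 (fun j => (v *m A) 0 j) ^+ 2.
  by rewrite -[RHS]norm2_row trmx_mul mulmxA -(mulmxA v) va -scalemxAl mxE norm2_row.
have S0 : 0 <= S.
  by rewrite -(pmulr_lge0 _ n0); apply: le_trans h2; exact: norm2_ge0.
rewrite -(ler_pM2r (x := n ^+ 2)) ?exprn_gt0// -[a <= _](ler_pM2r (x := n ^+ 2)) ?exprn_gt0//.
rewrite e -!exprMn !lerXn2r ?nnegrE ?norm2_ge0//.
- by rewrite mulr_ge0// ltW.
- by rewrite mulr_ge0// ltW.
Qed.

Lemma row_free_of_bounds : \rank A = m.
Proof.
apply/eqP; rewrite -[_ == _]/(row_free A) -kermx_eq0; apply/rowV0P => v /sub_kermxP vA.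
apply/eqP/negPn/negP => v0; have n0 := norm2_row_gt0 v0.
have /andP[h1 _] := row_bounds n0; move: h1; rewrite vA.
have -> : norm2 (fun j => (0 : 'rV[R]_k) 0 j) = 0.
  by rewrite /norm2 big1 ?sqrtr0// => j _; rewrite mxE expr0n.
by rewrite leNgt mulr_gt0.
Qed.

Lemma cond_number_le C : 1 <= C -> S <= C * s -> (cond_number A <= C%:E)%E.
Proof.
move=> C1 SC; rewrite /cond_number row_free_of_bounds ltnn lee_fin.
have C0 : 0 <= C by apply: le_trans C1.
rewrite /lambda_max /lambda_min; set L := [set a | eigenvalue (A *m A^T) a].
have [->|/set0P L0] := eqVneq L set0.
  by rewrite sup0 mul0r sqrtr0.
have Lb a : L a -> s ^+ 2 <= a <= S ^+ 2 by exact: eigenvalue_bounds.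
have supL : sup L <= S ^+ 2.
  by apply: sup_le_ub => // a /Lb /andP[].
have infL : s ^+ 2 <= inf L.
  by apply: lb_le_inf => // a /Lb /andP[].
have infL0 : 0 < inf L by apply: lt_le_trans infL; rewrite exprn_gt0.
have S0 : 0 <= S.
  have [a /eigenvalueP[v va v0]] := L0; have n0 := norm2_row_gt0 v0.
  have /andP[h1 h2] := row_bounds n0.
  by rewrite -(pmulr_lge0 _ n0); apply: le_trans h2; exact: norm2_ge0.
rewrite -(ger0_norm C0) -sqrtr_sqr ler_sqrt ?sqr_ge0// ler_pdivrMr//.
apply: le_trans supL _; apply: (@le_trans _ _ (C ^+ 2 * s ^+ 2)).
  by rewrite -exprMn lerXn2r ?nnegrE// mulr_ge0// ltW.
by apply: ler_wpM2l => //; exact: sqr_ge0.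
Qed.

End ConditionNumber.

Section Frames.
Context {R : realType}.

Lemma is_frame_of_col_submx m n (F : 'M[R]_(m, n)) (K : {set 'I_n}) :
  \rank (col_submx F K) = m -> is_frame F.
Proof.
move=> rK; rewrite /is_frame /row_full eqn_leq rank_leq_col /=.
rewrite -[X in (X <= _)%N]rK -mxrank_tr; apply: mxrankS.
by rewrite /col_submx trmx_mxsub; exact: rowsub_sub.
Qed.

End Frames.

(** * Measurability of robustness *)

Section RootSets.
Context {d : measure_display} {T : measurableType d} {R : realType}.

Lemma measurable_sublevel (f : T -> R) c : measurable_fun [set: T] f ->
  measurable [set t | f t < c].
Proof.
move=> mf; have -> : [set t | f t < c] = f @^-1` `]-oo, c[%classic.
  by apply/seteqP; split=> t /=; rewrite in_itv.
by rewrite -[X in measurable X]setTI; exact: mf.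
Qed.

(** On a segment, compactness turns the existence of a zero into that of
    arbitrarily small values, which can be tested at countably many points. The
    points are rationals moved into the segment, which may be a single
    irrational point. *)
Lemma measurable_root_segment (g : T -> R -> R) (a b : R) : a <= b ->
  (forall x, measurable_fun [set: T] (g ^~ x)) -> (forall t, continuous (g t)) ->
  measurable [set t | exists2 x, a <= x <= b & g t x = 0].
Proof.
move=> ab mg cg.
pose clamp (q : rat) : R := Num.max a (Num.min b (ratr q)).
have clampP q : a <= clamp q <= b.
  by rewrite /clamp le_max lexx/= ge_max ab/= ge_min lexx.
suff -> : [set t | exists2 x, a <= x <= b & g t x = 0] =
    \bigcap_n \bigcup_q [set t | `|g t (clamp q)| < n.+1%:R^-1].
  apply: bigcapT_measurable => n; apply: bigcupT_measurable_rat => q.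
  by apply: measurable_sublevel; apply: measurableT_comp => //; exact: mg.
apply/seteqP; split=> [t [x /andP[ax xb] gx] n _|t near0].
  have n0 : 0 < n.+1%:R^-1 :> R by rewrite invr_gt0.
  have /cvgrPdist_lt /(_ _ n0) := cg t x; rewrite gx => -[e/= e0 he].
  have [q] : exists q : rat, ratr q \in `]x - e, x + e[.
    by apply: rat_in_itvoo; lra.
  rewrite in_itv/= => /andP[q1 q2]; exists q => //=.
  rewrite -normrN -[- g _ _]add0r; apply: he => /=.
  rewrite /clamp ltr_distlC.
  by case: (leP b (ratr q)) => bq; rewrite /Num.max; case: ifPn;
    rewrite -?leNgt => ?; apply/andP; split; lra.
have cn : {within `[a, b], continuous (fun x => `|g t x|)}.
  apply: continuous_subspaceT => x; apply: cvg_norm; exact: cg.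
have [x] := EVT_min ab cn; rewrite in_itv/= => xab xmin.
exists x => //; apply/eqP; rewrite -normr_le0; apply/ler_addgt0Pl => e e0; rewrite addr0.
have [n ne] : exists n, n.+1%:R^-1 < e.
  exists (Num.truncn e^-1); rewrite invf_plt ?posrE//; exact: truncnS_gt.
have [q _ /= hq] := near0 n I.
apply: ltW; apply: le_lt_trans (lt_trans hq ne); apply: xmin.
by rewrite in_itv/=; exact: clampP.
Qed.

Lemma measurable_root_above (g : T -> R -> R) (a : R) :
  (forall x, measurable_fun [set: T] (g ^~ x)) -> (forall t, continuous (g t)) ->
  measurable [set t | exists2 x, a < x & g t x = 0].
Proof.
move=> mg cg.
suff -> : [set t | exists2 x, a < x & g t x = 0] = \bigcup_n [set t |
    exists2 x, a + n.+1%:R^-1 <= x <= a + n.+1%:R^-1 + n%:R & g t x = 0].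
  apply: bigcupT_measurable => n; apply: measurable_root_segment => //.
  by rewrite lerDl.
apply/seteqP; split=> [t [x ax gx]|t [n _ [x /andP[nx _] gx]]]; last first.
  by exists x => //; apply: lt_le_trans nx; rewrite ltrDl invr_gt0.
have xa0 : 0 < x - a by rewrite subr_gt0.
pose n := maxn (Num.truncn (x - a)^-1) (Num.truncn (x - a)).+1.
exists n => //; exists x => //; apply/andP; split.
  rewrite addrC -lerBrDr invf_ple ?posrE//; apply: (le_trans (ltW (truncnS_gt _))).
  by rewrite ler_nat ltnS leq_maxl.
rewrite addrAC -lerBlDr addrC -lerBrDr opprK.
have := truncnS_gt (x - a).
have : (Num.truncn (x - a)).+1%:R <= n%:R :> R by rewrite ler_nat leq_maxr.
have : 0 < n.+1%:R^-1 :> R by rewrite invr_gt0.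
move: (n.+1%:R^-1) (n%:R : R) => u v; lra.
Qed.

Lemma measurable_root_below (g : T -> R -> R) (a : R) :
  (forall x, measurable_fun [set: T] (g ^~ x)) -> (forall t, continuous (g t)) ->
  measurable [set t | exists2 x, x < a & g t x = 0].
Proof.
move=> mg cg.
suff -> : [set t | exists2 x, x < a & g t x = 0] =
    [set t | exists2 x, - a < x & g t (- x) = 0].
  apply: measurable_root_above (fun t x => g t (- x)) _ _ _ => [x|t x]; first exact: mg.
  by apply: continuous_comp; [exact: opp_continuous|exact: cg].
apply/seteqP; split=> t [x xa gx]; exists (- x); rewrite ?opprK ?ltrN2//.
by rewrite ltrNl.
Qed.

End RootSets.

Section Determinants.
Context {R : realType}.

Lemma measurable_det {d} {T : measurableType d} n (A : T -> 'M[R]_n) :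
  (forall i j, measurable_fun [set: T] (fun t => A t i j)) ->
  measurable_fun [set: T] (fun t => \det (A t)).
Proof.
move=> mA; apply: measurable_sum => s; apply: measurable_funM => //.
by apply: measurable_prod => i _; exact: mA.
Qed.

Lemma measurable_gram {d} {T : measurableType d} m k (A : T -> 'M[R]_(m, k)) i j :
  (forall i j, measurable_fun [set: T] (fun t => A t i j)) ->
  measurable_fun [set: T] (fun t => (A t *m (A t)^T) i j).
Proof.
move=> mA; under eq_fun do rewrite mxE.
apply: measurable_sum => l; apply: measurable_funM; first exact: mA.
by under eq_fun do rewrite mxE; exact: mA.
Qed.

Lemma continuous_charpoly n (S : 'M[R]_n) : continuous (fun a => \det (S - a%:M)).
Proof.
apply: continuous_big => [|s _ a]; first exact: add_continuous.
apply: cvgM; first exact: cvg_cst.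
move: a; apply: continuous_big => [|i _ a]; first exact: mul_continuous.
under eq_fun do rewrite !mxE.
apply: cvgB; first exact: cvg_cst.
by apply: cvgMn; exact: cvg_id.
Qed.

Lemma eigenvalue_det n (S : 'M[R]_n) a : eigenvalue S a = (\det (S - a%:M) == 0).
Proof.
by rewrite /eigenvalue /eigenspace kermx_eq0 row_free_unit unitmxE unitfE negbK.
Qed.

Lemma finite_roots (p : {poly R}) : p != 0 -> exists s : seq R, forall x, root p x -> x \in s.
Proof.
move: {2}(size p) (leqnn (size p)) => n; elim: n p => [|n IHn] p.
  by rewrite leqn0 size_poly_eq0 => /eqP ->; rewrite eqxx.
move=> sp p0; have [[a pa]|nop] := pselect (exists a, root p a); last first.
  by exists [::] => x px; exfalso; apply: nop; exists x.
have /factor_theorem[q qE] := pa.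
have q0 : q != 0 by apply: contra p0 => /eqP q0; rewrite qE q0 mul0r.
have [|s hs] := IHn q _ q0.
  by move: sp; rewrite qE size_mul ?polyXsubC_eq0// size_XsubC addn2.
exists (a :: s) => x; rewrite qE rootM root_XsubC inE => /orP[/hs ->|->]//.
by rewrite orbT.
Qed.

Lemma eigenvalue_finite n (S : 'M[R]_n) :
  exists s : seq R, forall a, eigenvalue S a -> a \in s.
Proof.
have [|s hs] := @finite_roots (char_poly S).
  exact: monic_neq0 (char_poly_monic S).
by exists s => a; rewrite eigenvalue_root_char; exact: hs.
Qed.

Lemma seq_pos_bounds (s : seq R) : exists lo hi : R,
  0 < lo /\ forall a, a \in s -> 0 < a -> lo <= a <= hi.
Proof.
elim: s => [|b s [lo [hi [lo0 h]]]]; first by exists 1, 1.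
have [b0|b0] := leP b 0.
  exists lo, hi; split=> // a; rewrite inE => /orP[/eqP ->|]; last exact: h.
  by rewrite ltNge b0.
exists (Num.min lo b), (Num.max hi b); split; first by rewrite lt_min lo0.
move=> a; rewrite inE => /orP[/eqP -> _|as_ a0].
  by rewrite ge_min le_max lexx !orbT.
by have /andP[h1 h2] := h a as_ a0; rewrite ge_min le_max h1 h2.
Qed.

End Determinants.

Section Gram.
Context {R : realType}.

(** Over the reals [v *m A *m A^T *m v^T] is the squared norm of [v *m A]. *)
Lemma gram_row_free m k (A : 'M[R]_(m, k)) : row_free (A *m A^T) = row_free A.
Proof.
apply/idP/idP => [|freeA].
  by rewrite /row_free !eqn_leq !rank_leq_row /= => h; exact: leq_trans h (mxrankM_maxl _ _).
rewrite -kermx_eq0; apply/rowV0P => v /sub_kermxP vS.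
have vA : v *m A = 0.
  apply/eqP/negPn/negP => /norm2_row_gt0; rewrite ltNge => /negP; apply.
  rewrite -(@ler_pXn2r _ 2)// ?nnegrE ?norm2_ge0// -norm2_row trmx_mul.
  by rewrite mulmxA -(mulmxA v) vS mul0mx mxE expr0n.
by apply/eqP; rewrite -(mulmx_free_eq0 _ freeA) vA.
Qed.

Lemma rank_lt_gram m k (A : 'M[R]_(m, k)) : (\rank A < m)%N = (\det (A *m A^T) == 0).
Proof.
have -> : (\rank A < m)%N = ~~ row_free A by rewrite ltn_neqAle rank_leq_row andbT.
by rewrite -gram_row_free row_free_unit unitmxE unitfE negbK.
Qed.

Lemma gram_eigenvalue_gt0 m k (A : 'M[R]_(m, k)) a :
  \det (A *m A^T) != 0 -> eigenvalue (A *m A^T) a -> 0 < a.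
Proof.
move=> detA /eigenvalueP[v va v0].
have vA : v *m A != 0.
  by rewrite mulmx_free_eq0// /row_free eqn_leq rank_leq_row /= leqNgt rank_lt_gram.
have n0 := norm2_row_gt0 v0; have nA := norm2_row_gt0 vA.
have e : a * norm2 (fun i => v 0 i) ^+ 2 = norm2 (fun j => (v *m A) 0 j) ^+ 2.
  by rewrite -[RHS]norm2_row trmx_mul mulmxA -(mulmxA v) va -scalemxAl mxE norm2_row.
by rewrite -(pmulr_lgt0 _ (exprn_gt0 2 n0)) e exprn_gt0.
Qed.

(** When [A *m A^T] is invertible its spectrum is finite and positive, so the
    ratio of its extremes exceeds [C ^+ 2] exactly when a rational number
    separates some eigenvalue from [C ^+ 2] times another one. This form
    involves countably many conditions only. *)
Lemma cond_number_leP m k (A : 'M[R]_(m, k)) C : 1 <= C ->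
  (cond_number A <= C%:E)%E <->
  \det (A *m A^T) != 0 /\
  ~ exists q : rat, (exists2 a, ratr q < a & \det (A *m A^T - a%:M) = 0) /\
                    (exists2 b, b < ratr q / C ^+ 2 & \det (A *m A^T - b%:M) = 0).
Proof.
move=> C1; have C0 : 0 < C by apply: lt_le_trans C1.
have C20 : 0 < C ^+ 2 by exact: exprn_gt0.
rewrite /cond_number rank_lt_gram; case: eqVneq => [_|det0] /=.
  by split=> [|[]//]; rewrite leye_eq.
rewrite lee_fin /lambda_max /lambda_min; set L := [set a | eigenvalue (A *m A^T) a].
have L0 a : L a -> 0 < a by exact: gram_eigenvalue_gt0.
have LE a : L a <-> \det (A *m A^T - a%:M) = 0.
  by rewrite /L /= eigenvalue_det; split=> /eqP.
have [s sL] := eigenvalue_finite (A *m A^T).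
have [lo [hi [lo0 lohi]]] := seq_pos_bounds s.
have {sL lohi} Lb a : L a -> lo <= a <= hi.
  by move=> La; apply: lohi (L0 a La); exact: sL.
transitivity (forall a b, L a -> L b -> a <= C ^+ 2 * b); last first.
  split=> [h|[_ h] a b La Lb'].
    split=> // -[q [[a qa /LE La] [b bq /LE Lb']]].
    have := h a b La Lb'; rewrite leNgt => /negP; apply; apply: lt_trans qa.
    by rewrite mulrC -ltr_pdivlMr.
  rewrite leNgt; apply/negP => /rat_in_itvoo[q]; rewrite in_itv/= => /andP[bq qa].
  apply: h; exists q; split; first by exists a => //; exact/LE.
  by exists b; [rewrite ltr_pdivlMr// mulrC|exact/LE].
have sqrtC : C = Num.sqrt (C ^+ 2) by rewrite sqrtr_sqr ger0_norm// ltW.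
split=> [h a b La Lb'|h].
  have infle : inf L <= b by apply: ge_inf => //; exists lo => c /Lb /andP[].
  have lesup : a <= sup L by apply: ub_le_sup => //; exists hi => c /Lb /andP[].
  have inf0 : 0 < inf L.
    by apply: lt_le_trans lo0 _; apply: lb_le_inf; [exists a|move=> c /Lb /andP[]].
  move: h; rewrite {1}sqrtC ler_sqrt ?(ltW C20)// ler_pdivrMr// => h.
  by apply: le_trans lesup (le_trans h _); rewrite ler_pM2l.
have [->|/set0P[a La]] := eqVneq L set0.
  by rewrite sup0 mul0r sqrtr0 ltW.
have inf0 : 0 < inf L.
  by apply: lt_le_trans lo0 _; apply: lb_le_inf; [exists a|move=> c /Lb /andP[]].
rewrite [leRHS]sqrtC ler_sqrt ?(ltW C20)// ler_pdivrMr// mulrC -ler_pdivrMr//.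
apply: lb_le_inf; first by exists a.
move=> b Lb'; rewrite ler_pdivrMr// mulrC; apply: sup_le_ub; first by exists a.
by move=> c Lc; exact: h.
Qed.

End Gram.

Section NERFEvent.
Context {d : measure_display} {T : measurableType d} {R : realType}.

Lemma measurable_det_neq0 n (A : T -> 'M[R]_n) :
  (forall i j, measurable_fun [set: T] (fun t => A t i j)) ->
  measurable [set t | \det (A t) != 0].
Proof.
move=> /measurable_det mA.
have -> : [set t | \det (A t) != 0] = (fun t => \det (A t)) @^-1` (~` [set 0]).
  by apply/seteqP; split=> t /= /eqP.
by rewrite -[X in measurable X]setTI; apply: mA => //; apply: measurableC; exact: measurable_set1.
Qed.

Lemma measurable_cond_number_le m k (A : T -> 'M[R]_(m, k)) C : 1 <= C ->
  (forall i j, measurable_fun [set: T] (fun t => A t i j)) ->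
  measurable [set t | (cond_number (A t) <= C%:E)%E].
Proof.
move=> C1 mA; pose g t a := \det (A t *m (A t)^T - a%:M).
have -> : [set t | (cond_number (A t) <= C%:E)%E] =
    [set t | \det (A t *m (A t)^T) != 0] `&` ~` \bigcup_(q : rat)
      ([set t | exists2 a, ratr q < a & g t a = 0] `&`
       [set t | exists2 b, b < ratr q / C ^+ 2 & g t b = 0]).
  apply/seteqP; split=> t /=.
    move=> /(cond_number_leP _ C1)[h1 h2]; split=> // -[q _ h3]; apply: h2; exists q; exact: h3.
  move=> [h1 h2]; apply/(cond_number_leP _ C1); split=> // -[q h3]; apply: h2; exists q => //.
have mS i j : measurable_fun [set: T] (fun t => (A t *m (A t)^T) i j) by exact: measurable_gram.
have mg a : measurable_fun [set: T] (g ^~ a).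
  apply: measurable_det => i j; under eq_fun do rewrite !mxE.
  by apply: measurable_funB => //; have := mS i j; under eq_fun do rewrite mxE.
have cg t : continuous (g t) by exact: continuous_charpoly.
apply: measurableI; first exact: measurable_det_neq0.
apply: measurableC; apply: bigcupT_measurable_rat => q.
by apply: measurableI; [exact: measurable_root_above|exact: measurable_root_below].
Qed.

Lemma measurable_NERF (P : probability T R) m n (F : 'M[{RV P >-> R}]_(m, n)) p C :
  1 <= C -> measurable [set t | is_NERF p C (sample_mx F t)].
Proof.
move=> C1.
have mF i j : measurable_fun [set: T] (fun t => sample_mx F t i j).
  by under eq_fun do rewrite mxE; exact: measurable_funPT.
have -> : [set t | is_NERF p C (sample_mx F t)] =
    [set t | \det (sample_mx F t *m (sample_mx F t)^T) != 0] `&`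
    \bigcap_(K in [set K : {set 'I_n} | #|K|%:R = (1 - p) * n%:R])
      [set t | (cond_number (col_submx (sample_mx F t) K) <= C%:E)%E].
  apply/seteqP; split=> t [h1 h2]; split=> //.
    by rewrite /= -rank_lt_gram -leqNgt -mxrank_tr; move: h1; rewrite /is_frame /row_full => /eqP ->.
  by move: h1; rewrite /= -rank_lt_gram -leqNgt -mxrank_tr /is_frame /row_full eqn_leq rank_leq_col.
apply: measurableI.
  by apply: measurable_det_neq0 => i j; exact: measurable_gram.
apply: fin_bigcap_measurable; first exact: finite_finset.
move=> K _; apply: measurable_cond_number_le => // i j.
by rewrite /col_submx; under eq_fun do rewrite mxE; exact: mF.
Qed.

End NERFEvent.

(** * Tail bounds for the condition number and for robustness *)

(** The strict inequality [S < C * s] leaves room for the two errors made on a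
    net. *)
Lemma net_radius (R : realType) (S s C w : R) : 0 < S -> 1 <= C -> S < C * s -> 0 < w ->
  exists del : R, [/\ 0 < del, del < 1, del * w <= 1 &
    let S1 := S / (1 - del) ^+ 2 in S1 <= C * (s - del * S1)].
Proof.
move=> S0 C1 SC w0; pose gap := C * s - S; have gap0 : 0 < gap by rewrite subr_gt0.
have D0 : 0 < S * (4 + 2 * C) by apply: mulr_gt0 => //; lra.
(* del <= 1 / 4 gives (1 - del) ^ -2 <= 1 + 4 del <= 2 *)
pose del := Num.min (4^-1) (Num.min w^-1 (gap / (S * (4 + 2 * C)))).
have del0 : 0 < del.
  by rewrite !lt_min invr_gt0 ltr0n/= invr_gt0 w0/= divr_gt0.
have [d1 d2 d3] : [/\ del <= 4^-1, del <= w^-1 & del <= gap / (S * (4 + 2 * C))].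
  by rewrite /del; split; rewrite !ge_min lexx ?orbT.
exists del; split=> //; first lra.
  by rewrite -ler_pdivlMr// div1r.
rewrite ler_pdivlMr// /gap in d3.
move: d1 d3 del0; clear d2; move: del => e d1 d3 e0.
have k0 : 0 < (1 - e) ^+ 2 by apply: exprn_gt0; lra.
have S1S : S / (1 - e) ^+ 2 <= S * (1 + 4 * e).
  rewrite ler_pdivrMr// -mulrA ler_peMr ?(ltW S0)//.
  have : 0 <= e * (2 - 7 * e) by apply: mulr_ge0; lra.
  have : 0 <= e ^+ 3 by apply: exprn_ge0; lra.
  have -> : (1 + 4 * e) * (1 - e) ^+ 2 = 1 + e * (2 - 7 * e) + 4 * e ^+ 3 by ring.
  lra.
have S12 : S / (1 - e) ^+ 2 <= S * 2 by apply: le_trans S1S _; rewrite ler_pM2l//; lra.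
move=> /=; move: (S / (1 - e) ^+ 2) S1S S12 => S1 S1S S12.
have C0 : 0 < C by exact: lt_le_trans C1.
have : C * (e * S1) <= C * (e * (S * 2)) by rewrite !ler_pM2l.
have : S * (1 + 4 * e) = S + e * (S * (4 + 2 * C)) - C * (e * (S * 2)) by ring.
rewrite mulrBr; lra.
Qed.

Section SampleRestriction.
Context {d : measure_display} {T : measurableType d} {R : realType} {P : probability T R}.

Lemma mutually_independent_inj (I I' : finType) (X : I -> {RV P >-> R}) (f : I' -> I) :
  injective f -> mutually_independent X -> mutually_independent (X \o f).
Proof.
move=> finj indX J B mB.
(* no condition is put on the variables outside the image of f *)
pose B' i := if [pick i' | f i' == i] is Some i' then B i' else setT.
have B'f i' : B' (f i') = B i'.
  by rewrite /B'; case: pickP => [k /eqP /finj ->|/(_ i')]//; rewrite eqxx.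
have mB' i : measurable (B' i) by rewrite /B'; case: pickP.
have := indX (f @: J) B' mB'.
rewrite big_imset /=; last by move=> x y _ _; exact: finj.
under eq_bigr do rewrite B'f.
move=> <-; congr (P _); apply/seteqP; split=> t h i /=.
  by move=> /imsetP[i' i'J ->]; rewrite B'f; exact: h.
by move=> iJ; rewrite -B'f; apply: (h (f i)); exact: imset_f.
Qed.

Lemma bilin_processE (Iu Iv J1 J2 : finType) (U : Iu -> J1 -> R) (V : Iv -> J2 -> R)
    (X : J1 * J2 -> {RV P >-> R}) t u v :
  bilin_process U V X t (u, v) = bilin (fun i j => X (i, j) t) (U u) (V v).
Proof.
rewrite /bilin_process /bilin /lcomb /=.
under [RHS]eq_bigr do rewrite mulr_suml.
rewrite exchange_big pair_big /=; apply: eq_bigr => -[i j] _ /=; ring.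
Qed.

Lemma cond_number_tail m k (X : 'I_m * 'I_k -> {RV P >-> R}) (C lam : R) :
  (0 < m)%N -> (0 < k)%N -> mutually_independent X -> (forall ij, standard_normal (X ij)) ->
  1 <= C -> 0 < lam -> lam <= Num.sqrt k%:R ->
  Num.sqrt m%:R + Num.sqrt k%:R + lam < C * (Num.sqrt k%:R - Num.sqrt m%:R - lam) ->
  exists2 E : set T, measurable E &
    (P E <= (k.+1%:R * expR (5 - lam ^+ 2 / 2))%:E)%E /\
    forall t, ~ E t -> let A := \matrix_(i, j) X (i, j) t in
      \rank A = m /\ (cond_number A <= C%:E)%E.
Proof.
move=> m0 k0 indX normX C1 lam0 lamk; set S := _ + lam; set s := _ - lam => SC.
have sm0 : 0 < Num.sqrt m%:R :> R by rewrite sqrtr_gt0 ltr0n.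
have sk0 : 0 < Num.sqrt k%:R :> R by rewrite sqrtr_gt0 ltr0n.
have S0 : 0 < S by rewrite /S; lra.
have [del [del0 del1 delw]] := net_radius S0 C1 SC (mulr_gt0 lam0 sk0).
set S1 := S / _ => SC1.
have S10 : 0 < S1 by rewrite /S1 divr_gt0// exprn_gt0// subr_gt0.
have [Iu [u0 [U [Uunit Unet]]]] := sphere_net (Ordinal m0) del0.
have [Iv [v0 [V [Vunit Vnet]]]] := sphere_net (Ordinal k0) del0.
have d01 : 0 <= del <= 1 by rewrite !ltW.
have Uinner := net_inner u0 d01 Uunit Unet.
have Vinner := net_inner v0 d01 Vunit Vnet.
have cm : (0 < #|'I_m|)%N by rewrite card_ord.
have ck : (0 < #|'I_k|)%N by rewrite card_ord.
have [E1 mE1] := bilin_max_tail u0 v0 Uunit Vunit cm ck lam0 indX normX.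
rewrite !card_ord => -[PE1 hE1].
have [||E2 mE2] := bilin_minmax_tail u0 v0 Uunit Vunit cm ck lam0 indX normX d01 Vinner.
- by rewrite card_ord.
- by rewrite card_ord.
rewrite !card_ord => -[PE2 hE2].
exists (E1 `|` E2); first exact: measurableU.
split.
  apply: le_trans (measureU2 P mE1 mE2) _; apply: le_trans (leeD PE1 PE2) _.
  rewrite -EFinD lee_fin -[k.+1%:R]natr1 mulrDl mul1r addrC lerD2l ler_expR; lra.
move=> t /not_orP[nE1 nE2] A.
have AE : (fun i j => A i j) = (fun i j => X (i, j) t).
  by apply/funext => i; apply/funext => j; rewrite mxE.
have upper u v : bilin (fun i j => A i j) (U u) (V v) <= S.
  rewrite AE -bilin_processE leNgt; apply/negP => h; apply: nE1; apply: (hE1 t u v).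
  exact: ltW.
have lower u : exists v, s <= bilin (fun i j => A i j) (U u) (V v).
  apply: contrapT => no; apply: nE2; apply: (hE2 t u) => v.
  by rewrite bilin_processE -AE leNgt; apply/negP => h; apply: no; exists v; exact: ltW.
have bounds z : \sum_i z i ^+ 2 = 1 ->
    s - del * S1 <= norm2 (lcomb (fun i j => A i j) z) <= S1.
  move=> z1; apply/andP; split.
    exact: (lcomb_lower (ltW del0) del1 (ltW S0) Vunit Unet Uinner Vinner upper lower z1).
  exact: (lcomb_upper del1 (ltW S0) Uinner Vinner upper z1).
have s10 : 0 < s - del * S1.
  by rewrite -(pmulr_rgt0 _ (lt_le_trans ltr01 C1)); apply: lt_le_trans SC1.
split; first exact: row_free_of_bounds s10 bounds.
exact: (cond_number_le s10 bounds C1 SC1).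
Qed.

End SampleRestriction.

Section UnionBound.
Context {d : measure_display} {T : measurableType d} {R : realType} {P : probability T R}.

Lemma union_bound (I : finType) (Q : pred I) (E : I -> set T) (b : R) :
  (forall i, Q i -> measurable (E i)) -> (forall i, Q i -> (P (E i) <= b%:E)%E) ->
  exists2 E' : set T, measurable E' &
    (P E' <= (#|Q|%:R * b)%:E)%E /\ forall i, Q i -> E i `<=` E'.
Proof.
move=> mE PE; rewrite cardE.
have : forall i, i \in enum Q -> Q i by move=> i; rewrite mem_enum.
suff : forall s : seq I, (forall i, i \in s -> Q i) -> exists2 E' : set T, measurable E' &
    (P E' <= ((size s)%:R * b)%:E)%E /\ forall i, i \in s -> E i `<=` E'.
  move=> h /h[E' mE' [PE' sub]]; exists E' => //; split=> // i Qi.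
  by apply: sub; rewrite mem_enum.
elim=> [|i s IHs] sQ.
  by exists set0 => //; rewrite measure0 mul0r.
have [|E' mE' [PE' sub]] := IHs.
  by move=> j js; apply: sQ; rewrite inE js orbT.
have Qi : Q i by apply: sQ; rewrite inE eqxx.
exists (E i `|` E'); first by apply: measurableU => //; exact: mE.
split.
  apply: le_trans (measureU2 P (mE _ Qi) mE') _; apply: le_trans (leeD (PE _ Qi) PE') _.
  by rewrite -EFinD lee_fin /= -[(size s).+1%:R]natr1 mulrDl mul1r addrC.
move=> j; rewrite inE => /orP[/eqP -> |/sub h]; first exact: subsetUl.
by apply: subset_trans h _; exact: subsetUr.
Qed.

End UnionBound.

Section Entropy.
Context {R : realType}.

Lemma ln_le_self (x : R) : 0 < x -> 1 + ln x <= x.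
Proof. by move=> x0; rewrite -[leRHS]lnK// ; exact: expR_ge1Dx. Qed.

Lemma entropy_ge0 (p : R) : 0 <= p <= 1 -> 0 <= p * (1 - ln p).
Proof.
move=> /andP[p0 p1]; apply: mulr_ge0 => //.
by rewrite subr_ge0; apply: le_trans (ln_le0 p1) _.
Qed.

(** With [j = n - k = p n], one term of the binomial expansion gives [C(n, j) *
    p ^ j <= (1 + p) ^ n <= exp (n p)]. *)
Lemma binomial_le_entropy (n k : nat) (p : R) : 0 <= p <= 1 -> (k <= n)%N ->
  k%:R = (1 - p) * n%:R -> 'C(n, k)%:R <= expR (n%:R * (p * (1 - ln p))).
Proof.
move=> /andP[p0 p1] kn kE; have := p0; rewrite le_eqVlt => /orP[/eqP p00|pp].
  have -> : k = n by apply/eqP; rewrite -(eqr_nat R) kE -p00 subr0 mul1r.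
  by rewrite binn -p00 mul0r mulr0 expR0.
have jE : (n - k)%:R = n%:R * p by rewrite natrB// kE; ring.
have h1 : 'C(n, k)%:R * p ^+ (n - k) <= (1 + p) ^+ n.
  have nk : (n - k < n.+1)%N by rewrite ltnS leq_subr.
  rewrite exprDn (bigD1 (Ordinal nk))//=.
  rewrite expr1n mul1r bin_sub// mulr_natl lerDl.
  by apply: sumr_ge0 => i _; rewrite mulrn_wge0// expr1n mul1r exprn_ge0.
have h2 : (1 + p) ^+ n <= expR (n%:R * p).
  rewrite mulrC expRM_natr lerXn2r ?nnegrE ?expR_ge0 ?addr_ge0//; exact: expR_ge1Dx.
have h3 : p ^+ (n - k) = expR (n%:R * p * ln p).
  by rewrite -jE mulrC expRM_natr lnK.
rewrite h3 in h1; have {h1 h2} := le_trans h1 h2.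
rewrite -ler_pdivlMr ?expR_gt0// -expRN -expRD => /le_trans; apply.
by rewrite ler_expR le_eqVlt; apply/orP; left; apply/eqP; ring.
Qed.

End Entropy.

Section Robustness.
Context {d : measure_display} {T : measurableType d} {R : realType} {P : probability T R}.

(** A union bound over the sets of [k] columns. There is at least one such set,
    and a submatrix of full rank makes [F] a frame. *)
Lemma NERF_tail (m n k : nat) (p C lam : R) (F : 'M[{RV P >-> R}]_(m, n)) :
  (0 < m)%N -> (0 < k <= n)%N -> k%:R = (1 - p) * n%:R -> 1 <= C ->
  0 < lam -> lam <= Num.sqrt k%:R ->
  Num.sqrt m%:R + Num.sqrt k%:R + lam < C * (Num.sqrt k%:R - Num.sqrt m%:R - lam) ->
  iid_standard_normal_mx F ->
  (P [set t | ~ is_NERF p C (sample_mx F t)] <=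
    ('C(n, k)%:R * (k.+1%:R * expR (5 - lam ^+ 2 / 2)))%:E)%E.
Proof.
move=> m0 /andP[k0 kn] kE C1 lam0 lamk SC [indF normF].
pose good (K : {set 'I_n}) t := \rank (col_submx (sample_mx F t) K) = m /\
  (cond_number (col_submx (sample_mx F t) K) <= C%:E)%E.
have tail (K : {set 'I_n}) : exists E : set T, #|K| == k -> measurable E /\
    (P E <= (k.+1%:R * expR (5 - lam ^+ 2 / 2))%:E)%E /\ forall t, ~ E t -> good K t.
  have [/eqP Kk|] := boolP (#|K| == k); last by exists set0.
  rewrite -Kk in k0 lamk SC *.
  pose f (ij : 'I_m * 'I_#|K|) := (ij.1, enum_val ij.2).
  have finj : injective f by move=> [i j] [i' j'] [-> /enum_val_inj ->].
  have [E mE [PE gE]] := @cond_number_tail _ _ _ P m #|K| _ C lam m0 k0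
    (mutually_independent_inj finj indF) (fun ij => normF _ _) C1 lam0 lamk SC.
  exists E => _; split; [exact: mE|split; [exact: PE|move=> t /gE]].
  have -> : \matrix_(i, j) (((fun ij => F ij.1 ij.2) \o f) (i, j)) t =
      col_submx (sample_mx F t) K; last by [].
  by apply/matrixP => i j; rewrite !mxE.
have [E hE] := choice tail.
have [E' mE' [PE' sub]] := @union_bound _ T R P _ (fun K : {set 'I_n} => #|K| == k) E
  (k.+1%:R * expR (5 - lam ^+ 2 / 2)) (fun K h => (hE K h).1) (fun K h => (hE K h).2.1).
have cardK : #|(fun K : {set 'I_n} => #|K| == k)| = 'C(n, k).
  by rewrite -[X in 'C(X, _)]card_ord -card_draws; apply: eq_card => K; rewrite !inE.
rewrite cardK in PE'.
apply: le_trans PE'; apply: le_measure; rewrite ?inE//.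
  by apply: measurableC; exact: measurable_NERF.
move=> t; apply: contra_notP => nE'.
have gK (K : {set 'I_n}) : #|K| == k -> good K t.
  by move=> Kk; apply: (hE K Kk).2.2 => EK; apply: nE'; exact: sub EK.
split; last first.
  move=> K; rewrite -kE => /eqP; rewrite eqr_nat => Kk; exact: (gK K Kk).2.
have [K Kk] : exists K : {set 'I_n}, #|K| == k.
  have : (0 < #|(fun K : {set 'I_n} => #|K| == k)|)%N by rewrite cardK bin_gt0.
  by move=> /card_gt0P[K Kk]; exists K.
exact: is_frame_of_col_submx (gK K Kk).1.
Qed.

End Robustness.

Theorem theorem2 (R : realType) (eps : R) (heps : 0 < eps)
    (alpha : R) (halpha : 0 < alpha) :
  exists c : R,
    forall (M N : nat) (p C : R),
      (0 < M)%N -> (0 < N)%N ->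
      0 <= p <= 1 -> (1 - p) * N%:R \is a Num.int ->
      1 <= C ->
      Num.sqrt (M%:R / N%:R) <=
        (C - 1) / (C + 1) * Num.sqrt (1 - p)
        - Num.sqrt (eps + 2 * p * (1 - ln p)) ->
    forall (d : measure_display) (T : measurableType d) (P : probability T R)
      (F : 'M[{RV P >-> R}]_(M, N)),
      iid_standard_normal_mx F ->
      (P [set t | ~ is_NERF p C (sample_mx F t)] <=
        (c * N%:R `^ (- alpha))%:E)%E.
Proof.
(* by ln N <= N / q + ln q, the power of N costs at most exp (N eps / 4) *)
pose q := 4 * (alpha + 1) / eps.
have a1 : 0 < alpha + 1 by lra.
have q0 : 0 < q by rewrite divr_gt0// mulr_gt0.
exists (2 * expR (5 + (alpha + 1) * ln q)).
move=> M N p C M0 N0 p01 kint C1 hyp d T P F iidF.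
have /andP[p0 p1] := p01.
have N0R : 0 < N%:R :> R by rewrite ltr0n.
have [k kE] : exists k : nat, k%:R = (1 - p) * N%:R.
  have : (1 - p) * N%:R \is a Num.nat.
    by rewrite natrEint kint mulr_ge0 ?ler0n// subr_ge0.
  by move=> /natrP[k kE]; exists k.
have kN : (k <= N)%N by rewrite -(ler_nat R) kE ler_piMl ?ler0n//; lra.
set h := p * (1 - ln p).
have h0 : 0 <= h := entropy_ge0 p01.
set r := (C - 1) / (C + 1).
have C10 : 0 < C + 1 by lra.
have r1 : r < 1 by rewrite ltr_pdivrMr//; lra.
(* In lam ^ 2 / 2 = N (eps / 4 + h), the summand h pays for the choice of the
   columns and eps / 4 for the power of N; the hypothesis allows eps / 2, and
   the rest makes the inequality [key] strict. *)
pose lam := Num.sqrt (N%:R * (eps / 2 + 2 * h)).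
have lam0 : 0 < lam by rewrite sqrtr_gt0 mulr_gt0//; lra.
have lam2 : lam ^+ 2 / 2 = N%:R * (eps / 4) + N%:R * h.
  rewrite sqr_sqrtr; last by rewrite mulr_ge0 ?ler0n//; lra.
  by field.
have key : Num.sqrt M%:R + lam < r * Num.sqrt k%:R.
  have sN : 0 < Num.sqrt N%:R :> R by rewrite sqrtr_gt0.
  have -> : Num.sqrt M%:R = Num.sqrt (M%:R / N%:R) * Num.sqrt N%:R :> R.
    by rewrite -sqrtrM ?divr_ge0 ?ler0n// divfK// gt_eqF.
  have -> : Num.sqrt k%:R = Num.sqrt (1 - p) * Num.sqrt N%:R.
    by rewrite -sqrtrM ?subr_ge0// kE.
  rewrite /lam (@sqrtrM _ N%:R) ?(ltW N0R)// [X in _ < X]mulrA [X in _ + X]mulrC -mulrDl ltr_pM2r//.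
  move: hyp; rewrite -/r -mulrA -/h => hyp.
  suff : Num.sqrt (eps / 2 + 2 * h) < Num.sqrt (eps + 2 * h) by lra.
  by rewrite ltr_sqrt; lra.
have sk0 : 0 < Num.sqrt k%:R :> R.
  have := sqrtr_ge0 (k%:R : R); rewrite le_eqVlt => /orP[/eqP k0|//].
  by move: key; rewrite -k0 mulr0 ltNge addr_ge0// ltW.
have k0 : (0 < k)%N by move: sk0; rewrite sqrtr_gt0 ltr0n.
have rk : r * Num.sqrt k%:R < Num.sqrt k%:R by rewrite gtr_pMl.
have lamk : lam <= Num.sqrt k%:R.
  by apply: ltW; apply: lt_trans rk; apply: le_lt_trans key; rewrite lerDr.
have SC : Num.sqrt M%:R + Num.sqrt k%:R + lam < C * (Num.sqrt k%:R - Num.sqrt M%:R - lam).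
  move: key; rewrite /r mulrAC ltr_pdivlMr//.
  move: (Num.sqrt M%:R) (Num.sqrt k%:R : R) => sm sk; clear; lra.
have kk : (0 < k <= N)%N by rewrite k0.
apply: le_trans (NERF_tail M0 kk kE C1 lam0 lamk SC iidF) _.
rewrite lee_fin lam2.
have hC := binomial_le_entropy p01 kN kE; rewrite -/h in hC.
have hk : k.+1%:R <= 2 * expR (ln N%:R) :> R.
  rewrite lnK ?posrE// -natrM ler_nat; apply: (@leq_trans N.+1); first by rewrite ltnS.
  by rewrite mul2n -addnn -addn1 leq_add2l.
have e0 : 0 <= expR (5 - (N%:R * (eps / 4) + N%:R * h)) by exact: expR_ge0.
apply: (@le_trans _ _ (expR (N%:R * h) * (2 * expR (ln N%:R) *
    expR (5 - (N%:R * (eps / 4) + N%:R * h))))).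
  by apply: ler_pM => //; apply: ler_wpM2r.
have lnq : (alpha + 1) * ln N%:R <= (alpha + 1) * ln q + N%:R * (eps / 4).
  have Nq : 0 < N%:R / q by rewrite divr_gt0.
  have := ln_le_self Nq; rewrite ln_div ?posrE// => lnNq.
  have : (alpha + 1) * (N%:R / q) = N%:R * (eps / 4).
    by rewrite /q; field; rewrite !gt_eqF.
  have : (alpha + 1) * (1 + (ln N%:R - ln q)) <= (alpha + 1) * (N%:R / q) by rewrite ler_pM2l.
  have := a1; move: (N%:R / q) (ln N%:R) (ln q) => x y z; nra.
rewrite /powR gt_eqF// -!mulrA mulrCA ler_pM2l// -!expRD ler_expR.
move: lnq; move: (ln N%:R) (ln q) => x y; lra.
Qed.
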